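(* Let $W$ be a TPWN. Then $ET_W$ is either $\infty$ or a rational number, and it can be computed in single exponential time: there is an algorithm and a polynomial $p$ such that, given $W$ of size $n$ with all weights and times written in binary, the algorithm determines whether $ET_W=\infty$ and otherwise outputs the rational $ET_W$, in time $O(2^{p(n)})$.
   Context: A workflow net is $N=(P,T,F,i,o)$: $P,T$ disjoint finite sets of places and transitions, $F\subseteq(P\times T)\cup(T\times P)$ arcs, $i$ has no incoming arcs, $o$ no outgoing arcs, and $(P\cup T,F\cup\{(o,i)\})$ is strongly connected. ${}^\bullet x=\{y:(y,x)\in F\}$, $x^\bullet=\{y:(x,y)\in F\}$, extended to sets by union. Markings, enabling, firing $M\xrightarrow{t}M'$ (remove one token from each place of ${}^\bullet t$, add one to each place of $t^\bullet$) as usual; $\mathbf{i}$ ($\mathbf{o}$) has a single token in $i$ (in $o$). 1-safe: every marking reachable from $\mathbf{i}$ has at most one token per place; such markings are identified with sets of places. Transitions are independent if their presets are disjoint, dependent otherwise; at a 1-safe marking $M$ two enabled transitions are concurrent if independent, in conflict if dependent; $C(t,M)$ = transitions in conflict with $t$ at $M$ (contains $t$); $\mathcal{C}(M)=\{C(t,M):t\text{ enabled at }M\}$. Confusion-free: for every reachable $M$, enabled $t$, and $u$ concurrent with $t$ at $M$: $C(u,M)=C(u,M\setminus{}^\bullet t)=C(u,(M\setminus{}^\bullet t)\cup t^\bullet)$. A TPWN is $W=(N,w,\tau)$ with $N$ a 1-safe confusion-free workflow net, $w:T\to\mathbb{Q}_{>0}$, $\tau:T\to\mathbb{N}$. Timing: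 $\mathbb{N}_\bot=\{\bot\}\cup\mathbb{N}$, $\bot\le x$, $\bot+x=\bot$; $upd(\vec x,t)_p=\max_{q\in{}^\bullet t}\vec x_q+\tau(t)$ if $p\in t^\bullet$, $\bot$ if $p\in{}^\bullet t\setminus t^\bullet$, $\vec x_p$ otherwise; $\mu(\epsilon)_i=0$, $\mu(\epsilon)_p=\bot$ for $p\ne i$, $\mu(\sigma t)=upd(\mu(\sigma),t)$; $\mathit{time}(\sigma)=\max_{p\in P}\mu(\sigma)_p$. MDP semantics: states are 1-safe markings $M$ and pairs $(M,t)$ with $t$ enabled at $M$; initial state $\mathbf{i}$. At $M$ with no enabled transition the only distribution is Dirac on $M$; otherwise there is one distribution per $C\in\mathcal{C}(M)$ giving $(M,t)$ probability $w(t)/\sum_{u\in C}w(u)$ for $t\in C$; from $(M,t)$ probability 1 goes to $M'$ with $M\xrightarrow{t}M'$. A scheduler $S$ picks an available distribution depending on the finite path so far, inducing the usual measure $\mathit{Prob}^S$ on infinite paths from $\mathbf{i}$. For an infinite path $\pi$, $\mathit{time}(\mathbf{o},\pi)=\infty$ if $\pi$ never visits $\mathbf{o}$, else $\mathit{time}$ of the transition sequence along the shortest prefix ending in $\mathbf{o}$. $ET^S_W$ is the expectation of $\mathit{time}(\mathbf{o},\cdot)$ under $\mathit{Prob}^S$; it does not depend on $S$, and $ET_W$ denotes this common value. *)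

(* Defs.v *)
From HB Require Import structures.
From mathcomp Require Import all_boot all_order all_algebra.
From mathcomp Require Import all_classical all_reals all_analysis.
Set Implicit Arguments.
Unset Strict Implicit.
Unset Printing Implicit Defensive.
Import Order.TTheory GRing.Theory Num.Theory.
Import numFieldNormedType.Exports.

Record net := Net {
  place : finType;
  trans : finType;
  arc_pt : place -> trans -> bool;
  arc_tp : trans -> place -> bool;
  src : place;
  snk : place
}.

Definition short_circuit (N : net) : rel (place N + trans N) := fun x y =>
  match x, y with
  | inl p, inr t => arc_pt p t
  | inr t, inl p => arc_tp t p
  | inl p, inl q => (p == snk N) && (q == src N)
  | inr _, inr _ => false
  end.

Definition is_workflow_net (N : net) : Prop :=
  [/\ forall t, ~~ arc_tp t (src N),
      forall t, ~~ arc_pt (snk N) t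
    & forall x y, connect (@short_circuit N) x y].

Definition preset (N : net) (t : trans N) : {set place N} :=
  [set p | arc_pt p t].
Definition postset (N : net) (t : trans N) : {set place N} :=
  [set p | arc_tp t p].

Definition marking (N : net) := {ffun place N -> nat}.

Definition enabled (N : net) (m : marking N) (t : trans N) : bool :=
  [forall p in preset t, 0 < m p].

Definition fire (N : net) (m : marking N) (t : trans N) : marking N :=
  [ffun p => m p - (p \in preset t) + (p \in postset t)].

Definition marking_of (N : net) (A : {set place N}) : marking N :=
  [ffun p => nat_of_bool (p \in A)].

Inductive reachable (N : net) : marking N -> Prop :=
| reachable_init : reachable (marking_of [set src N])
| reachable_fire m t : reachable m -> enabled m t -> reachable (fire m t).

Definition one_safe (N : net) : Prop :=
  forall m : marking N, reachable m -> forall p, m p <= 1.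

(* From here on 1-safe markings are identified with sets of places; the two
   lemmas relate the set operations to those on token counts. *)
Definition senabled (N : net) (A : {set place N}) (t : trans N) : bool :=
  preset t \subset A.

Definition sfire (N : net) (A : {set place N}) (t : trans N) : {set place N} :=
  (A :\: preset t) :|: postset t.

Lemma senabledE (N : net) (A : {set place N}) (t : trans N) :
  enabled (marking_of A) t = senabled A t.
Proof.
rewrite /senabled.
apply/forall_inP/fintype.subsetP => H p /H; rewrite ffunE; last by move->.
by case: (p \in A).
Qed.

Lemma sfireE (N : net) (A : {set place N}) (t : trans N) :
  one_safe N -> reachable (marking_of A) -> senabled A t ->
  fire (marking_of A) t = marking_of (sfire A t).
Proof.
move=> safe rA; rewrite -senabledE => en; apply/ffunP => p.
have := safe _ (reachable_fire rA en) p.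
rewrite !ffunE !inE; case: (_ \in A); case: (arc_pt _ _); by case: (arc_tp _ _).
Qed.

Definition dependent (N : net) (t u : trans N) : bool :=
  ~~ [disjoint preset t & preset u].

Definition conflict_set (N : net) (t : trans N) (A : {set place N})
  : {set trans N} :=
  [set u | senabled A u && dependent t u].

Definition conflict_sets (N : net) (A : {set place N}) : {set {set trans N}} :=
  [set conflict_set t A | t in [pred t | senabled A t]].

Definition confusion_free (N : net) : Prop :=
  forall (A : {set place N}) (t u : trans N),
    reachable (marking_of A) -> senabled A t -> senabled A u ->
    ~~ dependent t u ->
    conflict_set u A = conflict_set u (A :\: preset t) /\
    conflict_set u A = conflict_set u (sfire A t).

Lemma preset_neq0 (N : net) (t : trans N) :
  is_workflow_net N -> exists p, arc_pt p t.
Proof.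
case=> _ _ /(_ (inl (src N)) (inr t)) /connectP[s].
case/lastP: s => // s x; rewrite rcons_path last_rcons => /andP[_ e] tx.
by move: e; rewrite -tx; case: last => //= p; exists p.
Qed.

Lemma dependent_refl (N : net) (t : trans N) :
  is_workflow_net N -> dependent t t.
Proof.
move=> /preset_neq0 wf; have [p pt] := wf t; apply/negP => /pred0P /(_ p) /=.
by rewrite !inE pt.
Qed.

Record tpwn := TPWN {
  tnet :> net;
  weight : trans tnet -> rat;
  duration : trans tnet -> nat;
  tpwn_workflow : is_workflow_net tnet;
  tpwn_one_safe : one_safe tnet;
  tpwn_confusion_free : confusion_free tnet;
  weight_gt0 : forall t, (0 < weight t)%R
}.

(* N_bot is option nat, None being the bottom element. *)
Definition bmax (x y : option nat) : option nat :=
  match x, y with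
  | None, _ => y
  | _, None => x
  | Some a, Some b => Some (maxn a b)
  end.

Definition timestamp (W : tpwn) := {ffun place W -> option nat}.

Definition upd (W : tpwn) (x : timestamp W) (t : trans W) : timestamp W :=
  [ffun p => if p \in postset t then
               omap (addn^~ (duration t)) (\big[bmax/None]_(q in preset t) x q)
             else if p \in preset t then None else x p].

Definition timestamps (W : tpwn) (sigma : seq (trans W)) : timestamp W :=
  foldl (@upd W) [ffun p => if p == src W then Some 0 else None] sigma.

Definition time (W : tpwn) (sigma : seq (trans W)) : option nat :=
  \big[bmax/None]_(p : place W) timestamps sigma p.

(* Model of computation: the language WHILE over binary trees (N. D. Jones,
   Computability and Complexity, 1997). Its unit-cost time, which counts the
   elementary operations executed, is polynomially related to Turing machine
   time; there is no tree comparison, only the test for Leaf. *)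
Inductive tree := Leaf | Node of tree & tree.

Inductive expr :=
| Var of nat
| Nil
| Cons of expr & expr
| Hd of expr
| Tl of expr.

Inductive cmd :=
| Assign of nat & expr
| Seq of cmd & cmd
| If of expr & cmd & cmd
| While of expr & cmd.

Definition store := nat -> tree.

Definition set_var (s : store) (x : nat) (v : tree) : store :=
  fun y => if y == x then v else s y.

Fixpoint eval (s : store) (e : expr) : tree :=
  match e with
  | Var x => s x
  | Nil => Leaf
  | Cons e1 e2 => Node (eval s e1) (eval s e2)
  | Hd e1 => if eval s e1 is Node a _ then a else Leaf
  | Tl e1 => if eval s e1 is Node _ b then b else Leaf
  end.

Fixpoint expr_cost (e : expr) : nat :=
  match e with
  | Var _ | Nil => 1
  | Cons e1 e2 => (expr_cost e1 + expr_cost e2).+1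
  | Hd e1 | Tl e1 => (expr_cost e1).+1
  end.

Inductive exec : cmd -> store -> store -> nat -> Prop :=
| exec_assign s x e :
    exec (Assign x e) s (set_var s x (eval s e)) (expr_cost e).+1
| exec_seq c1 c2 s1 s2 s3 k1 k2 :
    exec c1 s1 s2 k1 -> exec c2 s2 s3 k2 -> exec (Seq c1 c2) s1 s3 (k1 + k2)
| exec_if_true e c1 c2 s s' k :
    eval s e <> Leaf -> exec c1 s s' k ->
    exec (If e c1 c2) s s' ((expr_cost e).+1 + k)
| exec_if_false e c1 c2 s s' k :
    eval s e = Leaf -> exec c2 s s' k ->
    exec (If e c1 c2) s s' ((expr_cost e).+1 + k)
| exec_while_true e c s1 s2 s3 k1 k2 :
    eval s1 e <> Leaf -> exec c s1 s2 k1 -> exec (While e c) s2 s3 k2 ->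
    exec (While e c) s1 s3 ((expr_cost e).+1 + k1 + k2)
| exec_while_false e c s :
    eval s e = Leaf -> exec (While e c) s s (expr_cost e).+1.

(* Input and output are in variable 0; the other variables are initially
   Leaf. *)
Definition computes_within (c : cmd) (input output : tree) (bound : nat)
  : Prop :=
  exists s k, exec c (set_var (fun=> Leaf) 0 input) s k /\
              s 0 = output /\ k <= bound.

Fixpoint tree_size (d : tree) : nat :=
  if d is Node a b then (tree_size a + tree_size b).+1 else 1.

Definition enc_seq (T : Type) (enc : T -> tree) (s : seq T) : tree :=
  foldr (fun x d => Node (enc x) d) Leaf s.

Definition enc_bool (b : bool) : tree := if b then Node Leaf Leaf else Leaf.

(* Binary expansion, least significant bit first. *)
Definition nat_bits (n : nat) : seq bool :=
  mkseq (fun i => odd (n %/ 2 ^ i)) (up_log 2 n.+1).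

Definition enc_nat (n : nat) : tree := enc_seq enc_bool (nat_bits n).

(* Only used for nonnegative rationals, so the sign is not recorded. *)
Definition enc_rat (q : rat) : tree :=
  Node (enc_nat `|numq q|%N) (enc_nat `|denq q|%N).

Definition enc_set (T : finType) (A : {set T}) : tree :=
  enc_seq (fun x => enc_bool (x \in A)) (enum T).

Definition enc_trans (W : tpwn) (t : trans W) : tree :=
  Node (Node (enc_set (preset t)) (enc_set (postset t)))
       (Node (enc_rat (weight t)) (enc_nat (duration t))).

Definition enc_tpwn (W : tpwn) : tree :=
  Node (Node (enc_set [set src W]) (enc_set [set snk W]))
       (enc_seq (@enc_trans W) (enum (trans W))).

Local Open Scope classical_set_scope.
Local Open Scope ring_scope.

Definition dirac_dist (R : realType) (Q : finType) (q : Q) : Q -> R :=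
  fun q' => (q' == q)%:R.

Definition is_dist (R : realType) (Q : finType) (d : Q -> R) : Prop :=
  (forall q, 0 <= d q) /\ \sum_q d q = 1.

Record mdp (R : realType) := MDP {
  mstate :> finType;
  minit : mstate;
  msteps : mstate -> set (mstate -> R);
  msteps_dist : forall q d, msteps q d -> is_dist d;
  msteps_neq0 : forall q, msteps q !=set0
}.

(* Values on sequences that are not paths of the MDP are irrelevant. *)
Record scheduler (R : realType) (M : mdp R) := Scheduler {
  sched_dist :> seq M -> M -> R;
  sched_ok : forall h q, msteps q (sched_dist (rcons h q))
}.

Lemma scheduler_exists (R : realType) (M : mdp R) : inhabited (scheduler M).
Proof.
pose f (h : seq M) : M -> R := projT1 (cid (msteps_neq0 (last (minit M) h))).
have fP h q : msteps q (f (rcons h q)).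
  by rewrite /f last_rcons; case: cid.
exact: (inhabits (Scheduler fP)).
Qed.

Definition mdp_path (R : realType) (M : mdp R) := nat -> M.

HB.instance Definition _ (R : realType) (M : mdp R) :=
  gen_eqMixin (mdp_path M).
HB.instance Definition _ (R : realType) (M : mdp R) :=
  gen_choiceMixin (mdp_path M).
HB.instance Definition _ (R : realType) (M : mdp R) :=
  isPointed.Build (mdp_path M) (fun=> minit M).

Definition cylinder (R : realType) (M : mdp R) (s : seq M) : set (mdp_path M) :=
  [set pi | mkseq pi (size s) = s].

Definition path_space (R : realType) (M : mdp R) :=
  g_sigma_algebraType (range (@cylinder R M)).

(* The law of the next state given the finite path so far; before the first
   state it is the Dirac distribution on the initial state. *)
Definition next_dist (R : realType) (M : mdp R) (S : scheduler M) (h : seq M)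
  : M -> R := if h is [::] then dirac_dist R (minit M) else S h.

Definition prefix_prob (R : realType) (M : mdp R) (S : scheduler M)
  (s : seq M) : R :=
  \prod_(k < size s) next_dist S (take k s) (nth (minit M) s k).

Section Sampling.
Variables (R : realType) (M : mdp R) (S : scheduler M).
Let K := next_dist S.
Let q0 := minit M.

Lemma next_dist_dist h : is_dist (K h).
Proof.
case: (lastP h) => [|{}h q].
  split=> [q|]; rewrite /K /= /dirac_dist; first by case: eqP.
  rewrite (bigD1 (minit M)) //= eqxx big1 ?addr0 // => q /negPf ->.
  by [].
rewrite /K; have := msteps_dist (sched_ok S h q).
by case: h.
Qed.

Local Notation pr := (prefix_prob S).

Lemma prefix_prob_nil : pr [::] = 1.
Proof. by rewrite /prefix_prob big_ord0. Qed.

Lemma prefix_prob_rcons h q : pr (rcons h q) = pr h * K h q.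
Proof.
rewrite /prefix_prob size_rcons big_ord_recr /=; congr (_ * _).
  apply: eq_bigr => i _.
  by rewrite nth_rcons ltn_ord -cats1 takel_cat // ltnW.
by rewrite nth_rcons ltnn eqxx -cats1 takel_cat // take_size.
Qed.

Lemma prefix_prob_ge0 s : 0 <= pr s.
Proof. by apply: prodr_ge0 => i _; apply: (next_dist_dist _).1. Qed.

(* Existence of the path measure: a point x of [0, 1[ is mapped to the path
   obtained by repeatedly subdividing [0, 1[ according to the kernel. *)
Let cum h (n : nat) : R := \sum_(q : M | (enum_rank q < n)%N) K h q.

Let cum0 h : cum h 0 = 0.
Proof. by rewrite /cum big1. Qed.

Let cumS h (q : M) : cum h (enum_rank q).+1 = cum h (enum_rank q) + K h q.
Proof.
rewrite /cum (bigD1 q) //= addrC; congr (_ + _); apply: eq_bigl => q'.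
by rewrite ltnS ltn_neqAle andbC (inj_eq val_inj) (inj_eq enum_rank_inj).
Qed.

Let cum1 h : cum h #|M| = 1.
Proof.
rewrite /cum -(next_dist_dist h).2; apply: eq_bigl => q.
by rewrite ltn_ord.
Qed.

Let cum_le h m n : (m <= n)%N -> cum h m <= cum h n.
Proof.
move=> mn; rewrite /cum [leRHS](bigID (fun q => (enum_rank q < m)%N)) /=.
rewrite [in leLHS](eq_bigl (fun q => (enum_rank q < n) && (enum_rank q < m))%N).
  by rewrite lerDl; apply: sumr_ge0 => q _; exact: (next_dist_dist h).1.
move=> q; apply/idP/andP => [lt|[]//]; split=> //; exact: leq_trans lt mn.
Qed.

Fixpoint lo_aux (h s : seq M) : R :=
  if s is q :: s' then pr h * cum h (enum_rank q) + lo_aux (rcons h q) s'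
  else 0.
Let lo := lo_aux [::].

Let lo_aux_rcons h s q :
  lo_aux h (rcons s q) = lo_aux h s + pr (h ++ s) * cum (h ++ s) (enum_rank q).
Proof.
elim: s h => [|a s IH] h /=; first by rewrite cats0 addr0 add0r.
by rewrite IH -addrA cat_rcons.
Qed.

Let lo_rcons s q : lo (rcons s q) = lo s + pr s * cum s (enum_rank q).
Proof. exact: lo_aux_rcons. Qed.

Let I (s : seq M) (x : R) := (lo s <= x) && (x < lo s + pr s).

Let I_rcons s q x : I (rcons s q) x -> I s x.
Proof.
rewrite /I lo_rcons prefix_prob_rcons -addrA -mulrDr -cumS => /andP[a b].
apply/andP; split.
  apply: le_trans a; rewrite lerDl mulr_ge0 ?prefix_prob_ge0 //.
  by rewrite -(cum0 s) cum_le.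
apply: (lt_le_trans b); rewrite lerD2l ler_piMr ?prefix_prob_ge0 //.
by rewrite -(cum1 s) cum_le // ltn_ord.
Qed.

Let I_inj s q q' x : I (rcons s q) x -> I (rcons s q') x -> q = q'.
Proof.
have key u v : (enum_rank u < enum_rank v)%N ->
    I (rcons s u) x -> I (rcons s v) x -> u = v.
  move=> uv; rewrite /I !lo_rcons !prefix_prob_rcons.
  rewrite -!addrA -!mulrDr -!cumS => /andP[_ a] /andP[b _].
  have := le_lt_trans b a; rewrite ltrD2l => c.
  have : pr s * cum s (enum_rank u).+1 <= pr s * cum s (enum_rank v).
    by rewrite ler_wpM2l ?prefix_prob_ge0 ?cum_le.
  by rewrite leNgt c.
move=> Iq Iq'; case: (ltngtP (enum_rank q) (enum_rank q')) => [lt|gt|/val_inj].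
- exact: key.
- by apply/esym; apply: key.
- exact: enum_rank_inj.
Qed.

Let I_next s x : I s x -> exists q, I (rcons s q) x.
Proof.
move=> /andP[a b].
pose P n := x < lo s + pr s * cum s n.
have exP : exists n, P n by exists #|M|; rewrite /P cum1 mulr1.
have := ex_minnP exP; case=> [[|m]]; rewrite /P.
  by rewrite cum0 mulr0 addr0 ltNge a.
move=> Pm min.
have mM : (m < #|M|)%N by apply: min; rewrite cum1 mulr1.
pose q := enum_val (Ordinal mM).
have rq : enum_rank q = Ordinal mM by rewrite enum_valK.
exists q; rewrite /I lo_rcons prefix_prob_rcons -addrA -mulrDr -cumS rq Pm andbT.
by rewrite leNgt; apply/negP => /min; rewrite ltnn.
Qed.

Let hist (x : R) : nat -> seq M :=
  fix hist n := if n is n'.+1 then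
    rcons (hist n') (odflt q0 [pick q | I (rcons (hist n') q) x]) else [::].

Let size_hist x n : size (hist x n) = n.
Proof. by elim: n => //= n IH; rewrite size_rcons IH. Qed.

Let sample (x : R) : mdp_path M := fun n => last q0 (hist x n.+1).

Let hist_sample x n : mkseq (sample x) n = hist x n.
Proof.
elim: n => // n IH; rewrite /mkseq -addn1 iotaD map_cat -/(mkseq _ _) IH /=.
by rewrite cats1 add0n /sample /= last_rcons addn1.
Qed.

Let I_hist x n : I [::] x -> I (hist x n) x.
Proof.
move=> I0; elim: n => //= n IH; case: pickP => //= F.
by have [q] := I_next IH; rewrite F.
Qed.

Let hist_uniq x s : I s x -> hist x (size s) = s.
Proof.
elim/last_ind: s => // s q IH Isq; rewrite size_rcons /= (IH (I_rcons Isq)).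
case: pickP => [q' /= Iq'|/(_ q)]; last by rewrite Isq.
by congr rcons; exact: I_inj Iq' Isq.
Qed.

Let I_nil x s : I s x -> I [::] x.
Proof. by elim/last_ind: s => // s q IH /I_rcons. Qed.

Let sample_cyl s :
  sample @^-1` cylinder s `&` [set x | I [::] x] = [set x | I s x].
Proof.
apply/seteqP; split=> x /=; rewrite /cylinder /= hist_sample.
  by move=> [e I0]; rewrite -e; exact: I_hist.
by move=> Is; split; [exact: hist_uniq|exact: I_nil Is].
Qed.

Let Iset s : [set x | I s x] = `[lo s, lo s + pr s[%classic.
Proof. by apply/seteqP; split=> x; rewrite /= in_itv. Qed.

Let measurable_Iset s : measurable [set x | I s x].
Proof. by rewrite Iset; exact: measurable_itv. Qed.

Let hist_out x y n : ~ I [::] x -> ~ I [::] y -> hist x n = hist y n.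
Proof.
move=> nx ny; elim: n => //= n ->; congr rcons.
by case: pickP => [q /I_nil //|_]; case: pickP => [q /I_nil //|_].
Qed.

Let measurable_sample : 
  measurable_fun setT (sample : measurableTypeR R -> path_space M).
Proof.
apply: (@measurability _ _ _ _ setT
  (sample : measurableTypeR R -> path_space M) (range (@cylinder R M)) erefl).
move=> _ [_ [s _ <-] <-]; rewrite setTI.
rewrite -(setIT (sample @^-1` _)) -(setUv [set x | I [::] x]) setIUr.
rewrite sample_cyl; apply: measurableU; first exact: measurable_Iset.
have [[x [nx e]]|F] := pselect (exists x, ~ I [::] x /\ cylinder s (sample x)).
  rewrite (_ : _ `&` _ = ~` [set x | I [::] x]).
    by apply: measurableC; exact: measurable_Iset.
  apply/seteqP; split=> [y []//|y ny]; split=> //.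
  move: e; rewrite /cylinder /= !hist_sample => {2}<-; exact: hist_out.
rewrite (_ : _ `&` _ = set0) //; apply/seteqP; split=> // x [a b].
by apply: F; exists x.
Qed.

Let mu := mrestr (@lebesgue_measure R) (measurable_Iset [::]).
Lemma path_measure_exists : exists P : probability (path_space M) R,
  forall s, P (cylinder s) = (prefix_prob S s)%:E.
Proof.
have [nu nuP] : exists nu : {measure set (path_space M) -> \bar R},
    forall A, nu A = mu (sample @^-1` A).
  unshelve eexists.
    refine [the {measure set (path_space M) -> \bar R} of
      pushforward mu (sample : measurableTypeR R -> path_space M)].
    exact: measurable_sample.
  by [].
have nuE s : nu (cylinder s) = (pr s)%:E.
  rewrite nuP /mu /mrestr sample_cyl Iset lebesgue_measure_itv.
  rewrite /= lte_fin ltrDl; case: ltP => [_|p0].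
    by rewrite -EFinB addrAC subrr add0r.
  by congr EFin; apply/eqP; rewrite eq_le prefix_prob_ge0.
have nuT : nu setT = 1%E.
  have -> : [set: path_space M] = cylinder [::] by apply/seteqP; split.
  by rewrite nuE prefix_prob_nil.
exists [the probability _ _ of
  mnormalize nu (dirac (point : path_space M))] => s.
by rewrite /= /mnormalize nuT /= onee_eq0 /= invr1 mule1 nuE.
Qed.

Lemma path_measure_unique (P1 P2 : probability (path_space M) R) :
  (forall s, P1 (cylinder s) = P2 (cylinder s)) ->
  forall A, measurable A -> P1 A = P2 A.
Proof.
move=> E A mA.
pose G : set (set (path_space M)) := range (@cylinder R M) `|` [set set0].
have mG : G `<=` measurable.
  by move=> _ [[s _ <-]| ->] //; apply: sub_sigma_algebra; exists s.
have cylI s t : G (cylinder s `&` cylinder t).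
  wlog st : s t / (size s <= size t)%N.
    by move=> W; case: (leqP (size s) (size t)) => [/W|/ltnW /W]; rewrite 1?setIC.
  have [e|ne] := eqVneq (take (size s) t) s.
    left; exists t => //; apply/seteqP; split=> [pi|pi []//].
    rewrite /cylinder /= => pit; split=> //=.
    rewrite -[RHS]e -pit; apply: (@eq_from_nth _ (minit M)).
      by rewrite size_takel !size_mkseq.
    move=> i; rewrite size_mkseq => il; rewrite nth_take // !nth_mkseq //.
    exact: leq_trans il st.
  right; apply/seteqP; split=> // pi []; rewrite /cylinder /= => pis pit.
  case/eqP: ne; rewrite -pit -[RHS]pis /mkseq -map_take take_iota.
  by rewrite (minn_idPl st).
have GI : setI_closed G.
  move=> _ _ [[s _ <-]| ->] [[t _ <-]| ->]; rewrite ?setI0 ?set0I; try by right.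
  exact: cylI.
apply: (@g_sigma_algebra_measure_unique _ _ _ G mG (fun=> setT)) => //.
- by move=> i; left; exists [::] => //; apply/seteqP.
- by apply/seteqP; split=> // x _; exists 0%N.
- by move=> _ [[s _ <-]| ->]; [exact: E | rewrite !measure0].
- by move=> k; rewrite [ltLHS](probability_setT P1) ltry.
- apply: (@sub_smallest2r _ _ (range (@cylinder R M)) G) mA => //.
  by move=> B; left.
Qed.

End Sampling.

(* The path measure, which exists and is unique by the two lemmas above. *)
Definition path_prob (R : realType) (M : mdp R) (S : scheduler M)
  : probability (path_space M) R := projT1 (cid (path_measure_exists S)).

Lemma path_prob_cylinder (R : realType) (M : mdp R) (S : scheduler M) s :
  path_prob S (cylinder s) = (prefix_prob S s)%:E.
Proof. exact: (projT2 (cid (path_measure_exists S))). Qed.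

Definition net_state (N : net) : finType :=
  ({set place N} + {x : {set place N} * trans N | senabled x.1 x.2})%type.

Section NetMDP.
Variables (R : realType) (W : tpwn).

Definition choice_dist (A : {set place W}) (C : {set trans W})
  : net_state W -> R := fun s =>
  if s is inr x then
    if ((val x).1 == A) && ((val x).2 \in C)
    then ratr (weight (val x).2 / \sum_(u in C) weight u) else 0
  else 0.

Definition net_steps (s : net_state W) : set (net_state W -> R) :=
  match s with
  | inl A => if [exists t, senabled A t]
             then [set d | exists2 C, C \in conflict_sets A
                                    & d = choice_dist A C]
             else [set dirac_dist R s]
  | inr x => [set dirac_dist R (inl (sfire (val x).1 (val x).2))]
  end.

Lemma dirac_dist_dist (Q : finType) (q : Q) : is_dist (dirac_dist R q).
Proof.
split=> [q'|]; rewrite /dirac_dist; first by case: eqP.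
rewrite (bigD1 q) //= eqxx big1 ?addr0 // => q' /negPf ->.
by [].
Qed.

Lemma choice_dist_dist A C :
  C \in conflict_sets A -> is_dist (choice_dist A C).
Proof.
case/imsetP => t; rewrite inE => tA ->.
set C' := conflict_set t A; pose w := \sum_(u in C') weight u.
have w_gt0 u : u \in C' -> 0 < w.
  move=> uC; rewrite /w (bigD1 u) //= ltr_wpDr ?weight_gt0 //.
  by apply: sumr_ge0 => v _; exact/ltW/weight_gt0.
have tC : t \in C' by rewrite inE tA dependent_refl //; exact: tpwn_workflow.
have w0 : w != 0 by rewrite gt_eqF // (w_gt0 t).
split=> [[B|x]|] //=.
  by case: ifP => // /andP[_ /w_gt0 ?]; rewrite ler0q divr_ge0 // ltW // weight_gt0.
rewrite big_sumType /= big1 // add0r.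
rewrite -big_mkcond /=; transitivity (\sum_(u in C') ratr (weight u / w) : R).
  rewrite [RHS](reindex_omap
    (fun x : {x : {set place W} * trans W | senabled x.1 x.2} => (val x).2)
    (fun u => insub (A, u))) /=; last first.
    by move=> u; rewrite inE => /andP[uA _]; rewrite insubT.
  apply: eq_bigl => -[[B u] /= Bu]; rewrite andbC; congr (_ && _).
  apply/eqP/eqP => [BA|].
    by subst B; rewrite insubT; congr Some; exact: val_inj.
  by case: insubP => // y _ yE [] /(congr1 val); rewrite yE => -[].
by rewrite -rmorph_sum /= -mulr_suml divff //; exact: rmorph1.
Qed.

Lemma net_steps_dist s d : net_steps s d -> is_dist d.
Proof.
case: s => [A|x] /=; last by move->; exact: dirac_dist_dist.
by case: ifP => _ => [[C /choice_dist_dist ? ->]|->] //; exact: dirac_dist_dist.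
Qed.

Lemma net_steps_neq0 s : net_steps s !=set0.
Proof.
case: s => [A|x] /=; last by eexists.
case: ifP => [/existsP[t tA]|_]; last by eexists.
exists (choice_dist A (conflict_set t A)); exists (conflict_set t A) => //.
by apply: imset_f; rewrite inE.
Qed.

Definition net_mdp : mdp R :=
  @MDP R (net_state W) (inl [set src W]%SET) net_steps
       net_steps_dist net_steps_neq0.

End NetMDP.

Definition fired (W : tpwn) (s : seq (net_state W)) : seq (trans W) :=
  pmap (fun q => if q is inr x then Some (val x).2 else None) s.

(* On a path of the MDP reaching the marking, time is not None, so the default
   value 0 is immaterial. *)
Definition time_to_snk (R : realType) (W : tpwn) (pi : path_space (net_mdp R W))
  : \bar R :=
  if pselect (exists n, pi n == inl [set snk W]%SET) is left ex then
    (odflt 0%N (time (fired (mkseq pi (ex_minn ex).+1))))%:R%:E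
  else +oo%E.

Definition sched_ET (R : realType) (W : tpwn) (S : scheduler (net_mdp R W))
  : \bar R := (\int[path_prob S]_pi time_to_snk pi)%E.

Definition is_ET (R : realType) (W : tpwn) (e : \bar R) : Prop :=
  forall S : scheduler (net_mdp R W), sched_ET S = e.

Lemma is_ET_unique (R : realType) (W : tpwn) (e e' : \bar R) :
  is_ET W e -> is_ET W e' -> e = e'.
Proof.
by move=> h h'; have [S] := scheduler_exists (net_mdp R W); rewrite -(h S); exact: h'.
Qed.

(* None stands for an infinite expected time. *)
Definition enc_ET (v : option rat) : tree :=
  if v is Some q then enc_rat q else Leaf.

Definition ET_value (R : realType) (v : option rat) : \bar R :=
  if v is Some q then (ratr q)%:E else +oo%E.

(* Main.v *)
Require Import Defs.
From HB Require Import structures.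
From mathcomp Require Import all_boot all_order all_algebra.
From mathcomp Require Import all_classical all_reals all_analysis.
From mathcomp Require Import measurable_realfun zify ring lra.
Set Implicit Arguments.
Unset Strict Implicit.
Unset Printing Implicit Defensive.
Import Order.TTheory GRing.Theory Num.Theory.
(* Once more, for the constructors of expr and the semantics of WHILE that
   the other libraries shadow. *)
Import Defs.

(* In a 1-safe confusion-free net, two conflicting transitions t and u enabled
   at a timestamp start at the same time. Indeed let w have produced a token of
   t. The transitions fired since then that are not caused by w can be fired
   before w, and after that confusion-freeness gives u an input token caused
   by w, so that u does not start before w ends.

   Since concurrent choices commute, the expectation does not depend on the
   scheduler and one may always resolve the conflict set that starts first.
   Measured from that start, timestamps are at most the longest duration H, so
   that at most (H + 2) ^ |P| of them are reachable: a finite Markov reward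
   chain, of exponential size. The expected time is infinite iff some reachable
   state cannot reach the final marking, which is when the elimination of
   states meets a zero pivot; otherwise it is the result of the elimination.
   By Cramer's rule all intermediate numbers have a size polynomial in that of
   the linear system. *)

(** * Polynomial-time functions *)

(** Along a run timestamps grow without bound, and a waiting token may lie arbitrarily far behind
    the current start. The chain is finite because subtraction truncates: a token older than the
    clock is dated 0, which loses nothing, as no later firing starts before the clock. The clock is
    the start common to a whole conflict set. Without that equality a member starting later than the
    others could produce a token dated beyond the longest duration.

    Running times are derived from a class of functions closed under composition and under folds
    whose intermediate values stay small. For the elimination these values are bounded by means of
    the stochasticity of the rows, hence only for systems that come from a net. The functions
    concerned are therefore taken over a type whose elements are the nets themselves, encoded
    together with a padding of exponential length. *)

Definition pbounded (g : nat -> nat) : Prop :=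
  exists e, forall n, g n <= (n + 2) ^ e.

(** The base [n + 2] is at least 2, so that powers absorb constants, and sums as well. *)
Lemma pbounded_const c : pbounded (fun=> c).
Proof.
exists c => n; apply: leq_trans (_ : 2 ^ c <= _); first exact/ltnW/ltn_expl.
by case: c => // c; rewrite leq_exp2r // leq_addl.
Qed.

Lemma pbounded_exp e : pbounded (fun n => (n + 2) ^ e).
Proof. by exists e. Qed.

Lemma pbounded_id : pbounded id.
Proof. by exists 1 => n; rewrite expn1 leq_addr. Qed.

Lemma pbounded_mul g h : pbounded g -> pbounded h -> pbounded (fun n => g n * h n).
Proof. by move=> [a ga] [b hb]; exists (a + b) => n; rewrite expnD leq_mul. Qed.

Lemma pbounded_add g h : pbounded g -> pbounded h -> pbounded (fun n => g n + h n).
Proof.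
move=> [a ga] [b hb]; exists (a + b).+1 => n; rewrite expnS.
have p e : 0 < (n + 2) ^ e by rewrite expn_gt0 addn2.
apply: leq_trans (_ : 2 * (n + 2) ^ (a + b) <= _); last by rewrite leq_mul // leq_addl.
rewrite mul2n -addnn leq_add // ?(leq_trans (ga n)) ?(leq_trans (hb n)) //.
  by rewrite expnD leq_pmulr.
by rewrite expnD leq_pmull.
Qed.

Lemma pbounded_pow g e : pbounded g -> pbounded (fun n => g n ^ e).
Proof.
move=> [a ga]; exists (a * e) => n; rewrite expnM.
by case: e => // e; rewrite leq_exp2r.
Qed.

Lemma pbounded_le g h : (forall n, g n <= h n) -> pbounded h -> pbounded g.
Proof. by move=> gh [e he]; exists e => n; apply: leq_trans (he n). Qed.

Lemma pbounded_S g : pbounded g -> pbounded (fun n => (g n).+1).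
Proof.
move=> h; apply: (@pbounded_le _ (fun n => g n + 1)); first by move=> n; rewrite addn1.
exact: pbounded_add h (pbounded_const 1).
Qed.

Ltac pbound :=
  repeat first [ exact: pbounded_id | exact: pbounded_const | exact: pbounded_exp
    | assumption
    | apply: pbounded_S | apply: pbounded_add | apply: pbounded_mul
    | apply: pbounded_pow ].

(** An encoding is any map to trees, so that an input type may be richer than what a program reads
    off the code, as is the case for [padded_encType]. *)
Structure encType := EncType { enc_sort :> Type; enc_of : enc_sort -> tree }.
Definition enc (T : encType) (x : T) : tree := enc_of x.

Canonical bool_encType := EncType enc_bool.
Canonical nat_encType := EncType enc_nat.
Canonical tree_encType := EncType (@id tree).
Definition enc_pair (T U : encType) (x : T * U) : tree := Node (enc x.1) (enc x.2).
Canonical prod_encType (T U : encType) := EncType (@enc_pair T U).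
Definition enc_option (T : encType) (o : option T) : tree :=
  if o is Some x then Node Leaf (enc x) else Leaf.
Canonical option_encType (T : encType) := EncType (@enc_option T).
Canonical seq_encType (T : encType) := EncType (enc_seq (@enc T)).

Definition sz (T : encType) (x : T) := tree_size (enc x).
Arguments sz {T} x : simpl never.

Lemma sz_gt0 (T : encType) (x : T) : 0 < sz x.
Proof. by rewrite /sz; case: (enc x). Qed.

Lemma sz_pair (T U : encType) (x : T * U) : sz x = (sz x.1 + sz x.2).+1.
Proof. by []. Qed.

Lemma sz_nil (T : encType) : sz (@nil T) = 1.
Proof. by []. Qed.

Lemma sz_cons (T : encType) (x : T) s : sz (x :: s) = (sz x + sz s).+1.
Proof. by []. Qed.

Lemma sz_cat (T : encType) (s t : seq T) : sz (s ++ t) + 1 = sz s + sz t.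
Proof. elim: s => [|x s IH]; rewrite /= ?sz_cons ?sz_nil; lia. Qed.

Lemma sz_rcons (T : encType) (s : seq T) x : sz (rcons s x) = (sz s + sz x).+1.
Proof. have := sz_cat s [:: x]; rewrite cats1 sz_cons sz_nil; lia. Qed.

Lemma sz_take (T : encType) (s : seq T) i : sz (take i s) <= sz s.
Proof. by have := sz_cat (take i s) (drop i s); have := sz_gt0 (drop i s); rewrite cat_take_drop; lia. Qed.

Lemma size_le_sz (T : encType) (s : seq T) : size s < sz s.
Proof. elim: s => //= x s IH; rewrite sz_cons; have := sz_gt0 x; lia. Qed.

Lemma sz_Some (T : encType) (x : T) : sz (Some x) = (sz x).+2.
Proof. by []. Qed.

Lemma sz_bool (b : bool) : sz b <= 3.
Proof. by case: b. Qed.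

(* [c] uses only the variables below [m] and may find garbage in those other
   than 0: this makes programs composable. *)
Definition implements (A B : encType) (c : cmd) (m : nat) (f : A -> B)
    (cost : A -> nat) : Prop :=
  forall (a : A) (s : store), s 0 = enc a -> exists s' k,
    [/\ exec c s s' k, s' 0 = enc (f a), forall y, m <= y -> s' y = s y & k <= cost a].
Arguments implements {A B} c m f cost.

(* An inductive type rather than a definition, so that unification does not
   look for matches up to the unfolding of the encodings. *)
Inductive FP (A B : encType) (f : A -> B) : Prop := FPI of
  exists c m g h, [/\ pbounded g, pbounded h,
    implements c m f (fun a => g (sz a)) & forall a, sz (f a) <= h (sz a)].
Arguments FP {A B} f.

Lemma FPE (A B : encType) (f : A -> B) : FP f -> exists c m e,
  implements c m f (fun a => (sz a + 2) ^ e) /\ forall a, sz (f a) <= (sz a + 2) ^ e.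
Proof.
move=> [[c [m [g [h [[e1 H1] [e2 H2] H3 H4]]]]]]; exists c, m, (e1 + e2).
have le (a : A) : (sz a + 2) ^ e1 <= (sz a + 2) ^ (e1 + e2) /\ (sz a + 2) ^ e2 <= (sz a + 2) ^ (e1 + e2).
  by rewrite !leq_exp2l ?leq_addr ?leq_addl // addn2.
split=> a; last by rewrite (leq_trans (H4 a)) ?(leq_trans (H2 _)) // (le a).2.
move=> s /H3 [s' [k [? ? ? ?]]]; exists s', k; split=> //.
by rewrite (leq_trans _ (le a).1) // (leq_trans _ (H1 _)).
Qed.

Lemma leq_base a b e : a <= b -> (a + 2) ^ e <= (b + 2) ^ e.
Proof. by case: e => // e ab; rewrite leq_exp2r // leq_add2r. Qed.

Lemma eq_FP (A B : encType) (f g : A -> B) : f =1 g -> FP g -> FP f.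
Proof.
move=> E [[c [m [g1 [h1 [p1 p2 H1 H2]]]]]]; constructor; exists c, m, g1, h1; split=> //.
  by move=> a s /H1; rewrite E.
by move=> a; rewrite E.
Qed.

(** * Closure properties of polynomial-time functions *)

Lemma FP_assign (A B : encType) (f : A -> B) (e : expr) :
  (forall s a, s 0 = enc a -> eval s e = enc (f a)) ->
  (forall a, sz (f a) <= (sz a + 2) ^ 2) -> FP f.
Proof.
move=> H1 H2; constructor; exists (Assign 0 e), 1, (fun=> (expr_cost e).+1), (fun n => (n + 2) ^ 2).
split; [pbound|pbound| |exact: H2].
move=> a s /H1 E; exists (set_var s 0 (eval s e)), (expr_cost e).+1; split=> //.
- exact: exec_assign.
- by case.
Qed.

Lemma FP_id (A : encType) : FP (fun x : A => x).
Proof. by apply: (@FP_assign _ _ _ (Var 0)) => // a; nia. Qed.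

Lemma FP_fst_ (A B : encType) : FP (fun x : A * B => x.1).
Proof.
apply: (@FP_assign _ _ _ (Hd (Var 0))) => [s a /= ->|a] //.
rewrite sz_pair; nia.
Qed.

Lemma FP_snd_ (A B : encType) : FP (fun x : A * B => x.2).
Proof.
apply: (@FP_assign _ _ _ (Tl (Var 0))) => [s a /= ->|a] //.
rewrite sz_pair; nia.
Qed.

Fixpoint quote (d : tree) : expr := if d is Node a b then Cons (quote a) (quote b) else Nil.

Lemma FP_const (A B : encType) (b : B) : FP (fun _ : A => b).
Proof.
constructor; exists (Assign 0 (quote (enc b))), 1, (fun=> (expr_cost (quote (enc b))).+1), (fun=> sz b).
split; [pbound|pbound| |by []].
move=> a s _; exists (set_var s 0 (eval s (quote (enc b)))), (expr_cost (quote (enc b))).+1.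
split=> //; [exact: exec_assign| |by case].
by rewrite /set_var eqxx; elim: (enc b) => //= x -> y ->.
Qed.

Lemma FP_comp (A B C : encType) (g : B -> C) (f : A -> B) :
  FP g -> FP f -> FP (fun x => g (f x)).
Proof.
move=> /FPE[cg [mg [eg [Ig Sg]]]] /FPE[cf [mf [ef [Jf Sf]]]].
pose p n := ((n + 2) ^ ef + 2) ^ eg.
have bnd a : (sz (f a) + 2) ^ eg <= p (sz a) by apply/leq_base/Sf.
constructor; exists (Seq cf cg), (maxn mf mg), (fun n => (n + 2) ^ ef + p n), p.
split; [by rewrite /p; pbound|by rewrite /p; pbound| |].
  move=> a s /Jf[s1 [k1 [E1 R1 F1 K1]]].
  have [s2 [k2 [E2 R2 F2 K2]]] := Ig _ _ R1.
  exists s2, (k1 + k2); split=> //; first exact: exec_seq E1 E2.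
    by move=> y; rewrite geq_max => /andP[y1 y2]; rewrite F2 // F1.
  by rewrite leq_add // (leq_trans K2).
by move=> a; rewrite (leq_trans (Sg _)).
Qed.

Lemma set_var_eq s x v : set_var s x v x = v.
Proof. by rewrite /set_var eqxx. Qed.

Lemma set_var_neq s x v y : y != x -> set_var s x v y = s y.
Proof. by rewrite /set_var => /negPf->. Qed.

Ltac store := repeat (rewrite set_var_eq || (rewrite set_var_neq; [|lia])).

Lemma FP_pair (A B C : encType) (f : A -> B) (g : A -> C) :
  FP f -> FP g -> FP (fun x => (f x, g x)).
Proof.
move=> /FPE[cf [mf [ef [Jf Sf]]]] /FPE[cg [mg [eg [Ig Sg]]]].
(* Beyond the reach of both programs, [M] keeps the input and [M.+1] the first result. *)
have [M [Mf Mg]] : exists M, mf < M /\ mg < M by exists (maxn mf mg).+1; lia.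
constructor; exists (Seq (Assign M (Var 0)) (Seq cf (Seq (Assign M.+1 (Var 0))
  (Seq (Assign 0 (Var M)) (Seq cg (Assign 0 (Cons (Var M.+1) (Var 0)))))))), M.+2,
  (fun n => (n + 2) ^ ef + (n + 2) ^ eg + 20), (fun n => ((n + 2) ^ ef + (n + 2) ^ eg).+1).
split; [pbound|pbound| |].
  move=> a s s0.
  have s0' : set_var s M (s 0) 0 = enc a by store.
  have [s1 [k1 [E1 R1 F1 K1]]] := Jf a _ s0'.
  set s2 := set_var s1 M.+1 (s1 0).
  set s3 := set_var s2 0 (s2 M).
  have s30 : s3 0 = enc a.
    by rewrite /s3 /s2; store; rewrite F1; [store|lia].
  have [s4 [k4 [E4 R4 F4 K4]]] := Ig a s3 s30.
  exists (set_var s4 0 (Node (s4 M.+1) (s4 0))), (2 + (k1 + (2 + (2 + (k4 + 4))))).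
  split.
  - apply: exec_seq (exec_assign _ _ _) _; apply: exec_seq E1 _.
    apply: exec_seq (exec_assign _ _ _) _; apply: exec_seq (exec_assign _ _ _) _.
    exact: exec_seq E4 (exec_assign _ _ _).
  - by rewrite set_var_eq R4 F4 ?/s3 ?/s2; [store; rewrite R1|lia].
  - move=> y yM; store; rewrite F4 /s3 /s2; last by lia.
    by store; rewrite F1; [store|lia].
  - by move: K1 K4; lia.
by move=> a; rewrite sz_pair ltnS; exact: leq_add (Sf a) (Sg a).
Qed.

Lemma FP_app2 (X A B C : encType) (h : A -> B -> C) (f : X -> A) (g : X -> B) :
  FP (fun y : A * B => h y.1 y.2) -> FP f -> FP g -> FP (fun x => h (f x) (g x)).
Proof. by move=> H F G; apply: (FP_comp H (FP_pair F G)). Qed.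

Section Contexts.
Variables X A B C : encType.

Lemma FP_fst (f : X -> A * B) : FP f -> FP (fun x => (f x).1).
Proof. exact: FP_comp (FP_fst_ _ _). Qed.

Lemma FP_snd (f : X -> A * B) : FP f -> FP (fun x => (f x).2).
Proof. exact: FP_comp (FP_snd_ _ _). Qed.

Lemma FP_cons (f : X -> A) (g : X -> seq A) : FP f -> FP g -> FP (fun x => f x :: g x).
Proof.
apply: FP_app2; apply: (@FP_assign _ _ _ (Var 0)) => // -[a s].
rewrite /sz /=; nia.
Qed.

Lemma FP_Some (f : X -> A) : FP f -> FP (fun x => Some (f x)).
Proof.
move=> ff; apply: (FP_comp (g := @Some A) _ ff).
apply: (@FP_assign _ _ _ (Cons Nil (Var 0))) => [s a /= ->|a] //.
rewrite sz_Some; nia.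
Qed.

(* Branching on whether the value of [o] is encoded by [Leaf]; otherwise the
   expression [e] extracts from it a value passed to [f]. *)
Lemma FP_case (o : X -> C) (e : expr) (f : X * A -> B) (g k : X -> B) :
  FP o -> FP f -> FP g ->
  (forall x, if enc (o x) is Leaf then k x = g x else
     exists a, [/\ forall s, s 0 = enc (o x) -> eval s e = enc a, sz a <= sz (o x)
                 & k x = f (x, a)]) -> FP k.
Proof.
move=> /FPE[co [mo [eo [Io So]]]] /FPE[cf [mf [ef [Jf Sf]]]] /FPE[cg [mg [eg [Ig Sg]]]] kE.
have [M [Mo [Mf Mg]]] : exists M, mo < M /\ (mf < M /\ mg < M).
  by exists (maxn mo (maxn mf mg)).+1; lia.
pose p n := (n + (n + 2) ^ eo + 3) ^ ef.
have szf (x : X) (a : A) : sz a <= sz (o x) -> (sz (x, a) + 2) ^ ef <= p (sz x).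
  move=> sa; rewrite /p -[3]/(1 + 2) addnA; apply: leq_base.
  by rewrite sz_pair /= addn1 ltnS leq_add2l (leq_trans sa).
constructor; exists (Seq (Assign M (Var 0)) (Seq co (If (Var 0) (Seq (Assign 0 (Cons (Var M) e)) cf)
   (Seq (Assign 0 (Var M)) cg)))), M.+1,
  (fun n => (n + 2) ^ eo + (p n + (n + 2) ^ eg) + (expr_cost e + 20)),
  (fun n => p n + (n + 2) ^ eg).
split; [by rewrite /p; pbound|by rewrite /p; pbound| |]; last first.
  move=> x; have := kE x; case: (enc (o x)) => [->|? ? [a [_ /szf sa ->]]].
    exact: leq_trans (Sg x) (leq_addl _ _).
  by rewrite (leq_trans (Sf _)) // (leq_trans sa) // leq_addr.
move=> x s s0.
have s0' : set_var s M (s 0) 0 = enc x by store.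
have [s1 [k1 [E1 R1 F1 K1]]] := Io x _ s0'.
have := kE x; case E : (enc (o x)) => [|u v].
  move=> kx; set s2 := set_var s1 0 (s1 M).
  have s20 : s2 0 = enc x by rewrite /s2; store; rewrite F1; [store|lia].
  have [s3 [k3 [E3 R3 F3 K3]]] := Ig x s2 s20.
  exists s3, (2 + (k1 + (2 + (2 + k3)))); split.
  - apply: exec_seq (exec_assign _ _ _) _; apply: exec_seq E1 _.
    apply: exec_if_false => //=; first by rewrite R1.
    by apply: exec_seq (exec_assign _ _ _) _; exact: E3.
  - by rewrite R3 kx.
  - by move=> y yM; rewrite F3 /s2; [store; rewrite F1; [store|lia]|lia].
  - by move: K1 K3; lia.
move=> [a [ea sa kx]]; set s2 := set_var s1 0 (Node (s1 M) (eval s1 e)).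
have s20 : s2 0 = enc (x, a).
  by rewrite /s2; store; rewrite F1; [store; rewrite (ea _ (etrans R1 E)) s0|lia].
have [s3 [k3 [E3 R3 F3 K3]]] := Jf (x, a) s2 s20.
exists s3, (2 + (k1 + (2 + ((1 + expr_cost e).+2 + k3)))); split.
- apply: exec_seq (exec_assign _ _ _) _; apply: exec_seq E1 _.
  apply: exec_if_true => //=; first by rewrite R1 E.
  by apply: exec_seq (exec_assign _ _ _) _; exact: E3.
- by rewrite R3 kx.
- by move=> y yM; rewrite F3 /s2; [store; rewrite F1; [store|lia]|lia].
- by have := szf _ _ sa; move: K1 K3; lia.
Qed.

End Contexts.

Section Branching.
Variables X A B : encType.

Lemma FP_if (b : X -> bool) (g h : X -> A) :
  FP b -> FP g -> FP h -> FP (fun x => if b x then g x else h x).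
Proof.
move=> fb fg fh; apply: (@FP_case _ tree_encType _ _ _ Nil (fun y => g y.1) _ _ fb _ fh).
  exact: FP_comp fg (FP_fst_ _ _).
by move=> x; case: (b x) => //=; exists Leaf; split=> //; exact: sz_gt0.
Qed.

Lemma FP_match_option (o : X -> option A) (f : X -> A -> B) (g : X -> B) :
  FP o -> FP (fun y : X * A => f y.1 y.2) -> FP g ->
  FP (fun x => if o x is Some a then f x a else g x).
Proof.
move=> fo ff fg; apply: (FP_case (e := Tl (Var 0)) fo ff fg) => x.
case: (o x) => [a|] //=; exists a; split=> [s /= -> //| |] //.
by rewrite sz_Some; lia.
Qed.

Lemma FP_match_seq (o : X -> seq A) (f : X -> A -> seq A -> B) (g : X -> B) :
  FP o -> FP (fun y : X * (A * seq A) => f y.1 y.2.1 y.2.2) -> FP g ->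
  FP (fun x => if o x is a :: s then f x a s else g x).
Proof.
move=> fo ff fg; apply: (FP_case (e := Var 0) fo ff fg) => x.
by case: (o x) => [|a s] //=; exists (a, s).
Qed.

(** The bound on the accumulator is independent of the input, because the loop that builds the
    padding has an accumulator of exponential size; the time is polynomial in that bound. *)
Lemma foldl_exec (f : X -> B -> A -> B) (b : X -> B) (s : X -> seq A) :
  FP (fun y : X * (B * A) => f y.1 y.2.1 y.2.2) -> FP b -> FP s ->
  exists c m e, forall x bound,
    (forall i, sz (foldl (f x) (b x) (take i (s x))) <= bound) ->
    forall st, st 0 = enc x -> exists st' k,
    [/\ exec c st st' k, st' 0 = enc (foldl (f x) (b x) (s x)),
       forall y, m <= y -> st' y = st y & k <= (sz x + bound + 2) ^ e].
Proof.
move=> /FPE[cf [mf [ef [Jf Sf]]]] /FPE[cb [mb [eb [Ib Sb]]]] /FPE[cs [ms [es [Is Ss]]]].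
have [M [Mf [Mb Ms]]] : exists M, mf < M /\ (mb < M /\ ms < M).
  by exists (maxn mf (maxn mb ms)).+1; lia.
(* Variable [M] holds the input, [M.+1] the rest of the list and [M.+2] the accumulator. *)
pose body := Seq (Assign 0 (Cons (Var M) (Cons (Var M.+2) (Hd (Var M.+1)))))
  (Seq cf (Seq (Assign M.+2 (Var 0)) (Assign M.+1 (Tl (Var M.+1))))).
pose q n := (n + (n + (n + 2) ^ es) + 4) ^ ef + 100.
have [e qe] : pbounded (fun n => (n + 2) ^ es + (n + 2) ^ eb + (n + 2) ^ es * q n + 100).
  by rewrite /q; pbound.
exists (Seq (Assign M (Var 0)) (Seq cs (Seq (Assign M.+1 (Var 0)) (Seq (Assign 0 (Var M))
  (Seq cb (Seq (Assign M.+2 (Var 0)) (Seq (While (Var M.+1) body) (Assign 0 (Var M.+2))))))))).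
exists M.+3, e => x bd Hbd st st0.
have loop l bv s1 : s1 M = enc x -> s1 M.+1 = enc l -> s1 M.+2 = enc bv ->
    (forall i, sz (foldl (f x) bv (take i l)) <= bd) -> sz l <= (sz x + 2) ^ es ->
    exists s2 k, [/\ exec (While (Var M.+1) body) s1 s2 k,
      s2 M.+2 = enc (foldl (f x) bv l), forall y, M.+3 <= y -> s2 y = s1 y
      & k <= 2 + size l * q (sz x + bd)].
  elim: l bv s1 => [|a l IH] bv s1 s1x s1l s1b H szl.
    exists s1, 2; split=> //; exact: exec_while_false.
  set s2 := set_var s1 0 (Node (s1 M) (Node (s1 M.+2) (enc a))).
  have s20 : s2 0 = enc (x, (bv, a)) by rewrite /s2 set_var_eq s1x s1b.
  have [s3 [k3 [E3 R3 F3 K3]]] := Jf _ s2 s20.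
  set s4 := set_var s3 M.+2 (s3 0).
  set s5 := set_var s4 M.+1 (enc l).
  have s3l : s3 M.+1 = enc (a :: l) by rewrite F3 /s2; [store|lia].
  have [|||||s6 [k6 [E6 R6 F6 K6]]] := IH (f x bv a) s5.
  - by rewrite /s5 /s4; store; rewrite F3 /s2; [store|lia].
  - by rewrite /s5 set_var_eq.
  - by rewrite /s5 /s4; store; rewrite R3.
  - by move=> i; have := H i.+1.
  - by move: szl; rewrite sz_cons; lia.
  exists s6, (2 + (7 + (k3 + (2 + 3))) + k6); split.
  - apply: exec_while_true E6; first by rewrite /= s1l.
    have -> : 7 = (expr_cost (Cons (Var M) (Cons (Var M.+2) (Hd (Var M.+1))))).+1 by [].
    apply: exec_seq.
      have := exec_assign s1 0 (Cons (Var M) (Cons (Var M.+2) (Hd (Var M.+1)))).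
      by rewrite /= s1l /= -/s2; apply.
    apply: exec_seq E3 _; apply: exec_seq (exec_assign _ _ _) _.
    have e4 : eval s4 (Tl (Var M.+1)) = enc l by rewrite /= /s4; store; rewrite s3l.
    by have := exec_assign s4 M.+1 (Tl (Var M.+1)); rewrite e4.
  - by rewrite R6.
  - by move=> y yM; rewrite F6 // /s5 /s4; store; rewrite F3 /s2; [store|lia].
  - have : (sz (x, (bv, a)) + 2) ^ ef <= q (sz x + bd) - 100.
      rewrite /q addnK -[4]/(2 + 2) addnA; apply: leq_base.
      rewrite !sz_pair /=; have := H 0; rewrite take0 /=; move: szl; rewrite sz_cons.
      have := @leq_base (sz x) (sz x + bd) es (leq_addr _ _); lia.
    move: K3 K6; rewrite /= mulSn /q; lia.
have st0' : set_var st M (st 0) 0 = enc x by store.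
have [s1 [k1 [E1 R1 F1 K1]]] := Is x _ st0'.
set s2 := set_var s1 M.+1 (s1 0).
set s3 := set_var s2 0 (s2 M).
have s30 : s3 0 = enc x.
  by rewrite /s3 /s2; store; rewrite F1; [store|lia].
have [s4 [k4 [E4 R4 F4 K4]]] := Ib x s3 s30.
set s5 := set_var s4 M.+2 (s4 0).
have [|||||s6 [k6 [E6 R6 F6 K6]]] := loop (s x) (b x) s5.
- rewrite /s5; store; rewrite F4 /s3 /s2; last by lia.
  by store; rewrite F1; [store|lia].
- rewrite /s5; store; rewrite F4 /s3 /s2; last by lia.
  by store; rewrite R1.
- by rewrite /s5 set_var_eq.
- exact: Hbd.
- exact: Ss.
exists (set_var s6 0 (s6 M.+2)), (2 + (k1 + (2 + (2 + (k4 + (2 + (k6 + 2))))))); split.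
- do 2![apply: exec_seq (exec_assign _ _ _) _ || apply: exec_seq E1 _].
  do 2!apply: exec_seq (exec_assign _ _ _) _.
  apply: exec_seq E4 _; apply: exec_seq (exec_assign _ _ _) _.
  exact: exec_seq E6 (exec_assign _ _ _).
- by rewrite set_var_eq R6.
- move=> y yM; store; rewrite F6 // /s5; store; rewrite F4 /s3 /s2; last by lia.
  by store; rewrite F1; [store|lia].
- have := qe (sz x + bd); apply: leq_trans.
  have := @leq_base (sz x) (sz x + bd) es (leq_addr _ _).
  have := @leq_base (sz x) (sz x + bd) eb (leq_addr _ _).
  have : size (s x) * q (sz x + bd) <= (sz x + bd + 2) ^ es * q (sz x + bd).
    rewrite leq_mul2r (leq_trans (ltnW (size_le_sz _))) ?(leq_trans (Ss x)) ?orbT //.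
    by rewrite leq_base // leq_addr.
  move: K1 K4 K6; lia.
Qed.

Lemma FP_foldl (f : X -> B -> A -> B) (b : X -> B) (s : X -> seq A) (g : nat -> nat) :
  pbounded g ->
  (forall x i, sz (foldl (f x) (b x) (take i (s x))) <= g (sz x)) ->
  FP (fun y : X * (B * A) => f y.1 y.2.1 y.2.2) -> FP b -> FP s ->
  FP (fun x => foldl (f x) (b x) (s x)).
Proof.
move=> pg H ff fb fs; have [c [m [e E]]] := foldl_exec ff fb fs.
constructor; exists c, m, (fun n => (n + g n + 2) ^ e), g; split=> //; first by pbound.
  by move=> x st /(E x _ (H x)).
by move=> x; have := H x (size (s x)); rewrite take_size.
Qed.

(** A step that adds an amount independent of the current accumulator leaves it polynomial after
    polynomially many rounds; a step that doubles it would not. *)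
Lemma FP_foldl_add (f : X -> B -> A -> B) (b : X -> B) (s : X -> seq A) (g : nat -> nat) :
  pbounded g -> (forall x v a, sz (f x v a) <= sz v + g (sz x + sz a)) ->
  FP (fun y : X * (B * A) => f y.1 y.2.1 y.2.2) -> FP b -> FP s ->
  FP (fun x => foldl (f x) (b x) (s x)).
Proof.
move=> [e ge] H' ff fb fs.
have H x v a : sz (f x v a) <= sz v + (sz x + sz a + 2) ^ e.
  exact: leq_trans (H' x v a) (leq_add (leqnn _) (ge _)).
have [_ [_ [eb [_ Sb]]]] := FPE fb; have [_ [_ [es [_ Ss]]]] := FPE fs.
pose g' n := (n + 2) ^ eb + (n + 2) ^ es * (n + (n + 2) ^ es + 2) ^ e.
apply: (@FP_foldl _ _ _ g') => // [|x i]; first by rewrite /g'; pbound.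
have G l v : sz (foldl (f x) v l) <= sz v + sz l * (sz x + sz l + 2) ^ e.
  elim: l v => [|a l IH] v /=; first exact: leq_addr.
  apply: leq_trans (IH _) _; rewrite sz_cons.
  have h1 : (sz x + sz l + 2) ^ e <= (sz x + (sz a + sz l).+1 + 2) ^ e by apply: leq_base; lia.
  have h2 : (sz x + sz a + 2) ^ e <= (sz x + (sz a + sz l).+1 + 2) ^ e by apply: leq_base; lia.
  have := H x v a; have := sz_gt0 a; nia.
have lt : sz (take i (s x)) <= (sz x + 2) ^ es := leq_trans (sz_take _ _) (Ss x).
apply: leq_trans (G _ _) _; rewrite /g' leq_add // leq_mul // leq_base //.
by rewrite leq_add2l.
Qed.

End Branching.

Section BoolOps.
Variables (X : encType) (a b : X -> bool).
Hypotheses (fa : FP a) (fb : FP b).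

Lemma FP_andb : FP (fun x => a x && b x).
Proof. exact: FP_if fa fb (FP_const _ false). Qed.

Lemma FP_orb : FP (fun x => a x || b x).
Proof. exact: FP_if fa (FP_const _ true) fb. Qed.

Lemma FP_negb : FP (fun x => ~~ a x).
Proof. exact: FP_if fa (FP_const _ false) (FP_const _ true). Qed.
End BoolOps.

Lemma FP_implb (X : encType) (a b : X -> bool) : FP a -> FP b -> FP (fun x => a x ==> b x).
Proof. by move=> fa fb; exact: FP_if fa fb (FP_const _ true). Qed.

Lemma FP_addb (X : encType) (a b : X -> bool) : FP a -> FP b -> FP (fun x => a x (+) b x).
Proof. by move=> fa fb; apply: eq_FP (FP_if fa (FP_negb fb) fb) => x; case: (a x). Qed.

Lemma FP_eq_bool (X : encType) (a b : X -> bool) : FP a -> FP b -> FP (fun x => a x == b x).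
Proof.
move=> fa fb; apply: eq_FP (FP_negb (FP_addb fa fb)) => x.
by case: (a x); case: (b x).
Qed.

Section Lists.
Variables (X A B : encType).

Lemma FP_isSome (o : X -> option A) : FP o -> FP (fun x => isSome (o x)).
Proof.
move=> fo; exact: (FP_match_option (f := fun _ _ => true) fo (FP_const _ true) (FP_const _ false)).
Qed.

Lemma FP_odflt (d : X -> A) (o : X -> option A) : FP d -> FP o -> FP (fun x => odflt (d x) (o x)).
Proof. by move=> fd fo; exact: (FP_match_option (f := fun _ a => a) fo (FP_snd (FP_id _)) fd). Qed.

Lemma FP_nilp (s : X -> seq A) : FP s -> FP (fun x => nilp (s x)).
Proof.
move=> fs; have := FP_match_seq (f := fun _ _ _ => false) fs (FP_const _ false) (FP_const _ true).
by apply: eq_FP => x; case: (s x).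
Qed.

Lemma FP_behead (s : X -> seq A) : FP s -> FP (fun x => behead (s x)).
Proof.
move=> fs; have := FP_match_seq (f := fun _ _ t => t) fs (FP_snd (FP_snd (FP_id _))) (FP_const _ [::]).
by apply: eq_FP => x; case: (s x).
Qed.

Lemma FP_head (d : X -> A) (s : X -> seq A) : FP d -> FP s -> FP (fun x => head (d x) (s x)).
Proof.
move=> fd fs; have := FP_match_seq (f := fun _ a _ => a) fs (FP_fst (FP_snd (FP_id _))) fd.
by apply: eq_FP => x; case: (s x).
Qed.

Lemma FP_catrev (s t : X -> seq A) : FP s -> FP t -> FP (fun x => catrev (s x) (t x)).
Proof.
move=> fs ft; apply: (@eq_FP _ _ _ (fun x => foldl (fun acc a => a :: acc) (t x) (s x))).
  by move=> x; elim: (s x) (t x) => //= a l IH v; rewrite IH.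
apply: (@FP_foldl_add _ _ _ (fun _ acc a => a :: acc) t s S) => //; first by pbound.
  by move=> x v a; rewrite sz_cons; lia.
exact: FP_cons (FP_snd (FP_snd (FP_id _))) (FP_fst (FP_snd (FP_id _))).
Qed.

Lemma FP_rev (s : X -> seq A) : FP s -> FP (fun x => rev (s x)).
Proof. by move=> fs; exact: FP_catrev fs (FP_const _ [::]). Qed.

End Lists.

Lemma FP_cat (X A : encType) (s t : X -> seq A) : FP s -> FP t -> FP (fun x => s x ++ t x).
Proof.
move=> fs ft; apply: eq_FP (FP_catrev (FP_rev fs) ft) => x.
by rewrite catrevE revK.
Qed.

Section Lists2.
Variables (X A B : encType).

Lemma sz_FP (Y C : encType) (f : Y -> C) : FP f ->
  exists2 g, pbounded g & forall y, sz (f y) <= g (sz y).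
Proof.
by move=> /FPE[_ [_ [e [_ S]]]]; exists (fun n => (n + 2) ^ e) => //; pbound.
Qed.

Lemma FP_filter_map (p : X -> A -> bool) (f : X -> A -> B) (s : X -> seq A) :
  FP (fun y : X * A => p y.1 y.2) -> FP (fun y : X * A => f y.1 y.2) -> FP s ->
  FP (fun x => [seq f x a | a <- s x & p x a]).
Proof.
move=> fp ff fs; apply: (@eq_FP _ _ _ (fun x =>
    rev (foldl (fun acc a => if p x a then f x a :: acc else acc) [::] (s x)))).
  move=> x; rewrite -[LHS]revK; congr rev; rewrite -[LHS]cats0.
  elim: (s x) [::] => //= a l IH v; rewrite -IH; case: (p x a) => //=.
  by rewrite rev_cons cat_rcons.
have [g pg Sg] := sz_FP ff.
apply: FP_rev; apply: (@FP_foldl_add _ _ _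
  (fun x acc a => if p x a then f x a :: acc else acc) _ _ (fun n => (g n.+1).+1)) => //.
(* Doubling the exponent absorbs the shift of the argument, since [n + 3 <= (n + 2) ^ 2]. *)
- by case: pg => e he; apply: pbounded_S; exists e.*2; move=> n;
   apply: leq_trans (he _) _; rewrite -mul2n expnM; case: (e) => // k; rewrite leq_exp2r //; nia.
- move=> x v a; have := Sg (x, a); rewrite sz_pair /=; case: (p x a); rewrite ?sz_cons; lia.
- apply: FP_if (FP_fst (FP_snd (FP_id _))).
    exact: (FP_comp fp (FP_pair (FP_fst (FP_id _)) (FP_snd (FP_snd (FP_id _))))).
  apply: FP_cons (FP_fst (FP_snd (FP_id _))).
  exact: (FP_comp ff (FP_pair (FP_fst (FP_id _)) (FP_snd (FP_snd (FP_id _))))).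
- exact: FP_const.
Qed.

End Lists2.

Section Lists3.
Variables (X A B : encType).

Lemma FP_map (f : X -> A -> B) (s : X -> seq A) :
  FP (fun y : X * A => f y.1 y.2) -> FP s -> FP (fun x => [seq f x a | a <- s x]).
Proof.
move=> ff fs; apply: eq_FP (FP_filter_map (p := fun _ _ => true) (FP_const _ true) ff fs) => x.
by rewrite filter_predT.
Qed.

Lemma FP_filter (p : X -> A -> bool) (s : X -> seq A) :
  FP (fun y : X * A => p y.1 y.2) -> FP s -> FP (fun x => [seq a <- s x | p x a]).
Proof.
move=> fp fs; apply: eq_FP (FP_filter_map (f := fun _ a => a) fp (FP_snd (FP_id _)) fs) => x.
by rewrite map_id.
Qed.

Lemma FP_has (p : X -> A -> bool) (s : X -> seq A) :
  FP (fun y : X * A => p y.1 y.2) -> FP s -> FP (fun x => has (p x) (s x)).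
Proof.
move=> fp fs; apply: eq_FP (FP_negb (FP_nilp (FP_filter fp fs))) => x.
by rewrite /= has_count -size_filter; case: (seq.filter _ _).
Qed.

Lemma FP_all (p : X -> A -> bool) (s : X -> seq A) :
  FP (fun y : X * A => p y.1 y.2) -> FP s -> FP (fun x => all (p x) (s x)).
Proof.
move=> fp fs; apply: eq_FP (FP_negb (FP_has (FP_negb fp) fs)) => x.
by rewrite -[LHS]negbK -has_predC.
Qed.

Lemma FP_zip (s : X -> seq A) (t : X -> seq B) : FP s -> FP t -> FP (fun x => zip (s x) (t x)).
Proof.
move=> fs ft; apply: (@eq_FP _ _ _ (fun x => rev (foldl (fun (st : seq (A * B) * seq B) a =>
   if st.2 is b :: t' then ((a, b) :: st.1, t') else st) ([::], t x) (s x)).1)).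
  move=> x; rewrite -[LHS]revK; congr rev; rewrite -[LHS]cats0.
  elim: (s x) (t x) [::] => [|a l IH] [|b u] v //=; last by rewrite -IH rev_cons cat_rcons.
  by elim: l {IH}.
apply: FP_rev; apply: FP_fst; apply: (@FP_foldl_add _ _ _ (fun _ (st : seq (A * B) * seq B) a =>
   if st.2 is b :: t' then ((a, b) :: st.1, t') else st) _ _ (fun n => n + 4)) => //.
- by pbound.
- by move=> x [u [|b l]] a; rewrite !sz_pair /= ?sz_cons ?sz_pair /=; lia.
- apply: (FP_match_seq (o := fun y => y.2.1.2)
    (f := fun y b t' => ((y.2.2, b) :: y.2.1.1, t')) (g := fun y => y.2.1)).
  + exact: FP_snd (FP_fst (FP_snd (FP_id _))).
  + apply: FP_pair (FP_snd (FP_snd (FP_id _))); apply: FP_cons.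
      exact: FP_pair (FP_snd (FP_snd (FP_fst (FP_id _)))) (FP_fst (FP_snd (FP_id _))).
    exact: FP_fst (FP_fst (FP_snd (FP_fst (FP_id _)))).
  + exact: FP_fst (FP_snd (FP_id _)).
- exact: FP_pair (FP_const _ [::]) ft.
Qed.

Lemma FP_flatten (s : X -> seq (seq A)) : FP s -> FP (fun x => flatten (s x)).
Proof.
move=> fs; apply: (@eq_FP _ _ _ (fun x => foldl (fun acc a => acc ++ a) [::] (s x))).
  move=> x; rewrite -[LHS]cat0s; elim: (s x) [::] => [|a l IH] v /=; first by rewrite cats0.
  by rewrite -IH catA.
apply: (@FP_foldl_add _ _ _ (fun _ acc a => acc ++ a) _ _ id) => //.
- exact: pbounded_id.
- by move=> x v a; have := sz_cat v a; lia.
- exact: FP_cat (FP_fst (FP_snd (FP_id _))) (FP_snd (FP_snd (FP_id _))).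
- exact: FP_const.
Qed.

End Lists3.

Ltac fp_step_ext := fail.
Ltac fp_step := first
  [ assumption | apply: FP_const | apply: FP_id
  | lazymatch goal with |- FP (fun x => (_, _)) => apply: FP_pair end | apply: FP_fst | apply: FP_snd
  | apply: FP_cons | apply: FP_Some
  | apply: FP_andb | apply: FP_orb | apply: FP_negb | apply: FP_implb
  | apply: FP_addb | apply: FP_eq_bool | apply: FP_isSome | apply: FP_odflt
  | apply: FP_nilp | apply: FP_behead | apply: FP_head | apply: FP_rev | apply: FP_cat
  | apply: FP_zip | apply: FP_flatten | apply: FP_has | apply: FP_all
  | apply: FP_filter | apply: FP_map | fp_step_ext
  | apply: FP_if | apply: FP_match_option | apply: FP_match_seq ].
Ltac fp := repeat (cbv beta; fp_step).

(** * Binary arithmetic *)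

Definition of_bits (s : seq bool) : nat := foldr (fun (b : bool) n => b + n.*2) 0 s.

Lemma nat_bitsE n : 0 < n -> nat_bits n = odd n :: nat_bits n./2.
Proof.
move=> n0; rewrite /nat_bits /mkseq up_log2S //= divn1; congr (_ :: _).
rewrite -[1]/(1 + 0) iotaDl -map_comp; apply: eq_map => i /=.
by rewrite expnD divnMA divn2.
Qed.

Lemma nat_bitsK n : of_bits (nat_bits n) = n.
Proof.
have [m le] := ubnP n; elim: m n le => // m IH [|n] le //.
by rewrite nat_bitsE //= IH ?odd_double_half //; lia.
Qed.

Lemma nat_bits_nilp n : nilp (nat_bits n) = (n == 0).
Proof. by case: n => // n; rewrite nat_bitsE. Qed.

(** The most significant digits come last, so the canonical expansion is obtained by dropping zeros
    at the end. *)
Definition trim (s : seq bool) : seq bool :=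
  foldr (fun b t => if b || ~~ nilp t then b :: t else [::]) [::] s.

Lemma of_bitsK s : nat_bits (of_bits s) = trim s.
Proof.
elim: s => //= b s <-; set n := of_bits s; rewrite nat_bits_nilp.
have [->|n0] := eqVneq n 0; first by case: b.
by rewrite orbT nat_bitsE ?half_bit_double ?oddD ?odd_double ?addbF ?oddb //; lia.
Qed.

Lemma of_bits_cat s t : of_bits (s ++ t) = of_bits s + 2 ^ size s * of_bits t.
Proof. by elim: s => [|b s /= ->]; rewrite ?mul1n //= expnS -muln2; lia. Qed.

Lemma of_bits_lt s : of_bits s < 2 ^ size s.
Proof. by elim: s => //= b s; rewrite expnS; case: b; lia. Qed.

Lemma of_bits_false (T : Type) (s : seq T) : of_bits [seq false | _ <- s] = 0.
Proof. by elim: s => //= _ s ->. Qed.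

Lemma size_nat_bits n k : (size (nat_bits n) <= k) = (n < 2 ^ k).
Proof.
rewrite /nat_bits size_mkseq; apply/idP/idP => [|nk]; last exact: up_log_min.
by move=> le; apply: leq_trans (up_logP n.+1 (isT : 1 < 2)) _; rewrite leq_exp2l.
Qed.

Lemma ltn_size_bits n : n < 2 ^ size (nat_bits n).
Proof. by rewrite -size_nat_bits. Qed.

Lemma sz_bits (s : seq bool) : (size s).*2.+1 <= sz s /\ sz s <= 4 * size s + 1.
Proof.
elim: s => [|b s [h1 h2]] //=; rewrite sz_cons.
have := sz_bool b; have := sz_gt0 b; lia.
Qed.

Lemma sz_nat n : sz n = sz (nat_bits n). Proof. by []. Qed.

Lemma sz_nat_le n k : n < 2 ^ k -> sz n <= 4 * k + 1.
Proof.
rewrite -size_nat_bits sz_nat => le; apply: leq_trans (sz_bits _).2 _; lia.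
Qed.

Lemma sz_nat_pair (a : nat * nat) k : a.1 < 2 ^ k -> a.2 < 2 ^ k -> sz a <= 8 * k + 3.
Proof.
move=> /sz_nat_le h1 /sz_nat_le h2; rewrite sz_pair.
apply: leq_trans (_ : (4 * k + 1 + (4 * k + 1)).+1 <= _).
  by rewrite ltnS leq_add.
lia.
Qed.

Lemma nat_lt_sz n : n < 2 ^ sz n.
Proof. by rewrite -size_nat_bits sz_nat; have := (sz_bits (nat_bits n)).1; lia. Qed.

Section NatOps.
Variables (X : encType).

Lemma FP_nat_bits (n : X -> nat) : FP n -> FP (fun x => nat_bits (n x)).
Proof.
move=> fn; apply: (FP_comp (g := nat_bits) _ fn).
by apply: (@FP_assign _ _ _ (Var 0)) => // a; rewrite -sz_nat; nia.
Qed.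

Lemma FP_trim (s : X -> seq bool) : FP s -> FP (fun x => trim (s x)).
Proof.
move=> fs; apply: (@eq_FP _ _ _ (fun x =>
   foldl (fun t b => if b || ~~ nilp t then b :: t else [::]) [::] (rev (s x)))).
  by move=> x; rewrite foldl_rev.
apply: (@FP_foldl_add _ _ _
    (fun _ (t : seq bool) (b : bool) => if b || ~~ nilp t then b :: t else [::]) _ _ S);
  [by pbound| |by fp|by fp|by fp].
by move=> x v a; case: ifP => _; rewrite ?sz_cons ?sz_nil; lia.
Qed.

(** A number is encoded as its canonical list of digits, so the program for [trim] serves
    unchanged. *)
Lemma FP_of_bits (s : X -> seq bool) : FP s -> FP (fun x => of_bits (s x)).
Proof.
move=> /FP_trim[[c [m [g [h [pg ph I S]]]]]]; constructor; exists c, m, g, h; split=> //.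
  move=> x st /I[st' [k [? R ? ?]]]; exists st', k; split=> //.
  by rewrite R -of_bitsK.
by move=> x; rewrite sz_nat of_bitsK.
Qed.

Lemma FP_eq0 (n : X -> nat) : FP n -> FP (fun x => n x == 0).
Proof.
by move=> fn; apply: eq_FP (FP_nilp (FP_nat_bits fn)) => x; rewrite nat_bits_nilp.
Qed.

End NatOps.

(* [g] computes the next carry; the digits of the result come out reversed. *)
Definition ripple_step (g : bool -> bool -> bool -> bool) (st : bool * seq bool) (ab : bool * bool) :=
  (g ab.1 ab.2 st.1, (ab.1 (+) ab.2 (+) st.1) :: st.2).
Definition ripple g (z : seq (bool * bool)) : bool * seq bool :=
  foldl (ripple_step g) (false, [::]) z.

Lemma FP_ripple (X : encType) g (z : X -> seq (bool * bool)) :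
  FP (fun y : X * (bool * (bool * bool)) => g y.2.1 y.2.2.1 y.2.2.2) ->
  FP z -> FP (fun x => ripple g (z x)).
Proof.
move=> fg fz; apply: (@FP_foldl_add _ _ _ (fun=> ripple_step g) _ _ (fun n => 20)) => //; last by fp.
- by pbound.
- move=> x [c l] a; rewrite /ripple_step !sz_pair sz_cons /=.
  by move: (g _ _ _) (_ (+) c) => u v; have := sz_bool u; have := sz_bool v; lia.
- rewrite /ripple_step; apply: FP_pair; last by fp.
  apply: (FP_comp (g := fun y : X * (bool * (bool * bool)) => g y.2.1 y.2.2.1 y.2.2.2)
    (f := fun y => (y.1, (y.2.2.1, (y.2.2.2, y.2.1.1))))) => //; fp.
Qed.

(** The majority of the three digits; complementing the first one turns the carry of an addition
    into the borrow of a subtraction. *)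
Definition carry (a b c : bool) := if a then b || c else b && c.
Definition borrow (a : bool) := carry (~~ a).

Lemma ripple_gen g z c acc :
  foldl (ripple_step g) (c, acc) z =
  let r := foldl (ripple_step g) (c, [::]) z in (r.1, r.2 ++ acc).
Proof.
elim: z c acc => [|ab z IH] c acc //=; rewrite IH [in RHS]IH /=.
by rewrite -catA.
Qed.

Lemma ripple_add z c :
  let r := foldl (ripple_step carry) (c, [::]) z in
  of_bits (rev r.2) + 2 ^ size z * r.1 = of_bits (unzip1 z) + of_bits (unzip2 z) + c.
Proof.
elim: z c => [|[a b] z IH] c; first by rewrite /=; lia.
rewrite /= (ripple_gen carry) /= rev_cat /= expnS.
have := IH (carry a b c); move: (foldl _ _ _) => r /=.
by rewrite /carry; case: a; case: b; case: c; rewrite /=; lia.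
Qed.

Lemma ripple_sub z c :
  let r := foldl (ripple_step borrow) (c, [::]) z in
  of_bits (rev r.2) + of_bits (unzip2 z) + c = of_bits (unzip1 z) + 2 ^ size z * r.1.
Proof.
elim: z c => [|[a b] z IH] c; first by rewrite /=; lia.
rewrite /= (ripple_gen borrow) /= rev_cat /= expnS.
have := IH (borrow a b c); move: (foldl _ _ _) => r /=.
by rewrite /borrow /carry; case: a; case: b; case: c; rewrite /=; lia.
Qed.

(** Each number is followed by as many zeros as the other has digits, which makes the lengths equal
    without comparing them. *)
Definition pad_zip (m n : nat) : seq (bool * bool) :=
  let s := nat_bits m in let t := nat_bits n in
  zip (s ++ [seq false | _ <- t]) (t ++ [seq false | _ <- s]).

Lemma pad_zipP m n :
  of_bits (unzip1 (pad_zip m n)) = m /\ of_bits (unzip2 (pad_zip m n)) = n.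
Proof.
rewrite /pad_zip; set s := _ ++ _; set t := _ ++ _.
have e : size s = size t by rewrite !size_cat !size_map addnC.
by rewrite unzip1_zip ?unzip2_zip ?e // /s /t !of_bits_cat !of_bits_false !nat_bitsK !muln0 !addn0.
Qed.

Definition add_bits m n := let r := ripple carry (pad_zip m n) in of_bits (rev (r.1 :: r.2)).

Lemma add_bitsE m n : add_bits m n = m + n.
Proof.
have [e1 e2] := pad_zipP m n; have := ripple_add (pad_zip m n) false.
rewrite e1 e2 /add_bits /ripple => /=; rewrite addn0 => <-.
set r := foldl _ _ _; rewrite rev_cons -cats1 of_bits_cat /= addn0 size_rev.
congr (_ + 2 ^ _ * _); rewrite /r.
by elim/last_ind: (pad_zip m n) => //= z a; rewrite foldl_rcons size_rcons /= => ->.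
Qed.

Definition sub_bits m n :=
  let r := ripple borrow (pad_zip m n) in
  if r.1 then 0 else of_bits (rev r.2).

Lemma sub_bitsE m n : sub_bits m n = m - n.
Proof.
have [e1 e2] := pad_zipP m n; have := ripple_sub (pad_zip m n) false.
rewrite e1 e2 /sub_bits /ripple; set r := foldl _ _ _ => /=; rewrite addn0.
case: r.1 => /=; last by lia.
have := of_bits_lt (rev r.2); rewrite size_rev.
suff -> : size r.2 = size (pad_zip m n) by lia.
rewrite /r; by elim/last_ind: (pad_zip m n) => //= z a; rewrite foldl_rcons size_rcons /= => ->.
Qed.

Section NatArith.
Variables (X : encType) (m n : X -> nat).
Hypotheses (fm : FP m) (fn : FP n).

Lemma FP_pad_zip : FP (fun x => pad_zip (m x) (n x)).
Proof.
have fbm := FP_nat_bits fm; have fbn := FP_nat_bits fn; rewrite /pad_zip; fp.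
Qed.

Lemma FP_addn : FP (fun x => m x + n x).
Proof.
apply: (@eq_FP _ _ _ (fun x => add_bits (m x) (n x))) => [x|]; first by rewrite add_bitsE.
apply: FP_of_bits; apply: FP_rev; have := FP_pad_zip => fz.
have fr : FP (fun x => ripple carry (pad_zip (m x) (n x))).
  by apply: FP_ripple fz; rewrite /carry; fp.
by fp.
Qed.

Lemma FP_subn : FP (fun x => m x - n x).
Proof.
apply: (@eq_FP _ _ _ (fun x => sub_bits (m x) (n x))) => [x|]; first by rewrite sub_bitsE.
rewrite /sub_bits; have := FP_pad_zip => fz.
have fr : FP (fun x => ripple borrow (pad_zip (m x) (n x))).
  by apply: FP_ripple fz; rewrite /borrow /carry; fp.
apply: FP_if; [by fp|by fp|apply: FP_of_bits; fp].
Qed.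

End NatArith.

Section NatArith2.
Variables (X : encType) (m n : X -> nat).
Hypotheses (fm : FP m) (fn : FP n).

Lemma FP_leq : FP (fun x => m x <= n x).
Proof. exact: FP_eq0 (FP_subn fm fn). Qed.

Lemma FP_ltn : FP (fun x => m x < n x).
Proof. by apply: eq_FP (FP_negb (FP_eq0 (FP_subn fn fm))) => x; rewrite subn_eq0 -ltnNge. Qed.

Lemma FP_maxn : FP (fun x => maxn (m x) (n x)).
Proof. apply: eq_FP (FP_addn fm (FP_subn fn fm)) => x; lia. Qed.

End NatArith2.

Lemma FP_eqn (X : encType) (m n : X -> nat) : FP m -> FP n -> FP (fun x => m x == n x).
Proof.
by move=> fm fn; apply: eq_FP (FP_andb (FP_leq fm fn) (FP_leq fn fm)) => x; rewrite eqn_leq.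
Qed.

Definition msb_val (l : seq bool) : nat := foldl (fun n (b : bool) => n + n + b) 0 l.

Lemma msb_val_rev s : msb_val (rev s) = of_bits s.
Proof. by rewrite /msb_val foldl_rev; elim: s => //= b s ->; rewrite -addnn; lia. Qed.

Lemma msb_val_take l i : msb_val (take i l) <= msb_val l.
Proof.
rewrite -[l in leqRHS](cat_take_drop i) /msb_val foldl_cat -/(msb_val _).
elim: (drop i l) (msb_val _) => //= b t IH v; apply: leq_trans (IH _); lia.
Qed.

Lemma msb_val_rcons l b : msb_val (rcons l b) = msb_val l + msb_val l + b.
Proof. by rewrite /msb_val foldl_rcons. Qed.

(** Horner's scheme from the most significant digit: no intermediate value exceeds the product. *)
Lemma FP_muln (X : encType) (m n : X -> nat) : FP m -> FP n -> FP (fun x => m x * n x).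
Proof.
move=> fm fn; pose f k (v : nat) (b : bool) := v + v + (if b then k else 0).
have fE k l : foldl (f k) 0 l = msb_val l * k.
  elim/last_ind: l => // l b; rewrite foldl_rcons msb_val_rcons /f => ->.
  by case: b; lia.
apply: (@eq_FP _ _ _ (fun x => foldl (f (n x)) 0 (rev (nat_bits (m x))))).
  by move=> x; rewrite fE msb_val_rev nat_bitsK.
have [g1 p1 S1] := sz_FP fm; have [g2 p2 S2] := sz_FP fn.
apply: (@FP_foldl _ _ _ (fun x => f (n x)) _ _ (fun k => 4 * (g1 k + g2 k) + 1)).
- by pbound.
- move=> x i; rewrite fE; apply: sz_nat_le.
  apply: (@leq_ltn_trans (m x * n x)).
    by rewrite leq_mul2r (leq_trans (msb_val_take _ _)) ?msb_val_rev ?nat_bitsK ?orbT.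
  apply: (@leq_trans (2 ^ sz (m x) * 2 ^ sz (n x))); last by rewrite -expnD leq_exp2l // leq_add.
  exact: ltn_mul (nat_lt_sz _) (nat_lt_sz _).
- have fn' : FP (fun y : X * (nat * bool) => n y.1) by apply: FP_comp fn _; fp.
  rewrite /f; apply: FP_addn; [apply: FP_addn; fp|fp].
- by fp.
- by apply: FP_rev; apply: FP_nat_bits.
Qed.

Definition divmod_step (d : nat) (st : nat * nat) (b : bool) : nat * nat :=
  let r := st.2 + st.2 + b in
  if d <= r then ((st.1 + st.1).+1, r - d) else (st.1 + st.1, r).
Definition divmod (a d : nat) : nat * nat := foldl (divmod_step d) (0, 0) (rev (nat_bits a)).

Lemma divmod_gen d l : 0 < d ->
  foldl (divmod_step d) (0, 0) l = (msb_val l %/ d, msb_val l %% d).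
Proof.
move=> d0; elim/last_ind: l => [|l b IH]; first by rewrite div0n mod0n.
rewrite foldl_rcons msb_val_rcons {}IH /divmod_step /=.
set h := msb_val l; have hE := divn_eq h d; have hlt := ltn_pmod h d0.
set q := h %/ d in hE *; set r := h %% d in hE hlt *.
have [le|lt] := leqP d (r + r + b).
  have e : h + h + b = (q + q).+1 * d + (r + r + b - d) by lia.
  have lt2 : r + r + b - d < d by case: b le {e}; lia.
  by rewrite e divnMDl // modnMDl divn_small // modn_small // addn0.
have e : h + h + b = (q + q) * d + (r + r + b) by lia.
by rewrite e divnMDl // modnMDl divn_small // modn_small // addn0.
Qed.

Lemma divmodE a d : 0 < d -> divmod a d = (a %/ d, a %% d).
Proof. by move=> d0; rewrite /divmod divmod_gen // msb_val_rev nat_bitsK. Qed.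

(** The bounds on the partial quotient and remainder hold for a zero divisor too, on which the
    program must also run in polynomial time. *)
Lemma FP_divmod (X : encType) (m n : X -> nat) : FP m -> FP n -> FP (fun x => divmod (m x) (n x)).
Proof.
move=> fm fn; pose f := divmod_step.
have fE d l : (foldl (f d) (0, 0) l).1 < 2 ^ size l /\ (foldl (f d) (0, 0) l).2 <= msb_val l.
  elim/last_ind: l => [|l b]; first by split.
  rewrite foldl_rcons msb_val_rcons size_rcons expnS.
  move: (foldl _ _ _) (expn_gt0 2 (size l)) => st p [h1 h2]; rewrite /f /divmod_step /=.
  by case: ifP => _ /=; split; lia.
have [g1 p1 S1] := sz_FP fm.
apply: (@FP_foldl _ _ _ (fun x => f (n x)) _ (fun x => rev (nat_bits (m x)))
   (fun k => 8 * (g1 k) + 20)).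
- by pbound.
- move=> x i; set l := rev (nat_bits (m x)).
  have [h1 h2] := fE (n x) (take i l).
  have sl : size l <= sz (m x).
    by rewrite size_rev size_nat_bits nat_lt_sz.
  apply: leq_trans (sz_nat_pair (k := sz (m x)) _ _) _; last by have := S1 x; lia.
    by apply: leq_trans h1 _; rewrite leq_exp2l // size_take; case: ifP; lia.
  apply: leq_ltn_trans h2 _; apply: leq_ltn_trans (msb_val_take _ _) _.
  by rewrite msb_val_rev nat_bitsK nat_lt_sz.
- have fn' : FP (fun y : X * ((nat * nat) * bool) => n y.1) by apply: FP_comp fn _; fp.
  have fr : FP (fun y : X * ((nat * nat) * bool) => y.2.1.2 + y.2.1.2 + y.2.2).
    apply: FP_addn; [apply: FP_addn; fp|].
    by apply: (FP_if (g := fun=> 1) (h := fun=> 0)); fp.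
  have fq : FP (fun y : X * ((nat * nat) * bool) => y.2.1.1 + y.2.1.1) by apply: FP_addn; fp.
  rewrite /f /divmod_step /=; apply: FP_if; first exact: FP_leq fn' fr.
    apply: FP_pair (FP_subn fr fn').
    apply: eq_FP (FP_addn fq (FP_const _ 1)) => y; by rewrite addn1.
  exact: FP_pair fq fr.
- by fp.
- by apply: FP_rev; apply: FP_nat_bits.
Qed.

(** Once the first component is the larger one, each round of Euclid's algorithm at least halves the
    product of the two, so the digits of [a] and [b] give enough rounds; the extra [true] pays for
    an initial exchange. *)
Definition gcd_loop (a b : nat) : nat * nat :=
  foldl (fun st (_ : bool) => if st.2 == 0 then st else (st.2, (divmod st.1 st.2).2)) (a, b)
    (true :: nat_bits a ++ nat_bits b).

Lemma gcd_loopE a b : (gcd_loop a b).1 = gcdn a b.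
Proof.
rewrite /gcd_loop; set f := fun (st : nat * nat) (_ : bool) => _.
have fE st x : f st x = if st.2 == 0 then st else (st.2, st.1 %% st.2).
  by rewrite /f; case: eqP => // /eqP; rewrite -lt0n => /divmodE ->.
have fg (l : seq bool) st : gcdn (foldl f st l).1 (foldl f st l).2 = gcdn st.1 st.2.
  elim: l st => //= x l IH st; rewrite IH fE; case: ifP => // _ /=.
  by rewrite gcdn_modr gcdnC.
have f0 (l : seq bool) st : st.2 <= st.1 -> st.1 * st.2 < 2 ^ size l -> (foldl f st l).2 = 0.
  elim: l st => [|x l IH] [u v] /= le; first by rewrite /=; nia.
  rewrite fE /=; have [->|v0] := eqVneq v 0 => lt.
    by rewrite IH //= muln0 expn_gt0.
  have ml := ltn_pmod u (_ : 0 < v); apply: IH => /=; first by apply/ltnW/ml; lia.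
  move: lt; rewrite expnS {1}(divn_eq u v); have : 0 < u %/ v by rewrite divn_gt0 //; lia.
  have := ml; nia.
have gE : (foldl f (a, b) (true :: nat_bits a ++ nat_bits b)).2 = 0.
  rewrite /= fE /=; have [b0|b0] := eqVneq b 0.
    by rewrite b0; apply: f0; rewrite /= ?muln0 ?expn_gt0.
  have ml := ltn_pmod a (_ : 0 < b); apply: f0 => /=; first by apply/ltnW/ml; lia.
  rewrite size_cat expnD mulnC; apply: ltn_mul; last exact: ltn_size_bits.
  exact: leq_ltn_trans (leq_mod _ _) (ltn_size_bits _).
by rewrite -(gcdn0 (foldl _ _ _).1) -gE fg.
Qed.

Lemma FP_gcdn (X : encType) (m n : X -> nat) : FP m -> FP n -> FP (fun x => gcdn (m x) (n x)).
Proof.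
move=> fm fn; apply: (@eq_FP _ _ _ (fun x => (gcd_loop (m x) (n x)).1)).
  by move=> x; rewrite gcd_loopE.
pose f (st : nat * nat) (b : bool) := if st.2 == 0 then st else (st.2, (divmod st.1 st.2).2).
have [g1 p1 S1] := sz_FP fm; have [g2 p2 S2] := sz_FP fn.
apply: FP_fst; apply: (@FP_foldl _ _ _ (fun x => f) (fun x => (m x, n x))
  (fun x => true :: nat_bits (m x) ++ nat_bits (n x)) (fun k => 8 * (g1 k + g2 k) + 20)).
- by pbound.
- move=> x i; set l := take _ _.
  have : (foldl f (m x, n x) l).1 <= maxn (m x) (n x) /\
         (foldl f (m x, n x) l).2 <= maxn (m x) (n x).
    elim/last_ind: l => [|l b]; first by rewrite /=; lia.
    rewrite foldl_rcons; set st := foldl _ _ _ => -[h1 h2]; rewrite /f; case: eqP => // /eqP st0.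
    split=> //=; rewrite divmodE /=; last by lia.
    by rewrite (leq_trans (leq_mod _ _)).
  set st := foldl _ _ _ => -[h1 h2].
  have M : maxn (m x) (n x) < 2 ^ (g1 (sz x) + g2 (sz x)).
    have : m x < 2 ^ (g1 (sz x) + g2 (sz x)).
      by apply: leq_trans (nat_lt_sz _) _; rewrite leq_exp2l // (leq_trans (S1 x)) ?leq_addr.
    have : n x < 2 ^ (g1 (sz x) + g2 (sz x)).
      by apply: leq_trans (nat_lt_sz _) _; rewrite leq_exp2l // (leq_trans (S2 x)) ?leq_addl.
    lia.
  by apply: leq_trans (sz_nat_pair (leq_ltn_trans h1 M) (leq_ltn_trans h2 M)) _; rewrite leq_add2l.
- have f1 : FP (fun y : X * ((nat * nat) * bool) => y.2.1.1) by fp.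
  have f2 : FP (fun y : X * ((nat * nat) * bool) => y.2.1.2) by fp.
  rewrite /f; apply: FP_if; [exact: FP_eq0|by fp|].
  by apply: FP_pair f2 (FP_snd (FP_divmod f1 f2)).
- by fp.
- by have := FP_nat_bits fm; have := FP_nat_bits fn => h1 h2; fp.
Qed.

Ltac fp_step_ext ::= first [ apply: FP_ltn | apply: FP_leq | apply: FP_eq0 | apply: FP_eqn
  | apply: FP_maxn | apply: FP_addn | apply: FP_subn | apply: FP_muln
  | apply: FP_divmod | apply: FP_gcdn | apply: FP_nat_bits ].

(** * The algorithm *)

Definition nfrac := (nat * nat)%type.

Definition fred (f : nfrac) : nfrac :=
  ((divmod f.1 (gcdn f.1 f.2)).1, (divmod f.2 (gcdn f.1 f.2)).1).
Definition fadd (f g : nfrac) : nfrac := fred (f.1 * g.2 + g.1 * f.2, f.2 * g.2).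
Definition fmul (f g : nfrac) : nfrac := fred (f.1 * g.1, f.2 * g.2).
Definition fdiv (f g : nfrac) : nfrac := fred (f.1 * g.2, f.2 * g.1).
Definition fsum (l : seq nfrac) : nfrac := foldl fadd (0, 1) l.

Arguments fred : simpl never.
Arguments fadd : simpl never.
Arguments fmul : simpl never.
Arguments fdiv : simpl never.
Arguments fsum : simpl never.

Section FracFP.
Variables (X : encType) (f g : X -> nfrac).
Hypotheses (ff : FP f) (fg : FP g).

Lemma FP_fred : FP (fun x => fred (f x)).
Proof. rewrite /fred; fp. Qed.

End FracFP.

Section FracFP2.
Variables (X : encType) (f g : X -> nfrac).
Hypotheses (ff : FP f) (fg : FP g).

Lemma FP_fadd : FP (fun x => fadd (f x) (g x)).
Proof. apply: FP_fred; fp. Qed.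

Lemma FP_fmul : FP (fun x => fmul (f x) (g x)).
Proof. apply: FP_fred; fp. Qed.

Lemma FP_fdiv : FP (fun x => fdiv (f x) (g x)).
Proof. apply: FP_fred; fp. Qed.

End FracFP2.

Lemma fred_le f : (fred f).1 <= f.1 /\ (fred f).2 <= f.2.
Proof.
have [g0|g0] := posnP (gcdn f.1 f.2).
  case: f g0 => a b /= g0; have [-> ->] : a = 0 /\ b = 0 by have := gcdn_gt0 a b; lia.
  by [].
by rewrite /fred !divmodE //= !leq_div.
Qed.

Lemma frac_lt (a : nfrac) : a.1 < 2 ^ sz a /\ a.2 < 2 ^ sz a.
Proof.
case: a => m n; rewrite sz_pair /=; split; apply: leq_trans (nat_lt_sz _) _.
  by rewrite leq_exp2l // ltnW // ltnS leq_addr.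
by rewrite leq_exp2l // ltnW // ltnS leq_addl.
Qed.

(** Each summand multiplies the bound by at most a power of 2 given by its own size, so partial sums
    keep a size linear in that of the list. *)
Lemma fsum_lt l : (fsum l).1 < 2 ^ sz l /\ (fsum l).2 < 2 ^ sz l.
Proof.
elim/last_ind: l => [|l a [h1 h2]] //.
have [a1 a2] := frac_lt a; set f := fsum l in h1 h2.
have [l1 l2] := fred_le (f.1 * a.2 + a.1 * f.2, f.2 * a.2).
rewrite /fsum foldl_rcons -/(fsum l) -/f sz_rcons expnS expnD; split.
  apply: leq_ltn_trans l1 _; have := ltn_mul h1 a2; have := ltn_mul h2 a1; rewrite /=; lia.
apply: leq_ltn_trans l2 _; have := ltn_mul h2 a2; rewrite /=; lia.
Qed.

Lemma FP_fsum (X : encType) (l : X -> seq nfrac) : FP l -> FP (fun x => fsum (l x)).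
Proof.
move=> fl; have [g pg Sg] := sz_FP fl.
apply: (@FP_foldl _ _ _ (fun=> fadd) (fun=> (0, 1)) l (fun k => 8 * g k + 20)) => //.
- by pbound.
- move=> x i; have [h1 h2] := fsum_lt (take i (l x)).
  apply: leq_trans (sz_nat_pair h1 h2) _; apply: leq_add => //; apply: leq_mul => //.
  exact: leq_trans (sz_take _ _) (Sg x).
- by apply: FP_fadd; fp.
- by fp.
Qed.

Definition state := seq (option nat).
Definition bits := seq bool.
(* A transition: preset, postset, weight and duration. *)
Definition rtrans := ((bits * bits) * (nfrac * nat))%type.

Definition renabled (pre : bits) (x : state) : bool :=
  all (fun pv => pv.1 ==> isSome pv.2) (zip pre x).
(** Applied to the sink instead of a preset, this is the date of the sink. *)
Definition rstart (pre : bits) (x : state) : nat :=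
  foldl (fun m pv => if pv.1 then maxn m (odflt 0 pv.2) else m) 0 (zip pre x).
Definition rupd (t : rtrans) (x : state) : state :=
  [seq if v.1.2 then Some (rstart t.1.1 x + t.2.2) else if v.1.1 then None else v.2
  | v <- zip (zip t.1.1 t.1.2) x].
Definition rsub (k : nat) (x : state) : state :=
  [seq if v is Some n then Some (n - k) else None | v <- x].
Definition rdep (p q : bits) : bool := has (fun ab => ab.1 && ab.2) (zip p q).
Definition rfinal (snk : bits) (x : state) : bool :=
  all (fun bv => isSome bv.2 == bv.1) (zip snk x).
Definition rbest (ts : seq rtrans) (x : state) : option rtrans :=
  foldl (fun best t => if renabled t.1.1 x && (if best is Some u
     then rstart t.1.1 x < rstart u.1.1 x else true) then Some t else best) None ts.
Definition rconflict (ts : seq rtrans) (x : state) (b : rtrans) : seq rtrans :=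
  [seq t <- ts | renabled t.1.1 x && rdep b.1.1 t.1.1].
(* The conflict set that can start first is fired, and all timestamps are
   reduced by the time that has elapsed, returned as a reward. *)
Definition rsucc (ts : seq rtrans) (x : state) : nat * seq (nfrac * state) :=
  if rbest ts x is Some b then
    (rstart b.1.1 x,
     [seq (fdiv t.2.1 (fsum [seq u.2.1 | u <- rconflict ts x b]), rupd t (rsub (rstart b.1.1 x) x))
     | t <- rconflict ts x b])
  else (0, [:: ((1, 1), x)]).

(** New states go to the front, so that the initial state stays last and its row is the one that
    elimination leaves. *)
Definition add_new (L : seq state) (y : state) : seq state :=
  if has (fun z => y == z) L then L else y :: L.
Definition close_step (ts : seq rtrans) (L : seq state) : seq state :=
  foldl add_new L (flatten [seq [seq q.2 | q <- (rsucc ts x).2] | x <- L]).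
Definition rstates (ts : seq rtrans) (x0 : state) (pad : seq bool) : seq state :=
  foldl (fun L _ => close_step ts L) [:: x0] pad.

(* The last two columns hold the probability of stopping and the reward. *)
Definition rrow (ts : seq rtrans) (snk : bits) (L : seq state) (x : state) : seq nfrac :=
  if rfinal snk x then [seq (0, 1) | y <- L] ++ [:: (1, 1); (rstart snk x, 1)]
  else [seq fsum [seq q.1 | q <- (rsucc ts x).2 & q.2 == y] | y <- L] ++
       [:: (0, 1); ((rsucc ts x).1, 1)].

(* State elimination in the subtraction-free form of Grassmann, Taksar and
   Heyman: the rows being stochastic apart from the reward, the pivot
   [1 - p] is the sum of the remaining entries. *)
Definition row_sum (T : seq nfrac) : nfrac := fsum (rev (behead (rev T))).
Definition elim_row (S : nfrac) (T R : seq nfrac) : seq nfrac :=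
  [seq fadd rt.1 (fmul (fdiv (head (0, 1) R) S) rt.2) | rt <- zip (behead R) T].
Definition elim_step (rows : seq (seq nfrac)) : option (seq (seq nfrac)) :=
  if rows is p :: rest then
    if (row_sum (behead p)).1 == 0 then None
    else Some [seq elim_row (row_sum (behead p)) (behead p) R | R <- rest]
  else None.
Definition elim_all (rows : seq (seq nfrac)) : option (seq (seq nfrac)) :=
  foldl (fun st (_ : seq nfrac) => if st is Some r then elim_step r else None) (Some rows) (behead rows).
(** The remaining row reads [x = p * x + u * a + r * b] with [u = 1 - p]; for [a = 0] and [b = 1]
    its solution is [r / u]. *)
Definition last_row (row : seq nfrac) : option nfrac :=
  if (head (0, 1) (behead row)).1 == 0 then None
  else Some (fdiv (head (0, 1) (behead (behead row))) (head (0, 1) (behead row))).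
Definition solve (rows : seq (seq nfrac)) : option nfrac :=
  if elim_all rows is Some r then last_row (head [::] r) else None.

Definition raw := ((bits * bits) * seq rtrans)%type.
Definition rinit (r : raw) : state := [seq if b then Some 0 else None | b <- r.1.1].
(* Only the length of [pad] matters: it bounds the number of closure steps. *)
Definition rrows (r : raw) (pad : seq bool) : seq (seq nfrac) :=
  [seq rrow r.2 r.1.2 (rstates r.2 (rinit r) pad) x | x <- rstates r.2 (rinit r) pad].
Definition expected_time (r : raw) (pad : seq bool) : option nfrac := solve (rrows r pad).

(** * Polynomial time of the steps of the algorithm *)

Lemma FP_size (X A : encType) (s : X -> seq A) : FP s -> FP (fun x => size (s x)).
Proof.
move=> fs; have E (l : seq A) n : foldl (fun n _ => n + 1) n l = size l + n.
  by elim: l n => //= _ l IH n; rewrite IH; lia.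
apply: (@eq_FP _ _ _ (fun x => foldl (fun n _ => n + 1) 0 (s x))).
  by move=> x; rewrite E addn0.
have [g pg Sg] := sz_FP fs.
apply: (@FP_foldl _ _ _ (fun=> fun n _ => n + 1) _ _ (fun k => 4 * g k + 1)) => //.
- by pbound.
- move=> x i; rewrite E addn0; apply: sz_nat_le; apply: leq_ltn_trans (_ : size (s x) < _).
    by rewrite size_take; case: ifP; lia.
  apply: leq_trans (ltn_expl _ (isT : 1 < 2)) _; rewrite leq_exp2l //.
  by have := size_le_sz (s x); have := Sg x; lia.
- by fp.
- by fp.
Qed.

Lemma FP_eq_state (X : encType) (s t : X -> state) :
  FP s -> FP t -> FP (fun x => s x == t x).
Proof.
move=> fs ft; apply: (@eq_FP _ _ _ (fun x => (size (s x) == size (t x)) &&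
   all (fun ab : option nat * option nat =>
     if ab.1 is Some m then (if ab.2 is Some n then m == n else false) else ~~ isSome ab.2)
     (zip (s x) (t x)))).
  move=> x; rewrite [LHS]eqseq_all all2E; congr (_ && _); apply: eq_all => -[[m|] [n|]] //=.
apply: FP_andb; first by apply: FP_eqn; apply: FP_size.
by fp.
Qed.

Ltac fp_var := match goal with
  H : @FP _ _ ?f |- FP (fun y => ?f (@?g y)) => apply: (FP_comp H (f := g)) end.
Ltac fp_arith := first [ apply: FP_ltn | apply: FP_leq | apply: FP_eq0 | apply: FP_eqn
  | apply: FP_maxn | apply: FP_addn | apply: FP_subn | apply: FP_muln
  | apply: FP_divmod | apply: FP_gcdn | apply: FP_nat_bits | apply: FP_fadd | apply: FP_fmul
  | apply: FP_fdiv | apply: FP_fsum | apply: FP_eq_state ].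
Ltac fp_step_ext ::= first [ fp_arith | fp_var ].

Section RawFP.
Variables (X : encType).

Lemma FP_renabled (p : X -> bits) (x : X -> state) :
  FP p -> FP x -> FP (fun a => renabled (p a) (x a)).
Proof. by move=> fpp fx; rewrite /renabled; fp. Qed.

Lemma FP_rdep (p q : X -> bits) : FP p -> FP q -> FP (fun a => rdep (p a) (q a)).
Proof. by move=> fpp fq; rewrite /rdep; fp. Qed.

Lemma FP_rfinal (p : X -> bits) (x : X -> state) :
  FP p -> FP x -> FP (fun a => rfinal (p a) (x a)).
Proof. by move=> fpp fx; rewrite /rfinal; fp. Qed.

Lemma FP_rsub (k : X -> nat) (x : X -> state) :
  FP k -> FP x -> FP (fun a => rsub (k a) (x a)).
Proof. by move=> fk fx; rewrite /rsub; fp. Qed.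

Lemma FP_rstart (p : X -> bits) (x : X -> state) :
  FP p -> FP x -> FP (fun a => rstart (p a) (x a)).
Proof.
move=> fpp fx; apply: (@FP_foldl_add _ _ _
  (fun _ m (pv : bool * option nat) => if pv.1 then maxn m (odflt 0 pv.2) else m) _ _ id).
- exact: pbounded_id.
- move=> a m [[] [n|]] //=; rewrite ?maxn0 ?leq_addr // !sz_pair sz_Some.
  by rewrite /maxn; case: ifP => _; lia.
- by fp.
- by fp.
- by fp.
Qed.

End RawFP.

Ltac fp_marking := first [ apply: FP_renabled | apply: FP_rdep | apply: FP_rfinal
  | apply: FP_rsub | apply: FP_rstart ].
Ltac fp_step_ext ::= first [ fp_arith | fp_marking | fp_var ].

Section RawFP2.
Variables (X : encType).

Lemma FP_rupd (t : X -> rtrans) (x : X -> state) : FP t -> FP x -> FP (fun a => rupd (t a) (x a)).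
Proof. by move=> ft fx; rewrite /rupd; fp. Qed.

Lemma FP_rconflict (ts : X -> seq rtrans) (x : X -> state) (b : X -> rtrans) :
  FP ts -> FP x -> FP b -> FP (fun a => rconflict (ts a) (x a) (b a)).
Proof. by move=> ft fx fb; rewrite /rconflict; fp. Qed.

Lemma FP_rbest (ts : X -> seq rtrans) (x : X -> state) :
  FP ts -> FP x -> FP (fun a => rbest (ts a) (x a)).
Proof.
move=> ft fx; apply: (@FP_foldl_add _ _ _
  (fun a best t => if renabled t.1.1 (x a) && (if best is Some u
     then rstart t.1.1 (x a) < rstart u.1.1 (x a) else true) then Some t else best) _ _ (fun n => n + 2)).
- by pbound.
- by move=> a m t; case: ifP => _; rewrite ?sz_Some; lia.
- by fp.
- by fp.
- by fp.
Qed.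

Lemma FP_add_new (L : X -> seq state) (y : X -> state) :
  FP L -> FP y -> FP (fun a => add_new (L a) (y a)).
Proof. by move=> fL fy; rewrite /add_new; fp. Qed.

Lemma FP_row_sum (T : X -> seq nfrac) : FP T -> FP (fun a => row_sum (T a)).
Proof. by move=> fT; rewrite /row_sum; fp. Qed.

Lemma FP_elim_row (S : X -> nfrac) (T R : X -> seq nfrac) :
  FP S -> FP T -> FP R -> FP (fun a => elim_row (S a) (T a) (R a)).
Proof. by move=> fS fT fR; rewrite /elim_row; fp. Qed.

Lemma FP_last_row (R : X -> seq nfrac) : FP R -> FP (fun a => last_row (R a)).
Proof. by move=> fR; rewrite /last_row; fp. Qed.

End RawFP2.

Ltac fp_system := first [ apply: FP_rupd | apply: FP_rconflict | apply: FP_rbest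
  | apply: FP_add_new | apply: FP_row_sum | apply: FP_elim_row | apply: FP_last_row ].
Ltac fp_step_ext ::= first [ fp_arith | fp_marking | fp_system | fp_var ].

Section RawFP3.
Variables (X : encType).

Lemma FP_rsucc (ts : X -> seq rtrans) (x : X -> state) :
  FP ts -> FP x -> FP (fun a => rsucc (ts a) (x a)).
Proof. by move=> ft fx; rewrite /rsucc; fp. Qed.

Lemma FP_elim_step (rows : X -> seq (seq nfrac)) :
  FP rows -> FP (fun a => elim_step (rows a)).
Proof. by move=> fr; rewrite /elim_step; fp. Qed.

End RawFP3.

Ltac fp_step_ext ::= first [ fp_arith | fp_marking | fp_system
  | apply: FP_rsucc | apply: FP_elim_step | fp_var ].

Section RawFP4.
Variables (X : encType).

Lemma FP_close_step (ts : X -> seq rtrans) (L : X -> seq state) :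
  FP ts -> FP L -> FP (fun a => close_step (ts a) (L a)).
Proof.
move=> ft fL; apply: (@FP_foldl_add _ _ _ (fun _ => add_new) _ _ (fun n => n + 2)).
- by pbound.
- by move=> a v t; rewrite /add_new; case: ifP => _; rewrite ?sz_cons; lia.
- by fp.
- by fp.
- by fp.
Qed.

Lemma FP_rrow (ts : X -> seq rtrans) (snk : X -> bits) (L : X -> seq state) (x : X -> state) :
  FP ts -> FP snk -> FP L -> FP x -> FP (fun a => rrow (ts a) (snk a) (L a) (x a)).
Proof. by move=> ft fs fL fx; rewrite /rrow; fp. Qed.

End RawFP4.

Section RawFP5.
Variables (X : encType).

Lemma FP_rstates (g : nat -> nat) (ts : X -> seq rtrans) (x0 : X -> state) (pad : X -> seq bool) :
  pbounded g ->
  (forall a i, sz (rstates (ts a) (x0 a) (take i (pad a))) <= g (sz a)) ->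
  FP ts -> FP x0 -> FP pad -> FP (fun a => rstates (ts a) (x0 a) (pad a)).
Proof.
move=> pg H ft fx fpad; apply: (@FP_foldl _ _ _ (fun a L _ => close_step (ts a) L) _ _ g) => //.
  by apply: FP_close_step; fp.
by fp.
Qed.

Lemma FP_solve (g : nat -> nat) (rows : X -> seq (seq nfrac)) :
  pbounded g ->
  (forall a i, sz (foldl (fun st (_ : seq nfrac) => if st is Some r then elim_step r else None)
     (Some (rows a)) (take i (behead (rows a)))) <= g (sz a)) ->
  FP rows -> FP (fun a => solve (rows a)).
Proof.
move=> pg H fr.
have fe : FP (fun a => elim_all (rows a)).
  apply: (@FP_foldl _ _ _ (fun _ st (_ : seq nfrac) => if st is Some r then elim_step r else None)
    _ _ g) => //; fp.
by rewrite /solve; fp.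
Qed.

End RawFP5.

(** * Timestamps of confusion-free nets *)

Section Timing.
Variable W : tpwn.
Implicit Types (x y : timestamp W) (t u v w : trans W) (p q r : place W).

Definition supp x : {set place W} := [set p | x p != None].
Definition tstart x t : nat := \max_(q in preset t) odflt 0 (x q).

Definition tinit : timestamp W := [ffun p => if p == src W then Some 0 else None].

Inductive treach : timestamp W -> Prop :=
| treach_init : treach tinit
| treach_upd x t : treach x -> senabled (supp x) t -> treach (upd x t).

Lemma bmaxE x t : senabled (supp x) t ->
  \big[bmax/None]_(q in preset t) x q = Some (tstart x t).
Proof.
move=> /fintype.subsetP en; have [p pt] := preset_neq0 t (tpwn_workflow W).
have bS (I : Type) (s : seq I) (f : I -> nat) (P : pred I) : has P s ->
    \big[bmax/None]_(q <- s | P q) Some (f q) = Some (\max_(q <- s | P q) f q).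
  elim: s => //= a s IH; rewrite !big_cons; case: ifP => //= Pa.
  case: (boolP (has P s)) => [h|nh] _; first by rewrite IH.
  by rewrite !big_hasC // maxn0.
rewrite (eq_bigr (fun q => Some (odflt 0 (x q)))) => [|q qt]; last first.
  by have := en q qt; rewrite inE; case: (x q).
by rewrite bS //; apply/hasP; exists p; rewrite ?mem_index_enum // inE.
Qed.

Lemma updE x t : senabled (supp x) t -> upd x t =
  [ffun p => if p \in postset t then Some (tstart x t + duration t)
             else if p \in preset t then None else x p].
Proof. by move=> en; apply/ffunP => p; rewrite !ffunE bmaxE. Qed.

Lemma supp_upd x t : senabled (supp x) t -> supp (upd x t) = sfire (supp x) t.
Proof.
move=> en; rewrite updE //; apply/setP => p; rewrite !inE !ffunE !inE orbC.
by case: (arc_tp t p) => //=; case: (arc_pt p t).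
Qed.

Lemma supp_tinit : supp tinit = [set src W].
Proof. by apply/setP => p; rewrite !inE ffunE; case: (p == src W). Qed.

Lemma treach_reachable x : treach x -> reachable (marking_of (supp x)).
Proof.
elim=> [|{}x t rx IH en]; first by rewrite supp_tinit; exact: reachable_init.
rewrite supp_upd // -sfireE //; last exact: tpwn_one_safe.
by apply: reachable_fire => //; rewrite senabledE.
Qed.

Lemma treach_safe x t p : treach x -> senabled (supp x) t ->
  p \in supp x -> p \notin preset t -> p \notin postset t.
Proof.
move=> rx en px npt; apply/negP => pt.
have := tpwn_one_safe (reachable_fire (treach_reachable rx) (etrans (senabledE _ _) en)) p.
by rewrite !ffunE px (negPf npt) pt.
Qed.

Lemma dependentC t u : dependent t u = dependent u t.
Proof. by rewrite /dependent disjoint_sym. Qed.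

Lemma ndependentP t u : reflect (forall p, p \in preset t -> p \notin preset u) (~~ dependent t u).
Proof.
rewrite negbK; apply: (iffP idP) => [d p pt|H]; first by rewrite (disjointFr d).
by rewrite disjoint_subset; apply/fintype.subsetP => p /H.
Qed.

Lemma dependentP t u : reflect (exists2 p, p \in preset t & p \in preset u) (dependent t u).
Proof.
apply: (iffP idP) => [|[p pt pu]]; last by apply/negP => /disjointFr/(_ pt); rewrite pu.
by move=> /pred0Pn[p /= /andP[pt pu]]; exists p.
Qed.

Lemma concurrent_enabled x t u : treach x -> senabled (supp x) t -> senabled (supp x) u ->
  ~~ dependent t u -> senabled (supp (upd x t)) u.
Proof.
move=> rx et eu /ndependentP ntu; rewrite supp_upd //; apply/fintype.subsetP => p pu.
rewrite finset.in_setU finset.in_setD (fintype.subsetP eu) // andbT.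
by case: (boolP (p \in preset t)) => // /ntu; rewrite pu.
Qed.

(** An input place of [u] already holds a token, which [t] does not take; by 1-safety [t] cannot add
    another one. *)
Lemma concurrent_post x t u p : treach x -> senabled (supp x) t -> senabled (supp x) u ->
  ~~ dependent t u -> p \in postset t -> p \notin preset u.
Proof.
move=> rx et eu /ndependentP ntu pt; apply/negP => pu.
have := treach_safe rx et (fintype.subsetP eu _ pu).
by rewrite pt => H; apply/negP/H: isT; apply/negP => /ntu; rewrite pu.
Qed.

Lemma concurrent_start x t u : treach x -> senabled (supp x) t -> senabled (supp x) u ->
  ~~ dependent t u -> tstart (upd x t) u = tstart x u.
Proof.
move=> rx et eu ntu; apply: eq_bigr => q qu; rewrite updE // ffunE.
case: ifP => [/(concurrent_post rx et eu ntu)|_]; first by rewrite qu.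
by case: ifP => // qt; move/ndependentP: ntu => /(_ _ qt); rewrite qu.
Qed.

(** Neither transition changes the start of the other, and by 1-safety they have no common output
    place, so neither overwrites the tokens of the other. *)
Lemma upd_comm x t u : treach x -> senabled (supp x) t -> senabled (supp x) u ->
  ~~ dependent t u -> upd (upd x t) u = upd (upd x u) t.
Proof.
move=> rx et eu ntu; have nut : ~~ dependent u t by rewrite dependentC.
have eut := concurrent_enabled rx et eu ntu; have etu := concurrent_enabled rx eu et nut.
rewrite (updE eut) (updE etu) (concurrent_start rx et eu ntu) (concurrent_start rx eu et nut).
rewrite (updE et) (updE eu); apply/ffunP => p; rewrite !ffunE.
have h1 := @concurrent_post x t u p rx et eu ntu; have h2 := @concurrent_post x u t p rx eu et nut.
have h3 := treach_safe (treach_upd rx et) eut (_ : p \in _).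
move: h1 h2 h3; rewrite supp_upd // !inE.
case: (arc_tp t p) => /= [/(_ isT) nup _|_]; last first.
  case: (arc_tp u p) => [/(_ isT)/negPf->//|_ _].
  by case: (arc_pt p t); case: (arc_pt p u).
rewrite orbT => /(_ isT); rewrite nup => /(_ isT)/negPf ->.
by rewrite (negPf nup).
Qed.

Lemma treach_cf x t u : treach x -> senabled (supp x) t -> senabled (supp x) u ->
  ~~ dependent t u -> conflict_set u (supp x) = conflict_set u (supp x :\: preset t) /\
  conflict_set u (supp x) = conflict_set u (supp (upd x t)).
Proof.
move=> rx et eu ntu; rewrite supp_upd //.
exact: tpwn_confusion_free (treach_reachable rx) et eu ntu.
Qed.

Lemma in_conflict x t u : (u \in conflict_set t (supp x)) = senabled (supp x) u && dependent t u.
Proof. by rewrite inE. Qed.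

(** If [t] and [v] were independent, [u] would by confusion-freeness remain in the conflict set of
    [v] once the preset of [t] is removed, although it shares a place with [t]. Thus conflict sets
    partition the enabled transitions. *)
Lemma dependent_trans x t u v : treach x -> senabled (supp x) t -> senabled (supp x) u ->
  senabled (supp x) v -> dependent t u -> dependent u v -> dependent t v.
Proof.
move=> rx et eu ev tu uv; case: (boolP (dependent t v)) => // ntv.
have [E _] := treach_cf rx et ev ntv.
have : u \in conflict_set v (supp x) by rewrite in_conflict eu dependentC.
rewrite E inE => /andP[/fintype.subsetP su _].
by have /dependentP[p pt /su] := tu; rewrite inE pt.
Qed.

Lemma conflict_set_eq x t u : treach x -> senabled (supp x) t -> senabled (supp x) u ->
  dependent t u -> conflict_set t (supp x) = conflict_set u (supp x).
Proof.
move=> rx et eu tu; apply/setP => v; rewrite !in_conflict.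
case ev: (senabled (supp x) v) => //=; apply/idP/idP.
  by apply: (dependent_trans rx) => //; rewrite dependentC.
exact: (dependent_trans rx).
Qed.

(** The tokens that [z] uses survive the firing of [b], hence were present before it and are not
    taken by [b]. *)
Lemma cold_step y b z : senabled (supp y) b -> senabled (supp (upd y b)) z ->
  [disjoint preset z & postset b] -> senabled (supp y) z /\ ~~ dependent b z.
Proof.
move=> eb ez dz.
have s : preset z \subset supp y :\: preset b.
  apply/fintype.subsetP => p pz; have := fintype.subsetP ez p pz.
  by rewrite supp_upd // finset.in_setU (disjointFr dz pz) orbF.
split; first exact: fintype.subset_trans s (finset.subsetDl _ _).
apply/ndependentP => p pv; apply/negP => /(fintype.subsetP s).
by rewrite inE pv.
Qed.

(* By confusion-freeness [v] cannot create a conflict between a transition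
   and one that uses no token of [v]. *)
Lemma conflict_before y v t u : treach y -> senabled (supp y) v ->
  senabled (supp (upd y v)) t -> senabled (supp (upd y v)) u -> dependent t u ->
  [disjoint preset u & postset v] ->
  [/\ senabled (supp y) t, senabled (supp y) u, [disjoint preset t & postset v]
    & tstart (upd y v) u = tstart y u].
Proof.
move=> ry ev et eu tu duv.
have [euy nvu] := cold_step ev eu duv.
have [E1 E2] := treach_cf ry ev euy nvu.
have : t \in conflict_set u (supp (upd y v)) by rewrite in_conflict et dependentC.
rewrite -E2 E1 inE => /andP[st _].
split=> //; first exact: fintype.subset_trans st (finset.subsetDl _ _).
  rewrite disjoint_subset; apply/fintype.subsetP => p /(fintype.subsetP st).
  by rewrite inE => /andP[npv py]; rewrite inE; exact: (treach_safe ry ev).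
exact: concurrent_start.
Qed.

Fixpoint runs y (s : seq (trans W)) : bool :=
  if s is t :: s' then senabled (supp y) t && runs (upd y t) s' else true.
Definition exec_run y s := foldl (@upd W) y s.

Lemma runs_rcons y s t : runs y (rcons s t) = runs y s && senabled (supp (exec_run y s)) t.
Proof. by elim: s y => [|a s IH] y /=; rewrite ?andbT // IH andbA. Qed.

Lemma runs_cat y s s' : runs y (s ++ s') = runs y s && runs (exec_run y s) s'.
Proof. by elim: s y => [|a s IH] y //=; rewrite IH andbA. Qed.

Lemma treach_runs y s : treach y -> runs y s -> treach (exec_run y s).
Proof. by elim: s y => //= a s IH y ry /andP[ea]; apply: IH; exact: treach_upd. Qed.

(** A transition that uses nothing produced by the block moves to its front by successive
    applications of [upd_comm]. *)
Lemma swap_block y s z : treach y -> runs y (rcons s z) ->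
  {in s, forall b, [disjoint preset z & postset b]} ->
  runs y (z :: s) /\ exec_run y (z :: s) = exec_run y (rcons s z).
Proof.
move=> ry; elim/last_ind: s z => [|s b IH] z //.
rewrite runs_rcons runs_rcons => /andP[/andP[rs eb]].
rewrite /exec_run foldl_rcons -/(exec_run y s) => ez cold.
have ryb := treach_runs ry rs.
have [|ez' nbz] := cold_step eb ez; first by apply: cold; rewrite mem_rcons mem_head.
have [||r E] := IH z.
- by rewrite runs_rcons rs.
- by move=> c cs; apply: cold; rewrite mem_rcons inE cs orbT.
have E' : exec_run (upd y z) s = upd (exec_run y s) z.
  by move: E; rewrite /exec_run /= foldl_rcons.
split; first by move: r => /= /andP[-> r]; rewrite runs_rcons r E' concurrent_enabled // dependentC.
rewrite /exec_run /= !foldl_rcons -/(exec_run _ s) E' -/(exec_run _ s).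
by apply: upd_comm => //; rewrite dependentC.
Qed.

(* [hot (postset w) s]: in the run [w :: s] every transition of [s] consumes a
   token produced, directly or not, by [w]. The others can be fired before
   [w]. *)
Fixpoint hot (P : {set place W}) (s : seq (trans W)) : bool :=
  if s is b :: s' then ~~ [disjoint preset b & P] && hot (P :|: postset b) s' else true.
Definition posts (s : seq (trans W)) : {set place W} := \bigcup_(b <- s) postset b.

Lemma posts_rcons s b : posts (rcons s b) = posts s :|: postset b.
Proof. by rewrite /posts -cats1 big_cat big_seq1. Qed.

Lemma hot_rcons P s b : hot P (rcons s b) = hot P s && ~~ [disjoint preset b & P :|: posts s].
Proof.
elim: s P => [|a s IH] P /=; first by rewrite /posts big_nil finset.setU0 andbT.
by rewrite IH /posts big_cons finset.setUA andbA.
Qed.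

Lemma le_tstart x t p : p \in preset t -> odflt 0 (x p) <= tstart x t.
Proof. by move=> pt; rewrite /tstart; exact: (leq_bigmax_cond _ pt). Qed.

(** Dates do not decrease along a causal chain from [w], because a firing starts no earlier than any
    of its input tokens is available. *)
Lemma hot_inv y w s : treach y -> runs y (w :: s) -> hot (postset w) s ->
  forall p, p \in posts (w :: s) -> p \in supp (exec_run y (w :: s)) ->
  tstart y w + duration w <= odflt 0 (exec_run y (w :: s) p).
Proof.
move=> ry; elim/last_ind: s => [|s b IH].
  rewrite /= andbT /posts => ew _ p; rewrite big_seq1 /exec_run /= updE // ffunE => ->.
  by rewrite /=.
rewrite -rcons_cons runs_rcons hot_rcons posts_rcons => /andP[rs eb] /andP[hs hb] p.
rewrite /exec_run foldl_rcons -/(exec_run y (w :: s)) finset.in_setU => pp ps.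
have {}IH := IH rs hs; have {hs}hb : ~~ [disjoint preset b & posts (w :: s)].
  by move: hb; rewrite /posts big_cons.
set x := exec_run _ _ in eb IH ps *.
have L : tstart y w + duration w <= tstart x b.
  have /pred0Pn[q /= /andP[qb qs]] := hb.
  by apply: leq_trans (le_tstart x qb); apply: IH qs _; exact: (fintype.subsetP eb).
move: pp ps; rewrite supp_upd // updE // ffunE; case: ifP => [_ _ _|npb] /=.
  exact: leq_trans L (leq_addr _ _).
rewrite orbF finset.in_setU npb orbF finset.in_setD => ps /andP[/negPf -> px].
exact: IH.
Qed.

(** Going backwards from the end, the conflict already exists before the last transition as long as
    that one produces no token of [u]. It cannot exist before [w], which produces the token of [t]
    in [r]. Hence [w] or some hot transition feeds [u], and what it produces is dated no earlier
    than the end of [w]. *)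
Lemma hot_conflict y w s t u r : treach y -> runs y (w :: s) -> hot (postset w) s ->
  let x := exec_run y (w :: s) in
  senabled (supp x) t -> senabled (supp x) u -> dependent t u ->
  r \in preset t -> r \in postset w -> tstart y w + duration w <= tstart x u.
Proof.
move=> ry + + /=; elim/last_ind: s => [|s b IH].
  rewrite /= andbT => ew _ et eu tu rt rw.
  have [d|/pred0Pn[p /= /andP[pu pw]]] := boolP [disjoint preset u & postset w].
    have [_ _ d' _] := conflict_before ry ew et eu tu d.
    by move: (disjointFr d' rt); rewrite rw.
  by apply: leq_trans (le_tstart _ pu); rewrite updE // ffunE pw.
rewrite -rcons_cons => rs hs.
move: (rs) (hs); rewrite runs_rcons hot_rcons => /andP[rs' eb] /andP[hs' hb].
have hi := hot_inv ry rs'; move: hb => hb et eu tu rt rw.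
have ryb := treach_runs ry rs'.
rewrite /exec_run foldl_rcons -/(exec_run y (w :: s)) in et eu *.
have [d|/pred0Pn[p /= /andP[pu pb]]] := boolP [disjoint preset u & postset b].
  have [et' eu' _ E] := conflict_before ryb eb et eu tu d.
  by rewrite E; exact: (IH rs' hs').
apply: leq_trans (le_tstart _ pu); rewrite updE // ffunE pb /=.
apply: leq_trans (leq_addr _ _).
have /pred0Pn[q /= /andP[qb qs]] := hb.
apply: leq_trans (le_tstart _ qb); apply: hi => //; last exact: (fintype.subsetP eb).
by move: qs; rewrite /posts big_cons.
Qed.

(** The transitions of [s'] are treated in turn: a hot one joins the block [s], a cold one is moved
    before [w], which changes neither the start of [w] nor the timestamp finally reached. *)
Lemma producer_conflict y w s s' t u r : treach y -> runs y (w :: s ++ s') -> hot (postset w) s ->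
  let x := exec_run y (w :: s ++ s') in
  senabled (supp x) t -> senabled (supp x) u -> dependent t u ->
  r \in preset t -> r \in postset w -> tstart y w + duration w <= tstart x u.
Proof.
elim: s' y s => [|z s' IH] y s ry /=; first by rewrite cats0; exact: hot_conflict.
rewrite -cat_rcons => /andP[ew rs] hs et eu tu rt rw.
have [hz|/negPn cz] := boolP (~~ [disjoint preset z & postset w :|: posts s]).
  apply: (IH y (rcons s z)) => //=; first by rewrite ew.
  by rewrite hot_rcons hs.
have cold b : b \in w :: s -> [disjoint preset z & postset b].
  move=> bs; apply: fintype.disjointWr cz.
  have -> : postset w :|: posts s = posts (w :: s) by rewrite /posts big_cons.
  by rewrite /posts (big_rem b bs) /= finset.subsetUl.
move: rs; rewrite runs_cat => /andP[rs rs'].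
have ryw := treach_upd ry ew.
have [|rz Ez] := swap_block ryw rs; first by move=> b bs; apply: cold; rewrite inE bs orbT.
move: rz => /= /andP[ezw rz].
have [ez nwz] := cold_step ew ezw (cold w (mem_head _ _)).
have nzw : ~~ dependent z w by rewrite dependentC.
have E : upd (upd y z) w = upd (upd y w) z by rewrite upd_comm.
have ryz := treach_upd ry ez.
have Ex : exec_run (upd y z) (w :: s ++ s') = exec_run y (w :: rcons s z ++ s').
  rewrite /exec_run /= !foldl_cat -!/(exec_run _ _) E; congr (exec_run _ s').
  by rewrite -Ez.
rewrite -(concurrent_start ry ez ew nzw).
have rn : runs (upd y z) (w :: s ++ s').
  rewrite /= concurrent_enabled //= E runs_cat rz /=.
  by have -> : exec_run (upd (upd y w) z) s = exec_run (upd y w) (rcons s z) by rewrite -Ez.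
by have := IH _ s ryz rn hs; cbv zeta; rewrite Ex; apply.
Qed.

Lemma producer x r : treach x -> r \in supp x ->
  x r = Some 0 \/ exists y w s, [/\ treach y, runs y (w :: s), x = exec_run y (w :: s),
    r \in postset w & x r = Some (tstart y w + duration w)].
Proof.
elim=> [|{}x t rx IH et]; first by rewrite supp_tinit inE => /eqP ->; left; rewrite ffunE eqxx.
rewrite supp_upd // finset.in_setU finset.in_setD; have [rt _|nrt] := boolP (r \in postset t).
  by right; exists x, t, [::]; rewrite /= et updE // ffunE rt.
rewrite orbF => /andP[npt /IH[x0|[y [w [s [ry rs xE rw xr]]]]]].
  by left; rewrite updE // ffunE (negPf nrt) (negPf npt).
right; exists y, w, (rcons s t); split => //.
- by rewrite -rcons_cons runs_rcons rs -xE.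
- by rewrite -rcons_cons /exec_run foldl_rcons -/(exec_run _ _) -xE.
- by rewrite updE // ffunE (negPf nrt) (negPf npt).
Qed.

Lemma tstart_conflict x t u : treach x -> senabled (supp x) t -> senabled (supp x) u ->
  dependent t u -> tstart x t = tstart x u.
Proof.
move=> rx; move: t u; suff le t u : senabled (supp x) t -> senabled (supp x) u ->
    dependent t u -> tstart x t <= tstart x u.
  by move=> t u et eu tu; apply/eqP; rewrite eqn_leq !le // dependentC.
move=> et eu tu; apply/bigmax_leqP => r rt.
have [->//|[y [w [s [ry rs xE rw ->]]]]] := producer rx (fintype.subsetP et r rt).
rewrite /= xE; apply: (@producer_conflict y w [::] s t u r) => //; by rewrite -xE.
Qed.

Lemma snk_dead x t : supp x = [set snk W] -> ~~ senabled (supp x) t.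
Proof.
move=> ->; have [p pt] := preset_neq0 t (tpwn_workflow W).
apply/negP => /fintype.subsetP/(_ p); rewrite !inE => /(_ pt)/eqP pE.
by have [_ /(_ t) + _] := tpwn_workflow W; rewrite -pE pt.
Qed.

Lemma postset_neq0 t : exists p, p \in postset t.
Proof.
have [_ _ /(_ (inr t) (inl (src W)))/connectP[[|[p|//] s] //= /andP[tp _] _]] := tpwn_workflow W.
by exists p; rewrite inE.
Qed.

End Timing.

(** * State elimination *)

Local Open Scope ring_scope.

Definition fval {K : realFieldType} (f : nfrac) : K := f.1%:R / f.2%:R.
(** Lowest terms are the form that [enc_rat] outputs; they also force each part to divide that of
    any other representation of the value, whence the size bounds in [fwf_bound]. *)
Definition fwf (f : nfrac) : bool := (0 < f.2)%N && coprime f.1 f.2.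

Section Rows.
Variable K : realFieldType.
Local Notation fval := (@fval K).

Lemma fval_ge0 f : 0 <= fval f.
Proof. by rewrite /fval divr_ge0 ?ler0n. Qed.

Lemma fval_eq0 f : (0 < f.2)%N -> (fval f == 0) = (f.1 == 0%N).
Proof. by move=> h; rewrite /fval mulf_eq0 invr_eq0 !pnatr_eq0 (gtn_eqF h) orbF. Qed.

Lemma fredP f : (0 < f.2)%N -> fwf (fred f) /\ fval (fred f) = fval f.
Proof.
move=> f0; have g0 : (0 < gcdn f.1 f.2)%N by rewrite gcdn_gt0 f0 orbT.
rewrite /fred !divmodE //= /fwf /fval /=.
have e1 := divnK (dvdn_gcdl f.1 f.2); have e2 := divnK (dvdn_gcdr f.1 f.2).
split; last first.
  have key (a b g : nat) : (0 < g)%N -> a%:R / b%:R = (a * g)%:R / (b * g)%:R :> K.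
    by move=> h; rewrite !natrM -mulf_div divff ?mulr1 // pnatr_eq0 -lt0n.
  by rewrite (key _ _ _ g0) e1 e2.
apply/andP; split; first by rewrite divn_gt0 // dvdn_leq // dvdn_gcdr.
rewrite /coprime -(eqn_pmul2r g0) mul1n muln_gcdl e1 e2 //.
Qed.

Lemma fwf_gt0 f : fwf f -> (0 < f.2)%N. Proof. by case/andP. Qed.

Lemma natr_neq0 n : (0 < n)%N -> n%:R != 0 :> K.
Proof. by rewrite pnatr_eq0 -lt0n. Qed.

Lemma faddP f g : (0 < f.2)%N -> (0 < g.2)%N -> fwf (fadd f g) /\ fval (fadd f g) = fval f + fval g.
Proof.
move=> f0 g0; have [|w ->] := @fredP (f.1 * g.2 + g.1 * f.2, f.2 * g.2)%N; first by rewrite muln_gt0 f0.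
split=> //; rewrite /fval /= natrD !natrM; field; by rewrite !natr_neq0.
Qed.

Lemma fmulP f g : (0 < f.2)%N -> (0 < g.2)%N -> fwf (fmul f g) /\ fval (fmul f g) = fval f * fval g.
Proof.
move=> f0 g0; have [|w ->] := @fredP (f.1 * g.1, f.2 * g.2)%N; first by rewrite muln_gt0 f0.
split=> //; rewrite /fval /= !natrM; field; by rewrite !natr_neq0.
Qed.

Lemma fdivP f g : (0 < f.2)%N -> (0 < g.2)%N -> (0 < g.1)%N ->
  fwf (fdiv f g) /\ fval (fdiv f g) = fval f / fval g.
Proof.
move=> f0 g0 g1; have [|w ->] := @fredP (f.1 * g.2, f.2 * g.1)%N; first by rewrite muln_gt0 f0.
split=> //; rewrite /fval /= !natrM; field; by rewrite !natr_neq0.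
Qed.

Lemma fsumP l : all fwf l -> fwf (fsum l) /\ fval (fsum l) = \sum_(f <- l) fval f.
Proof.
have gen v : fwf v -> all fwf l -> fwf (foldl fadd v l) /\
    fval (foldl fadd v l) = fval v + \sum_(f <- l) fval f.
  elim: l v => [|f l IH] v wv; first by rewrite big_nil addr0.
  move=> /= /andP[wf wl]; have [w' e'] := faddP (fwf_gt0 wv) (fwf_gt0 wf).
  by have [w'' ->] := IH _ w' wl; rewrite e' big_cons addrA.
by move=> /(gen (0, 1)%N isT)[w ->]; split=> //; rewrite /fval /= mul0r add0r.
Qed.

Fixpoint rdot (R : seq nfrac) (x : seq K) : K :=
  if R is r :: R' then if x is a :: x' then fval r * a + rdot R' x' else 0 else 0.

Lemma rdot_nth R x : size R = size x -> rdot R x = \sum_(i < size R) fval (nth (0, 1)%N R i) * x`_i.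
Proof.
elim: R x => [|r R IH] [|a x] //=; first by rewrite big_ord0.
by move=> [e]; rewrite big_ord_recl /= IH.
Qed.

Lemma rdot_ge0 R x : all (>= 0) x -> 0 <= rdot R x.
Proof.
elim: R x => [|r R IH] [|a x] //= /andP[a0 x0].
by rewrite addr_ge0 ?IH // mulr_ge0 ?fval_ge0.
Qed.

Lemma row_sumE T : all fwf T -> fwf (row_sum T) /\
  fval (row_sum T) = rdot T (rcons (nseq (size T).-1 1) 0).
Proof.
case/lastP: T => [|T t]; first by split=> //; rewrite /fval mul0r.
rewrite all_rcons /row_sum rev_rcons /= revK size_rcons /= => /andP[_ wT].
have [w ->] := fsumP wT; split => //.
elim: T {wT w} => [|r T IH]; first by rewrite big_nil /= mulr0 addr0.
by rewrite big_cons IH /= mulr1.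
Qed.

Lemma elim_rowE S T r R x : all fwf T -> all fwf R -> fwf S -> (0 < S.1)%N -> fwf r ->
  size R = size T -> size T = size x ->
  all fwf (elim_row S T (r :: R)) /\
  rdot (elim_row S T (r :: R)) x = rdot R x + fval r / fval S * rdot T x.
Proof.
move=> + + wS S0 wr; rewrite /elim_row /=.
elim: R T x => [|a R IH] [|b T] [|c x] //=; first by rewrite mulr0 addr0.
move=> /andP[wb wT] /andP[wa wR] [e1] [e2]; have [w1 ->] := IH _ x wT wR e1 e2.
have [wd ed] := fdivP (fwf_gt0 wr) (fwf_gt0 wS) S0.
have [wm em] := fmulP (fwf_gt0 wd) (fwf_gt0 wb).
have [wf' ef] := faddP (fwf_gt0 wa) (fwf_gt0 wm).
by rewrite w1 wf' ef em ed; split=> //; ring.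
Qed.

Lemma size_elim_row S T r R : size R = size T -> size (elim_row S T (r :: R)) = size T.
Proof. by move=> e; rewrite size_map size_zip /= e minnn. Qed.

Definition vrows (n : nat) (rows : seq (seq nfrac)) : Prop :=
  forall R, R \in rows -> size R = n /\ all fwf R.
(* [x] is indexed by all the columns; the rows constrain its first entries. *)
Definition solves (rows : seq (seq nfrac)) (x : seq K) : Prop :=
  forall i, (i < size rows)%N -> x`_i = rdot (nth [::] rows i) x.
(** The vector is 1 on the states and on stopping, and 0 on the reward. *)
Definition stoch (n : nat) (rows : seq (seq nfrac)) : Prop :=
  forall R, R \in rows -> rdot R (rcons (nseq n.-1 1) 0) = 1.

Section ElimStep.
Variables (n : nat) (p0 : nfrac) (T : seq nfrac) (rest rows' : seq (seq nfrac)).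
Let rows := (p0 :: T) :: rest.
Hypotheses (vr : vrows n.+1 rows) (st : stoch n.+1 rows).

Let S := row_sum T.

Lemma pivot_row : size T = n /\ all fwf T /\ fwf p0.
Proof. by have [[e] /= /andP[? ?]] := vr (mem_head _ _). Qed.

Lemma pivot_sum : (0 < n)%N -> fwf S /\ fval S = 1 - fval p0.
Proof.
move=> n0; have [sT [wT wp]] := pivot_row; have [wS SE] := row_sumE wT; split=> //.
rewrite /S SE sT; have := st (mem_head _ _) => /=; case: n n0 => //= m _ E; lra.
Qed.

Hypothesis es : elim_step rows = Some rows'.

Lemma elim_stepE : (0 < S.1)%N /\ rows' = [seq elim_row S T R | R <- rest].
Proof. by move: es; rewrite /elim_step /= -/S lt0n; case: eqP => // _ [<-]. Qed.

Lemma elim_step_vrows : (0 < n)%N -> vrows n rows'.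
Proof.
move=> n0; have [S0 ->] := elim_stepE; have [sT [wT wp]] := pivot_row.
have [wS _] := pivot_sum n0.
move=> R' /mapP[R Rr ->]; have [] := vr (_ : R \in rows); first by rewrite inE Rr orbT.
case: R {Rr} => //= r R [sR] /andP[wr wR].
have e : size R = size T by rewrite sT.
rewrite size_elim_row //; split=> //.
by have [] := @elim_rowE S T r R (nseq (size T) 0) wT wR wS S0 wr e; rewrite ?size_nseq.
Qed.

(** The new row agrees with the old one up to a nonnegative multiple of the defect of [x0] in the
    pivot equation. For solutions the defect is zero; for supersolutions its sign is what
    matters. *)
Lemma elim_step_dot x0 w R : (0 < n)%N -> size w = n -> R \in rest ->
  rdot (elim_row S T R) w = rdot R (x0 :: w) + fval (head (0, 1)%N R) * (rdot T w / fval S - x0).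
Proof.
move=> n0 sw Rr; have [S0 _] := elim_stepE; have [sT [wT wp]] := pivot_row.
have [wS _] := pivot_sum n0.
have [] := vr (_ : R \in rows); first by rewrite inE Rr orbT.
case: R {Rr} => //= r R [sR] /andP[wr wR].
have [||_ ->] := @elim_rowE S T r R w wT wR wS S0 wr; rewrite ?sR ?sT //.
ring.
Qed.

Lemma pivot_eq x0 w : (0 < n)%N -> (x0 == rdot (p0 :: T) (x0 :: w)) = (x0 == rdot T w / fval S).
Proof.
move=> n0; have [wS SE] := pivot_sum n0; have [S0 _] := elim_stepE.
have Sn : fval S != 0 by rewrite fval_eq0 ?fwf_gt0 // -lt0n.
rewrite /= -subr_eq0 -[RHS]subr_eq0.
have -> : x0 - (fval p0 * x0 + rdot T w) = fval S * (x0 - rdot T w / fval S).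
  by rewrite mulrBr mulrCA divff // mulr1 SE; ring.
by rewrite mulf_eq0 (negPf Sn).
Qed.

Lemma elim_step_sound x0 w R : (0 < n)%N -> size w = n -> x0 = rdot (p0 :: T) (x0 :: w) ->
  R \in rest -> rdot (elim_row S T R) w = rdot R (x0 :: w).
Proof.
move=> n0 sw /eqP; rewrite pivot_eq // => /eqP -> Rr.
by rewrite (elim_step_dot (rdot T w / fval S)) // subrr mulr0 addr0.
Qed.

Lemma elim_step_nth x0 w i : (0 < n)%N -> size w = n -> x0 = rdot (p0 :: T) (x0 :: w) ->
  (i < size rest)%N -> rdot (nth [::] rows' i) w = rdot (nth [::] rest i) (x0 :: w).
Proof.
move=> n0 sw x0E lt; have [_ ->] := elim_stepE.
by rewrite (nth_map [::]) // (elim_step_sound n0 sw x0E) // mem_nth.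
Qed.

Lemma elim_step_solves x0 w : (0 < n)%N -> size w = n ->
  solves rows (x0 :: w) <-> x0 = rdot T w / fval S /\ solves rows' w.
Proof.
move=> n0 sw; have [_ rE] := elim_stepE.
have key i x0E := @elim_step_nth x0 w i n0 sw x0E.
split=> [H|[/eqP x0E H]].
  have x0E := H 0 isT; split; first by apply/eqP; rewrite -pivot_eq //; apply/eqP.
  by move=> i; rewrite {1}rE size_map => lt; rewrite key //; exact: (H i.+1).
move: x0E; rewrite -pivot_eq // => /eqP x0E [|i] lt //=.
by rewrite -[x0 :: w]/(x0 :: w) -key // H // rE size_map.
Qed.

(** The vector that expresses stochasticity satisfies the pivot equation, so elimination preserves
    its product with the other rows. *)
Lemma elim_step_stoch : (1 < n)%N -> stoch n rows'.
Proof.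
move=> n1; have n0 := ltnW n1; have [_ ->] := elim_stepE => _ /mapP[R Rr ->].
have E : rcons (nseq n.+1.-1 1) 0 = 1 :: rcons (nseq n.-1 1) 0 :> seq K by case: (n) n0.
rewrite (@elim_step_sound 1) // ?size_rcons ?size_nseq ?prednK // -E st ?inE ?Rr ?orbT //.
  exact: mem_head.
Qed.

End ElimStep.

End Rows.

Lemma foldl_const_size (A B : Type) (g : B -> B) (l l' : seq A) b : size l = size l' ->
  foldl (fun st _ => g st) b l = foldl (fun st _ => g st) b l'.
Proof. by elim: l l' b => [|a l IH] [|a' l'] b //= [] /IH. Qed.

Lemma elim_step_size rows rows' : elim_step rows = Some rows' -> size rows' = (size rows).-1.
Proof. by case: rows => //= p rest; case: ifP => // _ [<-]; rewrite size_map. Qed.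

Lemma solve_step p r rest : solve (p :: r :: rest) =
  if elim_step (p :: r :: rest) is Some rows' then solve rows' else None.
Proof.
rewrite /solve /elim_all; set f := (X in foldl X).
have f0 l : foldl f None l = None by elim: l.
rewrite -[foldl f _ (behead _)]/(foldl f (elim_step (p :: r :: rest)) rest).
case E : (elim_step _) => [rows'|]; last by rewrite f0.
have -> : foldl f (Some rows') rest = foldl f (Some rows') (behead rows') => //.
by apply: (foldl_const_size (fun st => if st is Some r0 then elim_step r0 else None));
  rewrite size_behead (elim_step_size E).
Qed.

Lemma elim_step_last p rows' : elim_step [:: p] = Some rows' -> rows' = [::].
Proof. by rewrite /=; case: ifP => // _ []. Qed.

Section Super.
Variable K : realFieldType.
Local Notation fval := (@fval K).
Local Notation stoch := (@stoch K).

(** A strict supersolution is a certificate that elimination meets no zero pivot. Strictness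
    concerns the states; the last two entries are only nonnegative. *)
Definition super (rows : seq (seq nfrac)) (x : seq K) : Prop :=
  all (>= 0) x /\ forall i, (i < size rows)%N -> 0 < x`_i /\ rdot (nth [::] rows i) x < x`_i.

(** As [rdot T w] is nonnegative, [p0 * x0 < x0], so that the pivot [1 - p0] is positive. The defect
    of [x0] is then nonpositive, and products with the other rows can only decrease. *)
Lemma elim_step_super n p0 T rest x0 w : vrows n.+1 ((p0 :: T) :: rest) ->
  stoch n.+1 ((p0 :: T) :: rest) -> (0 < n)%N -> size w = n ->
  super ((p0 :: T) :: rest) (x0 :: w) ->
  exists2 rows', elim_step ((p0 :: T) :: rest) = Some rows' & super rows' w.
Proof.
move=> vr st n0 sw [/= /andP[x00 w0] H].
have [h1 h2] := H 0%N isT; rewrite /= in h1 h2.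
have [wS SE] := pivot_sum vr st n0.
have p1 : fval p0 < 1.
  have t0 := rdot_ge0 T w0.
  by rewrite -subr_gt0 -(pmulr_lgt0 _ h1) mulrBl mul1r; lra.
have S0 : (0 < (row_sum T).1)%N.
  by rewrite lt0n -(@fval_eq0 K) ?fwf_gt0 // SE subr_eq0 gt_eqF.
have es : elim_step ((p0 :: T) :: rest) = Some [seq elim_row (row_sum T) T R | R <- rest].
  by rewrite /= -if_neg -lt0n S0.
exists [seq elim_row (row_sum T) T R | R <- rest] => //; split=> // i; rewrite size_map => lt.
have [g1 g2] := H i.+1 lt; split=> //; apply: le_lt_trans g2.
rewrite (nth_map [::]) // (elim_step_dot vr st es x0) //; last by rewrite mem_nth.
rewrite gerDl mulr_ge0_le0 ?fval_ge0 // subr_le0 ler_pdivrMr; last by rewrite SE; lra.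
by rewrite SE; lra.
Qed.

(** With a single row left, the pivot tested by [elim_step] is the stopping probability that
    [last_row] tests. *)
Lemma row_sum_last u b : fwf u ->
  fval (row_sum [:: u; b]) = fval u /\ ((row_sum [:: u; b]).1 == 0%N) = (u.1 == 0%N).
Proof.
move=> wu; rewrite /row_sum /rev /=; have := @fsumP K [:: u]; rewrite /= wu big_seq1 => /(_ isT) [w e].
by split=> //; rewrite -(@fval_eq0 K _ (fwf_gt0 w)) e (@fval_eq0 K _ (fwf_gt0 wu)).
Qed.

Lemma solve_super rows x : rows != [::] -> vrows (size rows).+2 rows ->
  stoch (size rows).+2 rows -> size x = (size rows).+2 -> super rows x -> solve rows != None.
Proof.
have [m] := ubnP (size rows); elim: m rows x => // m IH [//|p rest] x lt _ vr st sx sup.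
case: x sx sup => // x0 w [sw] sup.
case: p vr st lt sup => [|p0 T] vr st lt sup; first by have [] := vr [::] (mem_head _ _).
have [rows' es sup'] := elim_step_super vr st (ltn0Sn _) sw sup.
case: rest vr st lt sup sw es => [|r rest] vr st lt sup sw es; last first.
  have sr := elim_step_size es; rewrite solve_step es; apply: (IH _ w) => //.
  - by rewrite sr.
  - by rewrite -size_eq0 sr.
  - by rewrite sr; exact: (elim_step_vrows vr st es).
  - by rewrite sr; exact: (elim_step_stoch vr st es).
  - by rewrite sr.
have [S0 _] := elim_stepE es.
have [sT [wT wp]] := pivot_row vr; case: T sT wT S0 {vr st es sup lt} => [|u [|b []]] //= _.
move=> /andP[wu _]; rewrite lt0n (row_sum_last b wu).2 => /negPf u0.
by rewrite /solve /elim_all /= /last_row /= u0.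
Qed.

(** Uniqueness will identify the hitting probabilities with 1, a nonnegative solution will show that
    the expected times are finite, and the last clause gives the value at the initial state, whose
    row is last. *)
Definition solved_by (rows : seq (seq nfrac)) (q : nfrac) : Prop :=
  [/\ fwf q,
   forall x y : seq K, size x = (size rows).+2 -> size y = (size rows).+2 ->
     solves rows x -> solves rows y -> drop (size rows) x = drop (size rows) y -> x = y,
   forall e : seq K, size e = 2 -> all (>= 0) e -> exists x,
     [/\ size x = (size rows).+2, drop (size rows) x = e, solves rows x & all (>= 0) x]
   & forall x : seq K, size x = (size rows).+2 -> solves rows x ->
     drop (size rows) x = [:: 0; 1] -> x`_(size rows).-1 = fval q].

Lemma solve_sound rows q : rows != [::] -> vrows (size rows).+2 rows ->
  stoch (size rows).+2 rows -> solve rows = Some q -> solved_by rows q.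
Proof.
have [m] := ubnP (size rows); elim: m rows q => // m IH [//|p rest] q lt _ vr st sq.
case: p vr st lt sq => [|p0 T] vr st lt sq; first by have [] := vr [::] (mem_head _ _).
have [sT [wT wp]] := pivot_row vr.
case es : (elim_step ((p0 :: T) :: rest)) => [rows'|]; last first.
  case: rest vr st lt sq es sT => [|r rest] vr st lt; last by rewrite solve_step => + es; rewrite es.
  case: T wT {vr st lt} => [|u [|b []]] //= /andP[wu _] + es _; move: es.
  rewrite (row_sum_last b wu).2 /solve /elim_all /= /last_row /=; by case: ifP.
have sr := elim_step_size es; rewrite /= in sr.
have [S0 _] := elim_stepE es; have [wS SE] := pivot_sum vr st isT.
have sol (x0 : K) w (sw : size w = (size rest).+2) := elim_step_solves vr st es x0 isT sw.
have rec : rest != [::] -> solved_by rows' q.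
  have vr' := elim_step_vrows vr st es isT; have st' := elim_step_stoch vr st es.
  case: rest lt sq es vr' st' sr {sT vr st sol} => // r rest lt sq es vr' st' sr _.
  rewrite solve_step es in sq; have {}st' := st' isT.
  by apply: IH; rewrite ?sr // -size_eq0 sr.
have base : rest = [::] -> exists u b, [/\ T = [:: u; b], fwf u, fwf b, (0 < u.1)%N & q = fdiv b u].
  move=> E; rewrite E in sT sq; case: T sT wT sq {vr st lt es S0 wS SE sol} => [|u [|b []]] //= _.
  move=> /and3P[wu wb _]; rewrite /solve /elim_all /= /last_row /=.
  by case: eqP => // /eqP u0 [<-]; exists u, b; split=> //; rewrite lt0n.
have [uq ex] : (forall x y : seq K, size x = (size rest).+2 -> size y = (size rest).+2 ->
       solves rows' x -> solves rows' y ->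
       drop (size rest) x = drop (size rest) y -> x = y) /\
    forall e : seq K, size e = 2 -> all (>= 0) e -> exists x,
       [/\ size x = (size rest).+2, drop (size rest) x = e, solves rows' x & all (>= 0) x].
  have [E|/rec[_ u e _]] := eqVneq rest [::]; last by split; [move: u|move: e]; rewrite sr.
  rewrite E in es *; rewrite (elim_step_last es); split=> [x y _ _ _ _|e se e0]; first by rewrite !drop0.
  by exists e; rewrite drop0.
split.
- have [/base[u [b [_ wu wb u0 ->]]]|/rec[]//] := eqVneq rest [::].
  by have [] := @fdivP K b u (fwf_gt0 wb) (fwf_gt0 wu) u0.
- move=> [//|x0 x] [//|y0 y] [sx] [sy] /sol-/(_ sx)[-> hx] /sol-/(_ sy)[-> hy] /= dxy.
  by rewrite (uq x y).
- move=> e se e0; have [w [sw dw hw w0]] := ex e se e0.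
  exists (rdot T w / fval (row_sum T) :: w); split=> //=; first by rewrite sw.
    by apply/sol => //.
  by rewrite w0 divr_ge0 ?fval_ge0 ?rdot_ge0.
- move=> [//|x0 x] [sx] /sol-/(_ sx)[x0E hx] /= dx.
  have [E|rn] := eqVneq rest [::].
    have [u [b [TE wu wb u0 ->]]] := base E; rewrite E /= drop0 in dx *.
    have [_ ->] := @fdivP K b u (fwf_gt0 wb) (fwf_gt0 wu) u0.
    by rewrite x0E TE dx (row_sum_last b wu).1 /= mulr0 mulr1 !add0r addr0.
  have [_ _ _ /(_ x)] := rec rn; rewrite sr => /(_ sx hx dx) <-.
  by case: (rest) rn.
Qed.

End Super.

(** * Size of the entries met during elimination *)

Section ElimIter.
Local Notation fval := (@fval rat).
Local Notation stoch := (@stoch rat).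

Fixpoint elim_iter (k : nat) (rows : seq (seq nfrac)) : option (seq (seq nfrac)) :=
  if k is j.+1 then if elim_step rows is Some r then elim_iter j r else None else Some rows.

Lemma foldl_elim (A : Type) (l : seq A) rows :
  foldl (fun st (_ : A) => if st is Some r then elim_step r else None) (Some rows) l =
  elim_iter (size l) rows.
Proof.
elim: l rows => //= a l IH rows; case: (elim_step rows) => [r|] //.
by elim: l {IH}.
Qed.

Lemma elim_iterS k n rows rk : elim_iter k.+1 rows = Some rk -> vrows n rows -> stoch n rows ->
  (2 < n)%N -> exists p0 T rest r1, [/\ rows = (p0 :: T) :: rest, elim_step rows = Some r1,
    elim_iter k r1 = Some rk, vrows n.-1 r1 /\ stoch n.-1 r1 & size r1 = size rest].
Proof.
case: rows => [|p rest] //.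
rewrite -[elim_iter _ _]/(if elim_step (p :: rest) is Some r then elim_iter k r else None).
case es: (elim_step _) => [r1|] // ek vr st; case: n vr st => // n vr st n1.
case: p vr st es => [|p0 T] vr st es; first by have [] := vr [::] (mem_head _ _).
exists p0, T, rest, r1; split=> //; last by rewrite (elim_step_size es).
by split; [exact: (elim_step_vrows vr st es (ltnW n1))|exact: (elim_step_stoch vr st es n1)].
Qed.

Lemma elim_iter_inv k n rows rk : elim_iter k rows = Some rk -> vrows n rows -> stoch n rows ->
  (k < size rows)%N -> (size rows < n)%N -> vrows (n - k) rk /\ size rk = (size rows - k)%N.
Proof.
elim: k n rows => [|k IH] n rows; first by case=> <- vr st _ _; rewrite !subn0.
move=> ek vr st lt sn.
have [|p0 [T [rest [r1 [E es ek' [vr' st'] sr]]]]] := elim_iterS ek vr st; first by lia.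
case: n vr st sn vr' st' => // n vr st sn vr' st'; rewrite E /= in sn lt *.
by have [||h1 h2] := IH n r1 ek' vr' st'; rewrite ?sr //; rewrite h2 sr !subSS.
Qed.

(** On vectors that satisfy the first [k] equations the remaining rows act like the original ones;
    well-chosen vectors then isolate single entries. *)
Lemma elim_iter_sound k n rows rk (x : seq rat) :
  elim_iter k rows = Some rk -> vrows n rows -> stoch n rows ->
  (size rows < n)%N -> size x = n ->
  (forall i, (i < k)%N -> x`_i = rdot (nth [::] rows i) x) ->
  forall i, (k + i < size rows)%N -> rdot (nth [::] rk i) (drop k x) = rdot (nth [::] rows (k + i)) x.
Proof.
elim: k n rows x => [|k IH] n rows x; first by case=> <- *; rewrite drop0.
move=> ek vr st sn sx H i lt.
have [|p0 [T [rest [r1 [E es ek' [vr' st'] sr]]]]] := elim_iterS ek vr st; first by lia.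
rewrite {}E in vr st es sn H lt *.
case: n x sx vr st sn vr' st' H => // n [//|x0 w] [sw] vr st sn vr' st' H; rewrite /= in sn lt.
have n0 : (0 < n)%N by lia.
have x0E := H 0%N isT; rewrite [nth _ _ _]/= in x0E.
have r1E j := elim_step_nth (i := j) vr st es n0 sw x0E.
have := IH n r1 w ek' vr' st' _ sw _ i; rewrite sr => -> //; first by rewrite r1E.
by move=> j jk; rewrite r1E; [exact: (H j.+1)|lia].
Qed.

(** Back substitution: each pivot equation makes its unknown vanish once the later ones do. This is
    the injectivity behind [elim_det_neq0]. *)
Lemma elim_iter_kernel k n rows rk (x : seq rat) :
  elim_iter k rows = Some rk -> vrows n rows -> stoch n rows ->
  (k <= size rows)%N -> ((size rows).+1 < n)%N -> size x = n ->
  (forall i, (i < k)%N -> x`_i = rdot (nth [::] rows i) x) ->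
  (forall i, (k <= i)%N -> x`_i = 0) -> forall i, x`_i = 0.
Proof.
elim: k n rows x => [|k IH] n rows x; first by move=> _ _ _ _ _ _ _ H i; exact: H.
move=> ek vr st kn sn sx H z.
have [|p0 [T [rest [r1 [E es ek' [vr' st'] sr]]]]] := elim_iterS ek vr st; first by lia.
rewrite {}E in vr st es kn sn H *.
case: n x sx vr st sn vr' st' H z => // n [//|x0 w] [sw] vr st sn vr' st' H z; rewrite /= in sn kn.
have n0 : (0 < n)%N by lia.
have x0E := H 0%N isT; rewrite [nth _ _ _]/= in x0E.
have r1E j := elim_step_nth (i := j) vr st es n0 sw x0E.
have w0 j : w`_j = 0.
  apply: (IH n r1 w ek' vr' st'); rewrite ?sr //.
    by move=> i ik; rewrite r1E; [exact: (H i.+1)|lia].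
  by move=> i ik; exact: (z i.+1).
have x00 : x0 = 0.
  have /eqP := x0E; rewrite [nth _ _ _]/= (pivot_eq vr st es) // => /eqP ->.
  have [sT _] := pivot_row vr.
  by rewrite rdot_nth ?sT // big1 ?mul0r // => i _; rewrite w0 mulr0.
by case=> //= i; rewrite w0.
Qed.

Section BoundedIntegers.
Implicit Types (x y : rat) (b c : nat).

Definition bint (b : nat) (x : rat) : Prop := x \is a Num.int /\ `|x| <= b%:R.

Lemma bint_le b c x : (b <= c)%N -> bint b x -> bint c x.
Proof. by move=> bc [ix bx]; split=> //; apply: le_trans bx _; rewrite ler_nat. Qed.

Lemma bint_add b c x y : bint b x -> bint c y -> bint (b + c) (x + y).
Proof.
move=> [ix bx] [iy cy]; split; first exact: rpredD.
by rewrite natrD (le_trans (ler_normD _ _)) // lerD.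
Qed.

Lemma bint_mul b c x y : bint b x -> bint c y -> bint (b * c) (x * y).
Proof.
move=> [ix bx] [iy cy]; split; first exact: rpredM.
by rewrite natrM normrM ler_pM.
Qed.

Lemma bint_nat n : bint n n%:R.
Proof. by split; [exact: natr_int|rewrite ger0_norm ?ler0n]. Qed.

Lemma bint_sum (I : finType) b (F : I -> rat) : (forall i, bint b (F i)) ->
  bint (#|I| * b) (\sum_i F i).
Proof.
move=> H; rewrite cardE -big_enum; elim: (enum I) => [|i s IH].
  by rewrite big_nil; exact: bint_nat 0%N.
by rewrite big_cons /= mulSn; apply: bint_add.
Qed.

Lemma bint_prod (n b : nat) (F : 'I_n -> rat) : (forall i, bint b (F i)) ->
  bint (b ^ n) (\prod_i F i).
Proof.
elim: n F => [|n IH] F H; first by rewrite big_ord0; exact: bint_nat 1%N.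
by rewrite big_ord_recl expnS; apply: bint_mul => //; apply: IH.
Qed.

Lemma bint_sign n : bint 1 ((-1) ^+ n).
Proof. by split; [rewrite rpredX // rpredN|rewrite normrX normrN1 expr1n]. Qed.

Lemma bint_det (n b : nat) (A : 'M[rat]_n) : (forall i j, bint b (A i j)) ->
  bint (n`! * b ^ n) (\det A).
Proof.
move=> H; rewrite -perm.card_Sn; apply: bint_sum => s.
by rewrite -[(b ^ n)%N]mul1n; apply: bint_mul; [exact: bint_sign|exact: bint_prod].
Qed.

Lemma bint_adj (n b : nat) (A : 'M[rat]_n) : (0 < b)%N -> (forall i j, bint b (A i j)) ->
  forall i j, bint (n`! * b ^ n) ((\adj A) i j).
Proof.
move=> b0 H i j; rewrite mxE /cofactor -[(_ * _)%N]mul1n; apply: bint_mul; first exact: bint_sign.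
apply: (@bint_le (n.-1`! * b ^ n.-1)).
  by apply: leq_mul; [case: n {A H i j} => // n; rewrite factS leq_pmull|rewrite leq_pexp2l // leq_pred].
by apply: bint_det => k l; rewrite !mxE.
Qed.

Lemma fwf_bound f (d z : rat) b c : fwf f -> bint b d -> bint c z -> d != 0 -> fval f * d = z ->
  (f.1 <= c)%N /\ (f.2 <= b)%N.
Proof.
move=> /andP[f0 cf] [/intrP[d' ->] db] [/intrP[z' ->] zc]; rewrite intr_eq0 => d0.
rewrite /fval mulrAC => /(canRL (mulfVK (natr_neq0 rat f0))) e.
have {e} : (f.1%:Z * d' = z' * f.2%:Z)%R.
  by apply/eqP; rewrite -(eqr_int rat) !intrM -e.
move=> /(congr1 absz); rewrite !abszM !absz_nat => e.
have dz : (`|d'| <= b)%N by move: db; rewrite -intr_norm -[b%:R]/(b%:Z%:~R) ler_int; lia.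
have zz : (`|z'| <= c)%N by move: zc; rewrite -intr_norm -[c%:R]/(c%:Z%:~R) ler_int; lia.
have d1 : (0 < `|d'|)%N by rewrite absz_gt0.
split; last first.
  apply: leq_trans dz; apply: dvdn_leq => //.
  by rewrite -(@Gauss_dvdr _ f.1) 1?coprime_sym // e dvdn_mull.
have [f10|f10] := posnP f.1; first by rewrite f10.
apply: leq_trans zz; apply: dvdn_leq.
  by rewrite lt0n; apply/eqP => z0; move: e; rewrite z0 mul0n; move: f10 d1; nia.
by rewrite -(@Gauss_dvdl _ _ f.2) // -e dvdn_mulr.
Qed.

End BoundedIntegers.

End ElimIter.

Section EntrySize.
Local Notation fval := (@fval rat).
Local Notation stoch := (@stoch rat).

Section EntryBound.
Variables (n k : nat) (rows rk : seq (seq nfrac)).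
Hypotheses (ek : elim_iter k rows = Some rk) (vr : vrows n rows) (st : stoch n rows).
Hypotheses (kN : (k < size rows)%N) (nN : ((size rows).+1 < n)%N).
Variables (D b : nat).

Let p i j := fval (nth (0, 1)%N (nth [::] rows i) j).
Hypotheses (D0 : (0 < D)%N)
  (Dp : forall i j, (i < size rows)%N -> (j < n)%N -> bint b (D%:R * p i j)).

Let A : 'M[rat]_k := \matrix_(i, j) (D%:R * ((i == j)%:R - p i j)).

Let row_dot i (x : seq rat) : (i < size rows)%N -> size x = n ->
  rdot (nth [::] rows i) x = \sum_(j < n) p i j * x`_j.
Proof.
move=> lt sx; have [sr _] := vr (mem_nth [::] lt).
by rewrite rdot_nth sr ?sx.
Qed.

(** The values [y] on the eliminated columns, completed by the unit vector of column [j]; for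
    [j = n] the completion is zero. *)
Let ext (y : 'I_k -> rat) (j : nat) : seq rat :=
  mkseq (fun i => if insub i is Some o then y o else (i == j)%:R) n.

Let size_ext y j : size (ext y j) = n. Proof. exact: size_mkseq. Qed.

Let nth_ext_lt y j (o : 'I_k) : (ext y j)`_o = y o.
Proof.
rewrite nth_mkseq; last by have := ltn_ord o; lia.
by rewrite insubT //= => h; congr y; apply: val_inj.
Qed.

Let nth_ext_ge y j i : (k <= i)%N -> (i < n)%N -> (ext y j)`_i = (i == j)%:R.
Proof. by move=> ki lt; rewrite nth_mkseq // insubF // ltnNge ki. Qed.

Let row_ext i y j : (i < size rows)%N -> (k <= j)%N -> (j < n)%N ->
  rdot (nth [::] rows i) (ext y j) = \sum_(o < k) p i o * y o + p i j.
Proof.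
move=> lt kj jn; rewrite row_dot //.
rewrite -(big_mkord xpredT (fun j0 => p i j0 * (ext y j)`_j0)) (@big_cat_nat _ _ _ k) //=; last by lia.
congr (_ + _); first by rewrite big_mkord; apply: eq_bigr => o _; rewrite nth_ext_lt.
rewrite (@big_cat_nat _ _ _ j) ?(ltnW jn) //= (big_ltn jn) nth_ext_ge // eqxx mulr1.
rewrite [X in X + _]big_nat big1 ?add0r => [|l /andP[l1 l2]]; last first.
  by rewrite nth_ext_ge ?(ltn_eqF l2) ?mulr0 //; lia.
rewrite big_nat big1 ?addr0 // => l /andP[l1 l2].
by rewrite nth_ext_ge ?(gtn_eqF l1) ?mulr0 //; lia.
Qed.

Lemma elim_det_neq0 : \det A != 0.
Proof.
rewrite -det_tr; apply/det0P => -[v v0 /matrixP vA].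
have Dn : D%:R != 0 :> rat by exact: natr_neq0.
pose x := ext (v 0) n; have xlt (o : 'I_k) : x`_o = v 0 o := nth_ext_lt _ _ o.
have xge i : (k <= i)%N -> x`_i = 0.
  move=> ki; have [lt|ge] := ltnP i n; last by rewrite nth_default // size_ext.
  by rewrite nth_ext_ge // (ltn_eqF lt).
have sx : size x = n := size_ext _ _.
have xs i : (i < k)%N -> x`_i = rdot (nth [::] rows i) x.
  move=> ik; rewrite row_dot //; last by lia.
  rewrite -(big_mkord xpredT (fun j => p i j * x`_j)) (@big_cat_nat _ _ _ k) //=; last by lia.
  rewrite [X in _ + X]big_nat [X in _ + X]big1 ?addr0 => [|l /andP[l1 _]]; last by rewrite xge ?mulr0.
  rewrite big_mkord; have := vA 0 (Ordinal ik); rewrite !mxE.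
  under eq_bigr => j _ do rewrite !mxE mulrCA mulrBr.
  rewrite -mulr_sumr => /eqP; rewrite mulf_eq0 (negPf Dn) /= sumrB subr_eq0.
  rewrite (bigD1 (Ordinal ik)) //= eqxx mulr1 big1 ?addr0 => [|j ne]; last first.
    by rewrite eq_sym (negPf ne) mulr0.
  rewrite -[v 0 _](xlt (Ordinal ik)) => /eqP ->; apply: eq_bigr => j _.
  by rewrite xlt mulrC.
have z := elim_iter_kernel ek vr st (ltnW kN) nN sx xs xge.
by case/eqP: v0; apply/rowP => o; rewrite mxE -xlt z.
Qed.

Let beta := (D + b)%N.

Let Aint i j : bint beta (A i j).
Proof.
rewrite mxE mulrBr; apply: bint_add.
  rewrite -[D]muln1; apply: bint_mul; rewrite ?muln1; first exact: bint_nat.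
  by apply: (@bint_le (i == j)); [case: eqP|exact: bint_nat].
have [ix bx] := Dp (ltn_trans (ltn_ord i) kN) (ltn_trans (ltn_trans (ltn_ord j) kN) (ltnW nN)).
by split; rewrite ?rpredN ?normrN.
Qed.

(* Cramer's rule: eliminating the first [k] unknowns is solving the first [k]
   equations for them. *)
Lemma elim_entry i j : (k + i < size rows)%N -> (k + j < n)%N ->
  let f := nth (0, 1)%N (nth [::] rk i) j in fwf f ->
  (f.1 <= (k * k + 1) * (k`! * beta ^ k.+2))%N /\ (f.2 <= D * (k`! * beta ^ k))%N.
Proof.
move=> iN jn f wf.
have Dn : D%:R != 0 :> rat by exact: natr_neq0.
have b0 : (0 < beta)%N by rewrite /beta; lia.
(* Set column [k + j] to 1 and the other remaining columns to 0. Cramer's rule gives the solution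
   [y] of the first [k] equations, and the entry sought is the product of the original row [k + i]
   with the resulting vector. *)
pose c : 'cV[rat]_k := \col_l (D%:R * p l (k + j)).
pose u : 'cV[rat]_k := \adj A *m c.
have Au : A *m u = \det A *: c by rewrite mulmxA mul_mx_adj mul_scalar_mx.
have d0 := elim_det_neq0.
pose y o := u o 0 / \det A.
have ys (o : 'I_k) : y o = \sum_(l < k) p o l * y l + p o (k + j).
  have /matrixP/(_ o 0) := Au; rewrite !mxE.
  under eq_bigr => l _ do rewrite mxE -mulrA mulrBl mulrBr.
  rewrite sumrB (bigD1 o) //= eqxx mul1r big1 ?addr0 => [|l ne]; last first.
    by rewrite eq_sym (negPf ne) mul0r mulr0.
  rewrite -mulr_sumr [in RHS]mulrCA -mulrBr => /(mulfI Dn) e.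
  rewrite /y; apply: (mulIf d0); rewrite mulfVK // mulrDl mulr_suml.
  under [X in _ = X + _]eq_bigr => l _ do rewrite -mulrA mulfVK //.
  by rewrite [p o _ * _]mulrC -e; ring.
have kj : (k <= k + j)%N by lia.
have xs l : (l < k)%N -> (ext y (k + j))`_l = rdot (nth [::] rows l) (ext y (k + j)).
  move=> lk; rewrite row_ext //; last by lia.
  by rewrite -[l]/(nat_of_ord (Ordinal lk)) nth_ext_lt; exact: ys.
have nN' : (size rows < n)%N by lia.
have [vk sk] := elim_iter_inv ek vr st kN nN'.
have ilt : (i < size rk)%N by lia.
have [sri wri] := vk _ (mem_nth [::] ilt).
have fE : fval f = \sum_(o < k) p (k + i)%N o * y o + p (k + i)%N (k + j)%N.
  rewrite -row_ext //; have /(_ _ (size_ext y (k + j)) xs i iN) <- := elim_iter_sound ek vr st nN'.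
  rewrite rdot_nth ?sri ?size_drop ?size_ext //.
  have jlt : (j < n - k)%N by lia.
  rewrite (bigD1 (Ordinal jlt)) //= nth_drop nth_ext_ge // eqxx mulr1 big1 ?addr0 // => l ne.
  rewrite nth_drop nth_ext_ge ?eqn_add2l; [|lia|by have := ltn_ord l; lia].
  by move: ne; rewrite -val_eqE /= => /negPf ->; rewrite mulr0.
have Dd0 : D%:R * \det A != 0 by rewrite mulf_neq0.
(* All denominators are cleared: one [D] serves row [k + i], and the determinant serves [y]. *)
have E : fval f * (D%:R * \det A) =
    \sum_(o < k) (D%:R * p (k + i)%N o) * u o 0 + (D%:R * p (k + i)%N (k + j)%N) * \det A.
  rewrite fE mulrDl mulr_suml; congr (_ + _); last by ring.
  apply: eq_bigr => o _; rewrite /y; field.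
  exact: d0.
have ui o : bint (k * (k`! * beta ^ k.+1)) (u o 0).
  have -> : (k * (k`! * beta ^ k.+1) = #|'I_k| * (k`! * beta ^ k * beta))%N.
    by rewrite card_ord expnSr; ring.
  rewrite mxE; apply: bint_sum => l; apply: bint_mul; first exact: bint_adj.
  rewrite mxE; apply: (@bint_le b); first by rewrite /beta; lia.
  by apply: Dp; have := ltn_ord l; lia.
have Zi : bint ((k * k + 1) * (k`! * beta ^ k.+2)) (fval f * (D%:R * \det A)).
  rewrite E mulnDl mul1n; apply: bint_add.
    have -> : (k * k * (k`! * beta ^ k.+2) = #|'I_k| * (beta * (k * (k`! * beta ^ k.+1))))%N.
      by rewrite card_ord (expnS _ k.+1); ring.
    apply: bint_sum => o.
    apply: bint_mul => //; apply: (@bint_le b); first by rewrite /beta; lia.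
    by apply: Dp => //; have := ltn_ord o; lia.
  apply: (@bint_le (b * (k`! * beta ^ k))); last by apply: bint_mul; [apply: Dp|exact: bint_det].
  rewrite mulnCA leq_mul2l !expnS mulnA leq_mul2r.
  by apply/orP; right; apply/orP; right; rewrite /beta; nia.
apply: (fwf_bound wf _ Zi Dd0 erefl).
by apply: bint_mul; [exact: bint_nat|exact: bint_det].
Qed.

End EntryBound.

Definition common_den (rows : seq (seq nfrac)) : nat := \prod_(R <- rows) \prod_(f <- R) f.2.

Lemma row_den_lt (R : seq nfrac) : (\prod_(f <- R) f.2 < 2 ^ sz R)%N.
Proof.
elim: R => [|f R IH]; first by rewrite big_nil.
rewrite big_cons sz_cons expnS expnD.
have := ltn_mul (frac_lt f).2 IH; move: (2 ^ sz f * _)%N => x; lia.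
Qed.

Lemma common_den_lt rows : (common_den rows < 2 ^ sz rows)%N.
Proof.
rewrite /common_den; elim: rows => [|R rows IH]; first by rewrite big_nil.
rewrite big_cons sz_cons expnS expnD.
have := ltn_mul (row_den_lt R) IH; move: (2 ^ sz R * _)%N => x; lia.
Qed.

Lemma common_den_gt0 n rows : vrows n rows -> (0 < common_den rows)%N.
Proof.
rewrite /common_den => vr; rewrite big_seq; apply: prodn_cond_gt0 => R /vr[_ /allP wR].
by rewrite big_seq; apply: prodn_cond_gt0 => f /wR /fwf_gt0.
Qed.

Lemma dvdn_big_mem (I : eqType) (F : I -> nat) i s : i \in s -> (F i %| \prod_(j <- s) F j)%N.
Proof. by move=> h; rewrite (big_rem i h) dvdn_mulr. Qed.

Lemma sz_nth (T : encType) (s : seq T) x0 j : (j < size s)%N -> (sz (nth x0 s j) <= sz s)%N.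
Proof.
elim: s j => // a s IH [|j] /= lt; rewrite sz_cons; first lia.
by have := IH j lt; lia.
Qed.

Lemma common_den_bint n rows i j : vrows n rows -> (i < size rows)%N -> (j < n)%N ->
  bint (2 ^ sz rows * 2 ^ sz rows) ((common_den rows)%:R * fval (nth (0, 1)%N (nth [::] rows i) j)).
Proof.
move=> vr lt jn; have [sr wr] := vr _ (mem_nth [::] lt).
have jlt : (j < size (nth [::] rows i))%N by rewrite sr.
set f := nth _ _ j; have fw : fwf f by exact: (allP wr _ (mem_nth _ jlt)).
have dv : (f.2 %| common_den rows)%N.
  apply: dvdn_trans (dvdn_big_mem _ (mem_nth [::] lt)).
  exact: dvdn_big_mem (fun g : nfrac => g.2) _ _ (mem_nth _ jlt).
have -> : (common_den rows)%:R * fval f = (common_den rows %/ f.2 * f.1)%:R :> rat.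
  rewrite -[in LHS](divnK dv) !natrM /fval; field.
  by rewrite natr_neq0 // fwf_gt0.
apply: bint_le (bint_nat _); apply: leq_mul.
  by apply: leq_trans (leq_div _ _) _; exact: ltnW (common_den_lt _).
apply: leq_trans (ltnW (frac_lt f).1) _; rewrite leq_exp2l //.
exact: leq_trans (sz_nth _ jlt) (sz_nth _ lt).
Qed.

End EntrySize.

Local Open Scope nat_scope.

Section ElimSize.
Local Notation fval := (@fval rat).
Local Notation stoch := (@stoch rat).

Lemma fact_le_exp n : n`! <= 2 ^ (n * n).
Proof.
elim: n => // n IH; rewrite factS.
apply: leq_trans (leq_mul (ltnW (ltn_expl n.+1 (isT : 1 < 2))) IH) _.
by rewrite -expnD leq_exp2l //; lia.
Qed.

Lemma sz_seq_le (A : encType) (s : seq A) B :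
  (forall i x0, i < size s -> sz (nth x0 s i) <= B) -> sz s <= 1 + size s * B.+1.
Proof.
elim: s => // a s IH H; rewrite sz_cons /= mulSn.
have h0 := H 0 a isT; have := IH (fun i x0 => H i.+1 x0); rewrite /= in h0; lia.
Qed.

(** The three terms bound the factors of [elim_entry]: [k * k + 1] by [2 ^ (2 * m)], the factorial
    by [2 ^ (m * m)], and at most [m + 2] factors that are each at most [2 ^ (2 * m + 1)]. *)
Definition entry_exp (m : nat) : nat := 2 * m + m * m + (2 * m + 1) * (m + 2).
Definition elim_size (m : nat) : nat :=
  1 + m * (1 + m * (8 * entry_exp m + 12)).+1 + 2.

Lemma elim_iter_sz k rows rk : elim_iter k rows = Some rk ->
  vrows (size rows).+2 rows -> stoch (size rows).+2 rows -> k < size rows ->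
  sz (Some rk) <= elim_size (sz rows).
Proof.
move=> ek vr st kN; set m := sz rows; set n := (size rows).+2 in vr st.
have nN : (size rows).+1 < n by [].
have mN : size rows < m := size_le_sz rows.
have [vk sk] := elim_iter_inv ek vr st kN (ltnW nN).
have nm : n <= m.
  have lt0 : 0 < size rows by lia.
  have [<- _] := vr _ (mem_nth [::] lt0).
  exact: leq_trans (ltnW (size_le_sz _)) (sz_nth _ lt0).
set D := common_den rows; set b := 2 ^ m * 2 ^ m.
have D0 : 0 < D := common_den_gt0 vr.
have Dm : D <= 2 ^ m := ltnW (common_den_lt rows).
have entry := elim_entry ek vr st kN nN D0 (fun i j li lj => common_den_bint vr li lj).
have beta : D + b <= 2 ^ (2 * m + 1).
  have -> : 2 ^ (2 * m + 1) = b + b by rewrite expnD mul2n -addnn expnD muln2 addnn.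
  by rewrite leq_add2r (leq_trans Dm) // leq_pmulr // expn_gt0.
have km : k <= m by lia.
have kk : k * k + 1 <= 2 ^ (2 * m).
  have : k < 2 ^ m by apply: leq_trans (ltn_expl k (isT : 1 < 2)) _; rewrite leq_exp2l.
  by rewrite mul2n -addnn expnD; nia.
have kf : k`! <= 2 ^ (m * m) by apply: leq_trans (fact_le_exp k) _; rewrite leq_exp2l // leq_mul.
have bk j : j <= m + 2 -> (D + b) ^ j <= 2 ^ ((2 * m + 1) * (m + 2)).
  move=> jm; apply: leq_trans (_ : (2 ^ (2 * m + 1)) ^ j <= _).
    by case: j {jm} => // j; rewrite leq_exp2r.
  by rewrite -expnM leq_exp2l // leq_mul2l jm orbT.
have ee : 2 ^ entry_exp m = 2 ^ (2 * m) * (2 ^ (m * m) * 2 ^ ((2 * m + 1) * (m + 2))).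
  by rewrite mulnA -!expnD.
have key R j : R \in rk -> j < size R -> sz (nth (0, 1) R j) <= 8 * entry_exp m + 11.
  move=> Rk jR; have [sR wR] := vk R Rk.
  have wf : fwf (nth (0, 1) R j) by exact: (allP wR _ (mem_nth _ jR)).
  have ilt : index R rk < size rk by rewrite index_mem.
  have h1 : k + index R rk < size rows by lia.
  have h2 : k + j < n by lia.
  have := entry _ _ h1 h2; rewrite (nth_index [::] Rk) => /(_ wf) [].
  move: (nth _ R j) wf => f _ f1 f2.
  have e1 : f.1 < 2 ^ (entry_exp m).+1.
    apply: leq_ltn_trans (_ : 2 ^ entry_exp m < _); last by rewrite ltn_exp2l.
    apply: leq_trans f1 _; rewrite ee; apply: leq_mul kk _.
    by apply: leq_mul kf _; apply: bk; lia.
  have e2 : f.2 < 2 ^ (entry_exp m).+1.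
    apply: leq_ltn_trans (_ : 2 ^ entry_exp m < _); last by rewrite ltn_exp2l.
    apply: leq_trans f2 _; rewrite ee; apply: leq_mul.
      by apply: leq_trans Dm _; rewrite leq_exp2l //; lia.
    by apply: leq_mul kf _; apply: bk; lia.
  by apply: leq_trans (sz_nat_pair e1 e2) _; lia.
have keyR i x0 : i < size rk -> sz (nth x0 rk i) <= 1 + m * (8 * entry_exp m + 12).
  move=> lt; have Rk : nth x0 rk i \in rk by exact: mem_nth.
  have [sR _] := vk _ Rk; apply: leq_trans (_ : 1 + size (nth x0 rk i) * (8 * entry_exp m + 12) <= _).
    rewrite -[12]/(11.+1) addnS; apply: sz_seq_le => j y0 jlt.
    by rewrite (set_nth_default (0, 1)) //; exact: key.
  by rewrite leq_add2l leq_mul2r sR; apply/orP; right; lia.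
rewrite sz_Some /elim_size addn2 !ltnS; apply: leq_trans (sz_seq_le keyR) _.
by rewrite leq_add2l; apply: leq_mul; rewrite // sk; lia.
Qed.

Lemma FP_solve_rows (X : encType) (rows : X -> seq (seq nfrac)) :
  (forall a, rows a != [::]) -> (forall a, vrows (size (rows a)).+2 (rows a)) ->
  (forall a, stoch (size (rows a)).+2 (rows a)) ->
  FP rows -> FP (fun a => solve (rows a)).
Proof.
move=> r0 vr st fr; have [g pg Sg] := sz_FP fr.
apply: (@FP_solve _ (fun m => elim_size (g m))) => //.
  by rewrite /elim_size /entry_exp; pbound.
move=> a i; set l := take i _; rewrite foldl_elim.
have lr : size l < size (rows a).
  have := r0 a; rewrite /l; case: (rows a) => //= p rest _; rewrite ltnS size_take.
  by case: ifP => // /ltnW.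
case E : (elim_iter (size l) (rows a)) => [rk|]; last by rewrite /elim_size /sz /=; lia.
apply: leq_trans (elim_iter_sz E (vr a) (st a) lr) _.
have := Sg a; move: (sz (rows a)) (g (sz a)) => m1 m2 le.
have ee : entry_exp m1 <= entry_exp m2.
  by rewrite /entry_exp; apply: leq_add; [apply: leq_add; [lia|exact: leq_mul]|apply: leq_mul; lia].
rewrite /elim_size; apply: leq_add => //; apply: leq_add => //; apply: leq_mul => //.
by rewrite ltnS; apply: leq_add => //; apply: leq_mul => //; lia.
Qed.

End ElimSize.

(** * Expected time as a series *)

Local Open Scope ring_scope.

Section Values.
Variables (R : realFieldType) (W : tpwn).
Implicit Types (x y : timestamp W) (t u v w : trans W) (p q r : place W).

Definition tprob (C : {set trans W}) t : R := ratr (weight t / \sum_(u in C) weight u).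

(** An arbitrary choice, which [hitvSS] replaces by any other conflict set. *)
Definition some_conflict x : {set trans W} :=
  if [pick t | senabled (supp x) t] is Some t then conflict_set t (supp x) else finset.set0.

(* Expectation of [F] over the runs from [x] that reach the final marking after
   exactly [n] steps of the MDP, of which each transition takes two. *)
Fixpoint hitv (F : timestamp W -> R) (n : nat) x : R :=
  match n with
  | 0 => if supp x == [set snk W]%SET then F x else 0
  | 1 => 0
  | m.+2 => \sum_(u in some_conflict x) tprob (some_conflict x) u * hitv F m (upd x u)
  end.

Lemma tprob_ge0 C t : 0 <= tprob C t.
Proof.
rewrite /tprob ler0q divr_ge0 //; first exact/ltW/weight_gt0.
by apply: sumr_ge0 => u _; exact/ltW/weight_gt0.
Qed.

Lemma some_conflict_enabled x u : u \in some_conflict x -> senabled (supp x) u.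
Proof. by rewrite /some_conflict; case: pickP => [t _|_]; rewrite ?in_conflict ?inE // => /andP[]. Qed.

Lemma some_conflictP x t : senabled (supp x) t -> some_conflict x \in conflict_sets (supp x).
Proof.
move=> et; rewrite /some_conflict; case: pickP => [u eu|/(_ t)]; last by rewrite et.
by apply/imset_f; rewrite inE.
Qed.

Lemma some_conflict_dead x : (forall t, ~~ senabled (supp x) t) -> some_conflict x = finset.set0.
Proof. by move=> d; rewrite /some_conflict; case: pickP => // u; rewrite (negPf (d u)). Qed.

Lemma hitv_ge0 F n x : (forall y, 0 <= F y) -> 0 <= hitv F n x.
Proof.
move=> F0; have [m] := ubnP n; elim: m n x => // m IH [|[|n]] x lt //=.
  by case: ifP.
by apply: sumr_ge0 => u _; rewrite mulr_ge0 ?tprob_ge0 // IH //; lia.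
Qed.

(* Concurrent choices commute, so the scheduler is irrelevant. *)
Lemma hitv_indep F n x C C' : treach x ->
  C \in conflict_sets (supp x) -> C' \in conflict_sets (supp x) ->
  \sum_(u in C) tprob C u * hitv F n (upd x u) = \sum_(u in C') tprob C' u * hitv F n (upd x u).
Proof.
have [m] := ubnP n; elim: m n x C C' => // m IH n x C C' lt rx.
move=> /imsetP[t]; rewrite inE => et CE /imsetP[t']; rewrite inE => et' C'E.
have [-> //|ne] := eqVneq C C'.
have CP u : u \in C -> senabled (supp x) u /\ dependent t u by rewrite CE in_conflict => /andP.
have C'P u : u \in C' -> senabled (supp x) u /\ dependent t' u by rewrite C'E in_conflict => /andP.
have ind u u' : u \in C -> u' \in C' -> ~~ dependent u u'.
  move=> /CP[eu tu] /C'P[eu' tu']; apply: contra ne => uu'.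
  rewrite CE C'E (conflict_set_eq rx et eu) // (conflict_set_eq rx et' eu') //.
  by rewrite (conflict_set_eq rx eu eu').
have tC : t \in C by rewrite CE in_conflict et dependent_refl //; exact: tpwn_workflow.
have tC' : t' \in C' by rewrite C'E in_conflict et' dependent_refl //; exact: tpwn_workflow.
case: n lt => [|[|n]] lt.
(* One firing cannot lead to the final marking, as the transitions of the other conflict set remain
   enabled. *)
- have z (D D' : {set trans W}) :
      (forall u u', u \in D -> u' \in D' ->
         [/\ senabled (supp x) u, senabled (supp x) u' & ~~ dependent u u']) ->
      (exists u', u' \in D') -> \sum_(u in D) tprob D u * hitv F 0 (upd x u) = 0.
    move=> H [u' u'D']; apply: big1 => u uD; have [eu eu' nuu'] := H u u' uD u'D'.
    rewrite /=; case: eqP => [fin|_]; last by rewrite mulr0.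
    by have := snk_dead u' fin; rewrite concurrent_enabled.
  rewrite (z C C') ?(z C' C) //.
  + by move=> u u' uC u'C; split; [exact: (C'P u uC).1|exact: (CP u' u'C).1|rewrite dependentC ind].
  + by exists t.
  + by move=> u u' uC u'C; split; [exact: (CP u uC).1|exact: (C'P u' u'C).1|exact: ind].
  + by exists t'.
- by rewrite !big1 // => u _ /=; rewrite mulr0.
(* By the induction hypothesis the second choice may be made in the other conflict set; both sides
   thus become sums over the same pairs of concurrent transitions. *)
have step (D D' : {set trans W}) a b : senabled (supp x) a -> senabled (supp x) b ->
    D = conflict_set a (supp x) -> D' = conflict_set b (supp x) ->
    (forall u u', u \in D -> u' \in D' -> ~~ dependent u u') ->
    \sum_(u in D) tprob D u * hitv F n.+2 (upd x u) =
    \sum_(u in D) \sum_(u' in D') tprob D u * (tprob D' u' * hitv F n (upd (upd x u) u')).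
  move=> ea eb DE D'E Hind; apply: eq_bigr => u uD; rewrite -mulr_sumr; congr (_ * _).
  have eu : senabled (supp x) u by move: uD; rewrite DE in_conflict => /andP[].
  have bD' : b \in D' by rewrite D'E in_conflict eb dependent_refl //; exact: tpwn_workflow.
  have nub := Hind u b uD bD'.
  have eb' := concurrent_enabled rx eu eb nub.
  have [_ E] := treach_cf rx eu eb nub.
  rewrite [LHS]/=; apply: IH; [lia|exact: treach_upd|exact: some_conflictP eb'|].
  by apply/imsetP; exists b; rewrite ?inE // D'E E.
rewrite (step C C' t t') // (step C' C t' t) //; last by move=> u u' uC u'C; rewrite dependentC ind.
rewrite exchange_big; apply: eq_bigr => u uC'; apply: eq_bigr => u' u'C.
rewrite mulrCA (@upd_comm _ x u' u) //; [exact: (CP _ u'C).1|exact: (C'P _ uC').1|exact: ind].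
Qed.

Lemma hitvSS F n x C : treach x -> C \in conflict_sets (supp x) ->
  hitv F n.+2 x = \sum_(u in C) tprob C u * hitv F n (upd x u).
Proof.
move=> rx CC /=; apply: hitv_indep => //.
by move: CC => /imsetP[t]; rewrite inE => /some_conflictP.
Qed.

Definition tshift k x : timestamp W := [ffun p => omap (subn^~ k) (x p)].

Lemma supp_tshift k x : supp (tshift k x) = supp x.
Proof. by apply/setP => p; rewrite !inE ffunE; case: (x p). Qed.

Lemma tstart_tshift k x t : tstart (tshift k x) t = (tstart x t - k)%N.
Proof.
rewrite /tstart; apply: (big_ind2 (fun a b => a = b - k)%N) => //.
  by move=> a1 a2 b1 b2 -> ->; lia.
by move=> q _; rewrite ffunE; case: (x q).
Qed.

Lemma tshift_upd k x t : senabled (supp x) t -> (k <= tstart x t)%N ->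
  tshift k (upd x t) = upd (tshift k x) t.
Proof.
move=> et le; rewrite !updE ?supp_tshift //; apply/ffunP => p; rewrite !ffunE tstart_tshift.
by case: ifP => _ /=; [congr Some; lia|case: ifP].
Qed.

(** Under this condition a shift by [k] loses nothing: the dates it truncates precede every start to
    come. *)
Definition start_ge k x := (forall t, senabled (supp x) t -> (k <= tstart x t)%N) /\
  (supp x = [set snk W]%SET -> (k <= odflt 0 (x (snk W)))%N).

(** A transition that uses a token of [t] starts after [t] does; any other was enabled before and
    keeps its start. *)
Lemma start_ge_upd k x t : start_ge k x -> senabled (supp x) t -> start_ge k (upd x t).
Proof.
move=> [H1 H2] et; have kt := H1 t et; split=> [u eu|fin].
  have [d|/pred0Pn[p /= /andP[pu pt]]] := boolP [disjoint preset u & postset t].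
    have [eux ntu] := cold_step et eu d.
    suff -> : tstart (upd x t) u = tstart x u by exact: H1.
    apply: eq_bigr => q qu; rewrite updE // ffunE (disjointFr d qu) ifN //.
    by apply/negP => qt; move/ndependentP: ntu => /(_ q qt); rewrite qu.
  apply: leq_trans (le_tstart _ pu); rewrite updE // ffunE pt /=; lia.
have [p pt] := postset_neq0 t; have : p \in supp (upd x t).
  by rewrite supp_upd // finset.in_setU pt orbT.
by rewrite fin inE => /eqP pE; rewrite -pE updE // ffunE pt /=; lia.
Qed.

Definition one_val : timestamp W -> R := fun=> 1.
Definition snk_time : timestamp W -> R := fun x => (odflt 0%N (x (snk W)))%:R.

(** The shift lowers by [k] the time of every run that reaches the final marking, hence the total by
    [k] times the probability of these runs. *)
Lemma hitv_shift k n x : start_ge k x ->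
  hitv one_val n x = hitv one_val n (tshift k x) /\
  hitv snk_time n x = hitv snk_time n (tshift k x) + k%:R * hitv one_val n x.
Proof.
have [m] := ubnP n; elim: m n x => // m IH [|[|n]] x lt H /=.
- rewrite supp_tshift /one_val /snk_time; case: ifP => [/eqP/H.2 le|_]; last by rewrite mulr0 addr0.
  split=> //; rewrite ffunE mulr1 -natrD; congr (_%:R).
  by case: (x (snk W)) le => //= a; lia.
- by rewrite mulr0 addr0.
have E : some_conflict (tshift k x) = some_conflict x by rewrite /some_conflict supp_tshift.
rewrite E; split.
  apply: eq_bigr => u /some_conflict_enabled eu; congr (_ * _).
  have [|-> _] := IH n (upd x u) _ (start_ge_upd H eu); first by lia.
  by rewrite tshift_upd // H.1.
rewrite mulr_sumr -big_split /=; apply: eq_bigr => u /some_conflict_enabled eu.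
have [|_ ->] := IH n (upd x u) _ (start_ge_upd H eu); first by lia.
by rewrite tshift_upd ?H.1 // mulrDr mulrCA.
Qed.

End Values.

(** * From the path measure to the series *)

Section PathExpectation.
Variables (R : realType) (M : mdp R) (S : scheduler M) (G : seq M -> R).

(** The conditional expectation of [G] after [n] more steps, given the prefix [h]. *)
Fixpoint cont_val (n : nat) (h : seq M) : R :=
  if n is m.+1 then \sum_q next_dist S h q * cont_val m (rcons h q) else G h.

Lemma sum_tuple_cons (n : nat) (F : seq M -> R) :
  \sum_(s : n.+1.-tuple M) F s = \sum_q \sum_(s : n.-tuple M) F (q :: s).
Proof.
rewrite pair_big /= (reindex (fun p : M * n.-tuple M => cons_tuple p.1 p.2)) //=.
exists (fun t : n.+1.-tuple M => (thead t, behead_tuple t)).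
  by move=> [q s] _; congr pair; apply: val_inj.
by move=> t _; rewrite [RHS]tuple_eta; apply: val_inj.
Qed.

Lemma cont_valE n h : \sum_(s : n.-tuple M) prefix_prob S (h ++ s) * G (h ++ s) =
  prefix_prob S h * cont_val n h.
Proof.
elim: n h => [|n IH] h.
  rewrite (eq_bigr (fun=> prefix_prob S h * G h)) => [|s _]; last by rewrite (tuple0 s) cats0.
  by rewrite sumr_const card_tuple expn0.
rewrite (sum_tuple_cons n (fun s => prefix_prob S (h ++ s) * G (h ++ s))) /= mulr_sumr.
apply: eq_bigr => q _; rewrite mulrA -prefix_prob_rcons -IH.
by apply: eq_bigr => s _; rewrite cat_rcons.
Qed.

Lemma sum_prefix n : \sum_(s : n.-tuple M) prefix_prob S s * G s = cont_val n [::].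
Proof. by rewrite (cont_valE n [::]) prefix_prob_nil mul1r. Qed.

End PathExpectation.

Section Process.
Variables (R : realType) (W : tpwn) (S : scheduler (net_mdp R W)) (F : timestamp W -> R).
Let M := net_mdp R W.
Implicit Types (x y : timestamp W) (t u : trans W) (h : seq M).

Definition snk_state : M := inl [set snk W]%SET.
(** The last state of [h] is its only occurrence of the final marking. A path stays in that marking
    forever, and only the first visit must count. *)
Definition first_hit h : bool := (index snk_state h).+1 == size h.
Definition hit_reward h : R := if first_hit h then F (timestamps (fired h)) else 0.

Lemma first_hit_rcons h q : first_hit (rcons h q) = (snk_state \notin h) && (q == snk_state).
Proof.
rewrite /first_hit size_rcons eqSS -cats1 index_cat; case: ifP => /= hm.
  by rewrite ltn_eqF // index_mem.
by case: (q == snk_state); lia.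
Qed.

Lemma fired_rcons h q : fired (rcons h q) =
  if q is inr z then rcons (fired h) (val z).2 else fired h.
Proof. by rewrite /fired -cats1 pmap_cat; case: q => [A|z] /=; rewrite ?cats0 ?cats1. Qed.

Lemma timestamps_rcons s t : timestamps (rcons s t) = upd (timestamps s) t.
Proof. by rewrite /timestamps foldl_rcons. Qed.

Local Notation EV := (cont_val S hit_reward).

Lemma cont_val_after n h : snk_state \in h -> EV n.+1 h = 0.
Proof.
elim: n h => [|n IH] h hs /=.
  by apply: big1 => q _; rewrite /hit_reward first_hit_rcons hs mulr0.
apply: big1 => q _; rewrite [\sum_(_ | _) _](IH (rcons h q)) ?mulr0 //.
by rewrite mem_rcons inE hs orbT.
Qed.

Lemma next_dist_rcons h q : next_dist S (rcons h q) = S (rcons h q).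
Proof. by case: h. Qed.

Lemma sum_dirac (T : finType) (a : T) (f : T -> R) : \sum_q dirac_dist R a q * f q = f a.
Proof.
rewrite (bigD1 a) //= /dirac_dist eqxx mul1r big1 ?addr0 // => q /negPf ->.
by rewrite mul0r.
Qed.

Lemma sum_choice A C (f : M -> R) (g : trans W -> R) :
  C \in conflict_sets A ->
  (forall z : {z : {set place W} * trans W | senabled z.1 z.2},
     (val z).1 = A -> f (inr z) = g (val z).2) ->
  \sum_q choice_dist R A C q * f q = \sum_(u in C) tprob R C u * g u.
Proof.
move=> /imsetP[t _ CE] fg; rewrite big_sumType /= big1 ?add0r; last by move=> B _; rewrite mul0r.
rewrite (eq_bigr (fun z : {z : {set place W} * trans W | senabled z.1 z.2} =>
  if ((val z).1 == A) && ((val z).2 \in C) then tprob R C (val z).2 * g (val z).2 else 0)); last first.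
  by move=> z _; case: ifP => [/andP[/eqP/fg -> _]|]; rewrite ?mul0r.
rewrite -big_mkcond /= [RHS](reindex_omap
    (fun z : {z : {set place W} * trans W | senabled z.1 z.2} => (val z).2)
    (fun u => insub (A, u))) /=; last first.
  by move=> u; rewrite CE inE => /andP[uA _]; rewrite insubT.
apply: eq_bigl => -[[B u] /= Bu]; rewrite andbC; congr (_ && _).
apply/eqP/eqP => [BA|].
  by subst B; rewrite insubT; congr Some; exact: val_inj.
by case: insubP => // y _ yE [] /(congr1 val); rewrite yE => -[].
Qed.

Lemma cont_val_dead n h A : (forall t, ~~ senabled A t) -> A != [set snk W]%SET ->
  EV n (rcons h (inl A)) = 0.
Proof.
move=> d nA; elim: n h => [|n IH] h /=.
  by rewrite /hit_reward first_hit_rcons andbC; case: eqP => //= -[] /eqP; rewrite (negPf nA).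
have := sched_ok S h (inl A); rewrite next_dist_rcons /=.
case: existsP => [[t]|_ ->]; first by rewrite (negPf (d t)).
by rewrite sum_dirac IH.
Qed.

(** The scheduler's conflict set enters through [hitvSS]; the intermediate state holding the chosen
    transition accounts for the second step of the MDP. *)
Lemma cont_val_hitv n h x : treach x -> snk_state \notin h ->
  timestamps (fired h) = x -> EV n (rcons h (inl (supp x))) = hitv F n x.
Proof.
have [m] := ubnP n; elim: m n h x => // m IH n h x lt rx nh xE.
have fx : timestamps (fired (rcons h (inl (supp x) : M))) = x by rewrite fired_rcons.
case: n lt => [|n] lt.
  by rewrite /= /hit_reward first_hit_rcons nh fx.
have [fin|nfin] := eqVneq (supp x) [set snk W]%SET.
  rewrite cont_val_after ?mem_rcons ?fin ?inE ?eqxx //; case: n {lt} => [//|n] /=.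
  by rewrite some_conflict_dead ?big_set0 // => t; exact: snk_dead.
have [/existsP[t et]|/existsPn d] := boolP [exists t, senabled (supp x) t]; last first.
  rewrite cont_val_dead //; case: n {lt} => [//|n] /=.
  by rewrite some_conflict_dead ?big_set0.
have nh' : snk_state \notin rcons h (inl (supp x)).
  by rewrite mem_rcons inE negb_or nh andbT /snk_state eq_sym; apply: contra nfin => /eqP[->].
have := sched_ok S h (inl (supp x)); rewrite /= next_dist_rcons.
case: existsP => [_ [C CC ->]|[]]; last by exists t.
case: n lt => [|n] lt.
  rewrite (sum_choice (g := fun=> 0) CC) ?big1 // => [u _|z _]; first by rewrite mulr0.
  by rewrite /= /hit_reward first_hit_rcons andbF.
rewrite -[RHS]/(hitv F n.+2 x) (hitvSS F n rx CC); apply: sum_choice => // z zA.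
have ez : senabled (supp x) (val z).2 by rewrite -zA; exact: (valP z).
have := sched_ok S (rcons h (inl (supp x) : M)) (inr z); rewrite /= next_dist_rcons => ->.
rewrite sum_dirac zA -supp_upd //; apply: IH; [by lia|exact: treach_upd| |].
  by rewrite mem_rcons inE negb_or nh'.
by rewrite fired_rcons timestamps_rcons fx.
Qed.

(** The initial state is sampled as well, so that a prefix of [n.+1] states consists of [n]
    steps. *)
Lemma cont_val_init n : EV n.+1 [::] = hitv F n (tinit W).
Proof.
rewrite /= sum_dirac -(@cont_val_hitv n [::] (tinit W)) //; last exact: treach_init.
by rewrite supp_tinit.
Qed.

End Process.

Lemma nneseries_single (R : realType) (f : nat -> \bar R) (N : nat) :
  (forall n, 0 <= f n)%E -> (forall n, n != N -> f n = 0)%E ->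
  (\sum_(0 <= n <oo) f n = f N)%E.
Proof.
move=> f0 fN; rewrite (nneseries_split 0 N.+1) // add0n big_nat_recr //= big_nat big1 ?add0e.
  by rewrite eseries0 ?adde0 // => i lt _; rewrite fN // gtn_eqF.
by move=> i /andP[_ lt]; rewrite fN // ltn_eqF.
Qed.

Fact bmaxA : associative bmax.
Proof. by move=> [a|] [b|] [c|] //=; rewrite maxnA. Qed.
Fact bmaxC : commutative bmax.
Proof. by move=> [a|] [b|] //=; rewrite maxnC. Qed.
Fact bmax0x : left_id None bmax.
Proof. by []. Qed.
HB.instance Definition _ := Monoid.isComLaw.Build (option nat) None bmax bmaxA bmaxC bmax0x.

Section Integral.
Variables (R : realType) (W : tpwn) (S : scheduler (net_mdp R W)).
Let M := net_mdp R W.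
Let P := path_prob S.
Local Open Scope classical_set_scope.

Lemma measurable_cylinder (s : seq M) : measurable (cylinder s : set (path_space M)).
Proof. by apply: sub_sigma_algebra; exists s. Qed.

Lemma measurable_indic_cylinder (s : seq M) :
  measurable_fun setT (fun pi : path_space M => (\1_(cylinder s) pi : R)%:E).
Proof.
apply/measurable_EFinP; apply: measurable_indic; exact: measurable_cylinder.
Qed.

(** Written as a simple function over the cylinders of length [n], which gives both its
    measurability and its integral. *)
Definition prefix_fun (G : seq M -> R) (n : nat) (pi : path_space M) : \bar R :=
  (\sum_(s : n.-tuple M) ((G s)%:E * (\1_(cylinder s) pi)%:E))%E.

Lemma prefix_funE G n pi : prefix_fun G n pi = (G (mkseq pi n))%:E.
Proof.
have sz : size (mkseq pi n) == n by rewrite size_mkseq.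
rewrite /prefix_fun (bigD1 (Tuple sz)) //= indicE mem_set /= ?mule1; last first.
  by rewrite /cylinder /= size_mkseq.
rewrite big1 ?adde0 // => s ne; rewrite indicE memNset ?mule0 //.
rewrite /cylinder /= size_tuple => E; case/eqP: ne; apply: val_inj; exact/esym.
Qed.

Lemma measurable_prefix_fun G n : measurable_fun setT (prefix_fun G n).
Proof.
apply: emeasurable_sum => s; apply: measurable_funeM; exact: measurable_indic_cylinder.
Qed.

Lemma integral_prefix_fun G n : (forall s, 0 <= G s) ->
  (\int[P]_pi prefix_fun G n pi = (cont_val S G n [::])%:E)%E.
Proof.
move=> G0; rewrite ge0_integral_sum //=; first last.
- by move=> s pi _; rewrite mule_ge0 // lee_fin.
- move=> s; apply: measurable_funeM; exact: measurable_indic_cylinder.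
rewrite -sum_prefix -sumEFin; apply: eq_bigr => s _.
rewrite ge0_integralZl_EFin //; last exact: measurable_indic_cylinder.
rewrite integral_indic //; last exact: measurable_cylinder.
rewrite setIT; transitivity ((G s)%:E * (prefix_prob S s)%:E)%E.
  by congr (_ * _)%E; exact: path_prob_cylinder.
by rewrite -EFinM mulrC.
Qed.

Definition hit_set : set (path_space M) := [set pi | exists n, pi n = snk_state R W].

Lemma measurable_hit_set : measurable hit_set.
Proof.
have -> : hit_set = \bigcup_n
    \big[setU/set0]_(s : n.+1.-tuple M | last (minit M) s == snk_state R W) cylinder s.
  apply/seteqP; split=> pi.
    move=> [n pn]; exists n => //.
    have sz : size (mkseq pi n.+1) == n.+1 by rewrite size_mkseq.
    have lst : last (minit M) (Tuple sz) == snk_state R W.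
      by rewrite [tval _]/= -nth_last size_mkseq nth_mkseq // pn.
    rewrite (bigD1 (Tuple sz) lst); left; rewrite /cylinder.
    by rewrite [tval _]/= /mkset size_mkseq.
  move=> [n _]; elim/big_ind: _ => [[]|A B HA HB [/HA|/HB]|s /eqP ls] //.
  rewrite /cylinder /= size_tuple => E; exists n; rewrite -ls -E.
  by rewrite -nth_last size_mkseq nth_mkseq.
apply: bigcupT_measurable => n; apply: bigsetU_measurable => s _; exact: measurable_cylinder.
Qed.

Lemma first_hitP (pi : path_space M) n : first_hit (mkseq pi n.+1) <->
  pi n = snk_state R W /\ forall i, (i < n)%N -> pi i <> snk_state R W.
Proof.
rewrite /mkseq -[n.+1]addn1 iotaD map_cat /= add0n cats1 first_hit_rcons.
split=> [/andP[h /eqP ->]|[-> H]]; last first.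
  rewrite eqxx andbT; apply/negP => /mapP[i]; rewrite mem_iota add0n => /andP[_ lt] /esym.
  exact: H.
split=> // i lt E; move/negP: h; apply; apply/mapP; exists i => //.
by rewrite mem_iota.
Qed.

Lemma first_hit_uniq (pi : path_space M) m n :
  first_hit (mkseq pi m.+1) -> first_hit (mkseq pi n.+1) -> m = n.
Proof.
move=> /first_hitP[m1 m2] /first_hitP[n1 n2]; apply/eqP; case: (ltngtP m n) => //.
  by move=> /n2; rewrite m1.
by move=> /m2; rewrite n1.
Qed.

Lemma hit_set_first pi : hit_set pi -> exists n, first_hit (mkseq pi n.+1).
Proof.
move=> [n pn]; have ex : exists n, pi n == snk_state R W by exists n; apply/eqP.
have [m /eqP pm min] := ex_minnP ex; exists m; apply/first_hitP; split=> // i lt /eqP /min.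
by rewrite leqNgt lt.
Qed.

Lemma first_hit_sum F (pi : path_space M) : (forall x, 0 <= F x) ->
  (\sum_(0 <= n <oo) prefix_fun (hit_reward F) n.+1 pi =
   if pselect (exists n, first_hit (mkseq pi n.+1)) is left ex
   then (F (timestamps (fired (mkseq pi (projT1 (cid ex)).+1))))%:E else 0)%E.
Proof.
move=> F0; case: pselect => [ex|nex].
  case: cid => N /= hN; rewrite (nneseries_single (N := N)).
  - by rewrite prefix_funE /hit_reward hN.
  - by move=> n; rewrite prefix_funE lee_fin /hit_reward; case: ifP.
  - move=> n ne; rewrite prefix_funE /hit_reward; case: ifP => // hn.
    by case/eqP: ne; exact: first_hit_uniq hn hN.
rewrite eseries0 // => n _ _; rewrite prefix_funE /hit_reward; case: ifP => // hn.
by case: nex; exists n.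
Qed.

Definition final_time (x : timestamp W) : R := (odflt 0%N (\big[bmax/None]_(p : place W) x p))%:R.

(** At the final marking only the sink carries a date, so the maximum over all places is that
    date. *)
Lemma hitv_final_time n x : hitv final_time n x = hitv (@snk_time R W) n x.
Proof.
have [m] := ubnP n; elim: m n x => // m IH [|[|n]] x lt //=.
  case: eqP => // fin; rewrite /final_time /snk_time; congr (_%:R).
  rewrite (bigD1 (snk W)) //= big1 => [|p np]; first by case: (x _).
  have : p \notin supp x by rewrite fin inE.
  by rewrite inE negbK => /eqP.
by apply: eq_bigr => u _; rewrite IH //; lia.
Qed.

(** At most one term of the series is nonzero, that of the first visit; the other summand is
    infinite exactly on the paths without a visit. *)
Lemma time_to_snkE (pi : path_space M) : time_to_snk pi =
  ((\sum_(0 <= n <oo) prefix_fun (hit_reward final_time) n.+1 pi) +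
   ((cst +oo) \_ (~` hit_set)) pi)%E.
Proof.
rewrite first_hit_sum; last by move=> x; rewrite ler0n.
rewrite /time_to_snk /patch; case: pselect => [ex|nex].
  have hpi : hit_set pi by case: (ex) => n /eqP; exists n.
  rewrite memNset ?adde0; last by rewrite /= => /(_ hpi).
  case: pselect => [ex'|[]]; last exact: hit_set_first.
  case: cid => N /= /first_hitP[N1 N2]; case: ex_minnP => m /eqP m1 m2.
  suff -> : m = N by [].
  apply/eqP; rewrite eqn_leq m2 ?N1 ?eqxx //= leqNgt; apply/negP => /N2; exact.
rewrite mem_set /=; last by move=> [n pn]; apply: nex; exists n; apply/eqP.
case: pselect => [ex|_]; last by rewrite add0e.
by exfalso; case: ex => n /first_hitP[pn _]; case: nex; exists n; apply/eqP.
Qed.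

Definition hit_prob : \bar R := (\sum_(0 <= n <oo) (hitv (@one_val R W) n (tinit W))%:E)%E.

Lemma hit_probE : P hit_set = hit_prob.
Proof.
rewrite -[X in P X]setIT -integral_indic //; last exact: measurable_hit_set.
have g0 s : 0 <= hit_reward (@one_val R W) s by rewrite /hit_reward; case: ifP.
have E n : (hitv (@one_val R W) n (tinit W))%:E =
    (\int[P]_pi prefix_fun (hit_reward (@one_val R W)) n.+1 pi)%E.
  by rewrite integral_prefix_fun // -(cont_val_init S).
rewrite /hit_prob (eq_eseriesr (fun n _ => E n)) -integral_nneseries //; first last.
- by move=> n pi _; rewrite prefix_funE lee_fin.
- by move=> n; exact: measurable_prefix_fun.
apply: eq_integral => pi _; rewrite first_hit_sum // indicE.
case: pselect => [ex|nex]; last by rewrite memNset // => /hit_set_first.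
by rewrite mem_set //; case: ex => n /first_hitP[pn _]; exists n.
Qed.

(** The right-hand side is free of [S]. Since +oo times 0 is 0, its last term vanishes when the
    final marking is reached almost surely. *)
Lemma sched_ET_series : sched_ET S =
  ((\sum_(0 <= n <oo) (hitv (@snk_time R W) n (tinit W))%:E) + +oo * (1 - hit_prob))%E.
Proof.
rewrite /sched_ET (eq_integral _ _ (fun pi _ => time_to_snkE pi)).
have g0 s : 0 <= hit_reward final_time s by rewrite /hit_reward; case: ifP => // _; rewrite ler0n.
have f0 n pi : (0 <= prefix_fun (hit_reward final_time) n.+1 pi)%E by rewrite prefix_funE lee_fin.
rewrite ge0_integralD //; first last.
- apply/(measurable_restrictT _ _).1; last exact: measurable_cst.
  apply: measurableC; exact: measurable_hit_set.
- by move=> pi _; rewrite /patch; case: ifP => // _; rewrite leey.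
- apply: ge0_emeasurable_sum => [n pi _ _|n _]; first exact: f0.
  exact: measurable_prefix_fun.
- by move=> pi _; apply: nneseries_ge0 => n _ _; exact: f0.
congr (_ + _)%E.
  rewrite integral_nneseries //; last by move=> n; exact: measurable_prefix_fun.
  apply: eq_eseriesr => n _; rewrite integral_prefix_fun // -(hitv_final_time n (tinit W)).
  by rewrite -(cont_val_init S).
have mC : measurable (~` hit_set) by apply: measurableC; exact: measurable_hit_set.
rewrite -integral_mkcond integral_cst // -hit_probE; congr (_ * _)%E.
exact: (probability_setC P measurable_hit_set).
Qed.

End Integral.

Local Close Scope classical_set_scope.

(** * The chain of normalised timestamps *)

Section RawNet.
Variable W : tpwn.
Implicit Types (x y z : timestamp W) (t u v w : trans W) (p q : place W) (A : {set place W}).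

Definition bits_of A : bits := [seq p \in A | p <- enum (place W)].
Definition st_of x : state := [seq x p | p <- enum (place W)].
Definition raw_trans t : rtrans :=
  ((bits_of (preset t), bits_of (postset t)),
   ((`|numq (weight t)|%N, `|denq (weight t)|%N), duration t)).
Definition raw_of : raw :=
  ((bits_of [set src W]%SET, bits_of [set snk W]%SET), [seq raw_trans t | t <- enum (trans W)]).

Lemma enc_seq_map (T U : Type) (e : U -> tree) (f : T -> U) s :
  enc_seq e [seq f a | a <- s] = enc_seq (fun a => e (f a)) s.
Proof. by rewrite /enc_seq foldr_map. Qed.

Lemma eq_enc_seq (T : Type) (e e' : T -> tree) s : e =1 e' -> enc_seq e s = enc_seq e' s.
Proof. by move=> E; elim: s => //= a s ->; rewrite E. Qed.

Lemma enc_bits_of A : enc (bits_of A) = enc_set A.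
Proof. exact: enc_seq_map. Qed.

Lemma enc_raw_trans t : enc (raw_trans t) = enc_trans t.
Proof. by rewrite /enc_trans -!enc_bits_of. Qed.

(** The raw net is all that a program sees of [W], so the algorithm can be stated on raw data
    alone. *)
Lemma enc_raw_of : enc raw_of = enc_tpwn W.
Proof.
rewrite /enc_tpwn -!enc_bits_of -(eq_enc_seq (enum (trans W)) enc_raw_trans).
by rewrite -(enc_seq_map (@enc _) raw_trans).
Qed.

Lemma st_of_inj : injective st_of.
Proof.
move=> x y /eq_in_map E; apply/ffunP => p; apply: E.
by rewrite mem_enum.
Qed.

Lemma in_supp x p : (p \in supp x) = isSome (x p).
Proof. by rewrite /supp finset.in_set; case: (x p). Qed.

Lemma renabledE t x : renabled (bits_of (preset t)) (st_of x) = senabled (supp x) t.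
Proof.
rewrite /renabled zip_map all_map; apply/allP/fintype.subsetP => H p.
  have pe : p \in enum (place W) by rewrite mem_enum.
  by move=> pt; have /implyP/(_ pt) := H p pe; rewrite in_supp.
by move=> _ /=; apply/implyP => /H; rewrite in_supp.
Qed.

Lemma rstartE A x : rstart (bits_of A) (st_of x) = (\max_(p in A) odflt 0%N (x p))%N.
Proof.
rewrite /rstart zip_map [RHS](eq_bigl (fun p => (p \in place W) && (p \in A))) //.
rewrite -big_enum_cond /=.
suff gen s m : foldl (fun m (pv : bool * option nat) => if pv.1 then maxn m (odflt 0%N pv.2) else m) m
    [seq (p \in A, x p) | p <- s] = maxn m (\max_(p <- s | p \in A) odflt 0%N (x p))%N.
  by rewrite gen max0n.
elim: s m => [|p s IH] m /=; first by rewrite big_nil maxn0.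
by rewrite IH big_cons; case: (p \in A); rewrite ?maxnA.
Qed.

Lemma rstart_trans t x : rstart (bits_of (preset t)) (st_of x) = tstart x t.
Proof. exact: rstartE. Qed.

Lemma rupdE t x : senabled (supp x) t -> rupd (raw_trans t) (st_of x) = st_of (upd x t).
Proof.
move=> en; rewrite /rupd /= !zip_map -map_comp; apply: eq_map => p /=.
by rewrite updE // ffunE rstart_trans.
Qed.

Lemma rsubE k x : rsub k (st_of x) = st_of (tshift k x).
Proof.
rewrite /rsub -map_comp; apply: eq_map => p /=; rewrite ffunE.
by case: (x p).
Qed.

Lemma rdepE t u : rdep (bits_of (preset t)) (bits_of (preset u)) = dependent t u.
Proof.
rewrite /rdep zip_map has_map; apply/hasP/dependentP => [[p _ /andP[]]|[p pt pu]].
  by exists p.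
by exists p; rewrite ?mem_enum //=; apply/andP.
Qed.

Lemma rfinalE x : rfinal (bits_of [set snk W]%SET) (st_of x) = (supp x == [set snk W]%SET).
Proof.
rewrite /rfinal zip_map all_map; apply/allP/eqP => [H|E p _].
  apply/setP => p; have pe : p \in enum (place W) by rewrite mem_enum.
  by have /eqP /= <- := H p pe; rewrite in_supp.
by rewrite /= -E in_supp.
Qed.

Lemma rbestP x : let ts := [seq raw_trans t | t <- enum (trans W)] in
  (rbest ts (st_of x) = None /\ forall t, ~~ senabled (supp x) t) \/
  exists b, [/\ rbest ts (st_of x) = Some (raw_trans b), senabled (supp x) b &
    forall t, senabled (supp x) t -> (tstart x b <= tstart x t)%N].
Proof.
rewrite /=; suff H (s : seq (trans W)) : let best := rbest [seq raw_trans t | t <- s] (st_of x) in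
  (best = None /\ {in s, forall t, ~~ senabled (supp x) t}) \/
  exists b, [/\ best = Some (raw_trans b), senabled (supp x) b &
    {in s, forall t, senabled (supp x) t -> (tstart x b <= tstart x t)%N}].
  have [[-> h]|[b [-> eb h]]] := H (enum (trans W)); [left|right].
    by split=> // t; apply: h; rewrite mem_enum.
  by exists b; split=> // t; apply: h; rewrite mem_enum.
elim/last_ind: s => [|s t IH]; first by left.
rewrite /= /rbest map_rcons foldl_rcons -/(rbest _ _) renabledE.
case: IH => [[-> h]|[b [-> eb h]]] /=.
  rewrite andbT; case et: (senabled _ t); [right|left].
    exists t; split=> // u; rewrite mem_rcons inE => /predU1P[->//|/h]; by move=> /negPf ->.
  by split=> // u; rewrite mem_rcons inE => /predU1P[->|/h //]; rewrite et.
right; rewrite !rstart_trans; case et: (senabled _ t) => /=; last first.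
  exists b; split=> // u; rewrite mem_rcons inE => /predU1P[->|]; first by rewrite et.
  exact: h.
case: ltnP => lt.
  exists t; split=> // u; rewrite mem_rcons inE => /predU1P[->//|us eu].
  exact: leq_trans (ltnW lt) (h u us eu).
exists b; split=> // u; rewrite mem_rcons inE => /predU1P[->//|].
exact: h.
Qed.

Lemma rconflictE b x : rconflict [seq raw_trans t | t <- enum (trans W)] (st_of x) (raw_trans b) =
  [seq raw_trans t | t <- enum (conflict_set b (supp x))].
Proof.
rewrite /rconflict filter_map; congr map; rewrite enumT; apply: eq_filter => t /=.
by rewrite renabledE rdepE inE.
Qed.

Lemma fval_weight (K : realFieldType) t : @fval K (raw_trans t).2.1 = ratr (weight t).
Proof.
have w0 := weight_gt0 t; rewrite /fval /=.
have -> : `|denq (weight t)|%N%:R = (denq (weight t))%:~R :> K.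
  by rewrite pmulrn absz_denq.
have -> : `|numq (weight t)|%N%:R = (numq (weight t))%:~R :> K.
  by rewrite pmulrn gez0_abs // numq_ge0 ltW.
by [].
Qed.

Lemma fwf_weight t : fwf (raw_trans t).2.1.
Proof. by rewrite /fwf /= absz_gt0 denq_neq0 coprime_num_den. Qed.

End RawNet.

Section Chain.
Variable W : tpwn.
Implicit Types (x y z : timestamp W) (t u v w b : trans W) (p q : place W).
Let ts := [seq raw_trans t | t <- enum (trans W)].

Definition is_best z b : Prop := [/\ rbest ts (st_of z) = Some (raw_trans b),
  senabled (supp z) b & forall t, senabled (supp z) t -> (tstart z b <= tstart z t)%N].

(** [rbest] returns raw data that several transitions may share; one of them is chosen. *)
Definition bestz z : option (trans W) :=
  if pselect (exists b, is_best z b) is left ex then Some (projT1 (cid ex)) else None.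

Lemma bestzP z :
  (bestz z = None /\ rbest ts (st_of z) = None /\ forall t, ~~ senabled (supp z) t) \/
  exists2 b, bestz z = Some b & is_best z b.
Proof.
rewrite /bestz; case: pselect => [ex|nex]; first by right; exists (projT1 (cid ex)) => //; case: cid.
left; split=> //; have [//|[b [h1 h2 h3]]] := rbestP z.
by case: nex; exists b; split.
Qed.

Definition kz z : nat := if bestz z is Some b then tstart z b else 0%N.
Definition Cz z : {set trans W} := if bestz z is Some b then conflict_set b (supp z) else finset.set0.
Definition nextz z u : timestamp W := upd (tshift (kz z) z) u.
Definition qz z u : nfrac :=
  fdiv (raw_trans u).2.1 (fsum [seq (raw_trans v).2.1 | v <- enum (Cz z)]).

(** A dead timestamp loops, as in the MDP, so that the probabilities always add up to 1. *)
Definition arcs z : seq (nfrac * timestamp W) :=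
  if bestz z is Some _ then [seq (qz z u, nextz z u) | u <- enum (Cz z)] else [:: ((1, 1)%N, z)].

Lemma rsuccE z : rsucc ts (st_of z) = (kz z, [seq (a.1, st_of a.2) | a <- arcs z]).
Proof.
rewrite /rsucc /arcs /kz /qz /nextz /kz /Cz; have [[-> [-> _]]|[b -> [-> eb mb]]] := bestzP z.
  by [].
rewrite rstart_trans rconflictE -!map_comp; congr pair.
apply/eq_in_map => u; rewrite mem_enum in_conflict => /andP[eu _] /=.
by rewrite rsubE rupdE // supp_tshift.
Qed.

Lemma Cz_enabled z u : u \in Cz z -> senabled (supp z) u.
Proof.
rewrite /Cz; case: (bestz z) => [b|]; last by rewrite finset.inE.
by rewrite in_conflict => /andP[].
Qed.

Lemma weight_sum_gt0 (C : {set trans W}) u : u \in C -> 0 < \sum_(v in C) weight v.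
Proof.
move=> uC; rewrite (bigD1 u) //= ltr_wpDr ?weight_gt0 //.
by apply: sumr_ge0 => v _; exact/ltW/weight_gt0.
Qed.

Lemma tprob_sum (K : realFieldType) (C : {set trans W}) u : u \in C -> \sum_(v in C) tprob K C v = 1.
Proof.
move=> uC; rewrite /tprob -rmorph_sum /= -mulr_suml divff ?rmorph1 //.
by rewrite gt_eqF // (weight_sum_gt0 uC).
Qed.

Lemma qzP (K : realFieldType) z u : u \in Cz z -> fwf (qz z u) /\ @fval K (qz z u) = tprob K (Cz z) u.
Proof.
move=> uC; rewrite /qz; set l := [seq _ | _ <- _].
have wl : all fwf l by apply/allP => _ /mapP[v _ ->]; exact: fwf_weight.
have [ws es] := fsumP K wl.
have esE : @fval K (fsum l) = ratr (\sum_(v in Cz z) weight v).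
  rewrite es big_map big_enum rmorph_sum /=; apply: eq_bigr => v _; exact: fval_weight.
have s0 : (0 < (fsum l).1)%N.
  rewrite lt0n -(@fval_eq0 K) ?fwf_gt0 // esE fmorph_eq0.
  by rewrite gt_eqF // (weight_sum_gt0 uC).
have [w ->] := fdivP K (fwf_gt0 (fwf_weight u)) (fwf_gt0 ws) s0; split=> //.
by rewrite fval_weight esE /tprob fmorph_div.
Qed.

Definition Hmax : nat := (\max_(t : trans W) duration t)%N.

(* Timestamps counted from the start of the last firing: the earliest conflict
   set being fired first, they are bounded by the longest duration. *)
Definition good z : Prop := exists x k, [/\ treach x, start_ge k x, z = tshift k x
  & forall p, (odflt 0%N (z p) <= Hmax)%N].

Lemma tshift0 x : tshift 0 x = x.
Proof. by apply/ffunP => p; rewrite ffunE; case: (x p) => //= n; rewrite subn0. Qed.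

Lemma tshift_add k k' x : tshift k' (tshift k x) = tshift (k + k') x.
Proof. by apply/ffunP => p; rewrite !ffunE; case: (x p) => //= n; rewrite subnDA. Qed.

Lemma good_init : good (tinit W).
Proof.
exists (tinit W), 0%N; split; [exact: treach_init| |by rewrite tshift0|].
  by split.
by move=> p; rewrite ffunE; case: ifP.
Qed.

(** As [b] starts first, the clock can be advanced to its start; the rest of its conflict set starts
    simultaneously by [tstart_conflict]. *)
Lemma good_step x k z b : treach x -> start_ge k x -> z = tshift k x ->
  bestz z = Some b -> start_ge (k + tstart z b) x /\
  forall u, u \in Cz z -> [/\ senabled (supp x) u, tstart z u = tstart z b
     & nextz z u = tshift (k + tstart z b) (upd x u)].
Proof.
move=> rx sk zE bE; have [[bN _]|[b' + [_ eb mb]]] := bestzP z; first by rewrite bE in bN.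
rewrite bE => -[] bb; subst b'.
have sz : supp z = supp x by rewrite zE supp_tshift.
have sk' : start_ge (k + tstart z b) x.
  split=> [t et|fin]; last by move: eb; rewrite sz => eb; have := snk_dead b fin; rewrite eb.
  by have := mb t; rewrite sz => /(_ et); have := sk.1 t et; rewrite zE !tstart_tshift; lia.
split=> // u uC; have eu : senabled (supp x) u by rewrite -sz; exact: Cz_enabled uC.
split=> //.
  rewrite zE !tstart_tshift (@tstart_conflict _ x u b) // -?sz //.
  by move: uC; rewrite /Cz bE in_conflict dependentC => /andP[].
have e : tshift (tstart z b) z = tshift (k + tstart z b) x by rewrite -tshift_add -zE.
by rewrite /nextz /kz bE e tshift_upd //; exact: sk'.1.
Qed.

Lemma good_next z u : good z -> u \in Cz z -> good (nextz z u).
Proof.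
move=> [x [k [rx sk zE zH]]] uC; case bE: (bestz z) => [b|]; last by move: uC; rewrite /Cz bE finset.inE.
have [sk' /(_ u uC) [eu us nE]] := good_step rx sk zE bE.
have ez : senabled (supp (tshift (kz z) z)) u by rewrite supp_tshift (Cz_enabled uC).
exists (upd x u), (k + tstart z b)%N; split=> //; [exact: treach_upd|exact: start_ge_upd|].
(* After the shift [u] starts at 0, so its tokens are dated by its duration; the other dates only
   decrease. *)
move=> p; rewrite /nextz updE // ffunE tstart_tshift /kz bE us subnn add0n.
case: ifP => [_|_] /=; first by rewrite /Hmax; exact: (leq_bigmax (F := fun t => duration t) u).
case: ifP => // _; rewrite ffunE; have := zH p; case: (z p) => //= n; lia.
Qed.

Lemma good_arcs z a : good z -> a \in arcs z -> good a.2.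
Proof.
rewrite /arcs; case: (bestz z) => [b|] gz; last by rewrite inE => /eqP ->.
by move=> /mapP[u]; rewrite mem_enum => uC ->; exact: good_next.
Qed.

Definition addz (L : seq (timestamp W)) z := if z \in L then L else z :: L.
Definition newz (L : seq (timestamp W)) := flatten [seq [seq a.2 | a <- arcs z] | z <- L].
Definition stepz L := foldl addz L (newz L).

Lemma add_newE L z : add_new [seq st_of y | y <- L] (st_of z) = [seq st_of y | y <- addz L z].
Proof.
rewrite /add_new /addz has_map (_ : has _ _ = (z \in L)); first by case: ifP.
by rewrite -has_pred1; apply: eq_has => y /=; rewrite (inj_eq (@st_of_inj W)) eq_sym.
Qed.

Lemma close_stepE L : close_step ts [seq st_of y | y <- L] = [seq st_of y | y <- stepz L].
Proof.
rewrite /close_step /stepz.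
have -> : flatten [seq [seq d.2 | d <- (rsucc ts a).2] | a <- [seq st_of y | y <- L]] =
   [seq st_of y | y <- newz L].
  rewrite /newz map_flatten -!map_comp; congr flatten; apply: eq_map => z /=.
  by rewrite rsuccE /= -!map_comp.
by move: (newz L) => s; elim: s L => //= z s IH L; rewrite add_newE IH.
Qed.

Lemma foldl_addz L s : let L' := foldl addz L s in
  [/\ exists l, L' = l ++ L, uniq L -> uniq L', {subset s <= L'} & {subset L' <= L ++ s}].
Proof.
elim: s L => [|z s IH] L /=; first by split=> //; [exists [::]|move=> z; rewrite cats0].
have [[l lE] uL sL Ls] := IH (addz L z); split.
- rewrite lE /addz; case: ifP => _; first by exists l.
  by exists (rcons l z); rewrite cat_rcons.
- by move=> u; apply: uL; rewrite /addz; case: ifP => //= ->.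
- move=> y; rewrite inE => /predU1P[->|/sL //]; rewrite lE mem_cat; apply/orP; right.
  by rewrite /addz; case: ifP => //; rewrite mem_head.
- move=> y /Ls; rewrite !mem_cat inE => /orP[|->]; last by rewrite !orbT.
  by rewrite /addz; case: ifP => _; [move=> ->|rewrite inE => /orP[|] ->; rewrite ?orbT].
Qed.

Definition statesz (n : nat) := iter n stepz [:: tinit W].

Lemma st_of_init : rinit (raw_of W) = st_of (tinit W).
Proof.
rewrite /rinit -map_comp; apply: eq_map => p /=; rewrite ffunE finset.inE.
by case: (p == src W).
Qed.

Lemma rstatesE pad : rstates ts (rinit (raw_of W)) pad = [seq st_of z | z <- statesz (size pad)].
Proof.
rewrite /rstates st_of_init -[[:: st_of _]]/([seq st_of y | y <- [:: tinit W]]) /statesz.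
elim: pad [:: tinit W] => //= _ pad IH L.
by rewrite close_stepE IH -iterSr.
Qed.

Lemma statesz_inv n : [/\ uniq (statesz n), (forall z, z \in statesz n -> good z)
  & exists l, statesz n = rcons l (tinit W)].
Proof.
elim: n => [|n [u g [l E]]].
  by split=> //; [move=> z; rewrite inE => /eqP ->; exact: good_init|exists [::]].
rewrite /statesz iterS -/(statesz n).
have [[l' E'] h1 h2 h3] := foldl_addz (statesz n) (newz (statesz n)).
split; first exact: h1.
  move=> z /h3; rewrite mem_cat => /orP[/g //|/flattenP[_ /mapP[y /g gy ->]]].
  by move=> /mapP[a aA ->]; exact: good_arcs aA.
by exists (l' ++ l); rewrite /stepz E' E rcons_cat.
Qed.

Definition closedz (L : seq (timestamp W)) := forall z a, z \in L -> a \in arcs z -> a.2 \in L.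

(** As long as the list is not closed, a step adds at least one state. *)
Lemma statesz_closed_or n : closedz (statesz n) \/ (n < size (statesz n))%N.
Proof.
elim: n => [|n IH]; first by right.
rewrite /statesz iterS -/(statesz n); have [[l E] h1 h2 h3] := foldl_addz (statesz n) (newz (statesz n)).
have [c|nc] := pselect (closedz (statesz n)).
  left; suff -> : stepz (statesz n) = statesz n by [].
  have al : {subset newz (statesz n) <= statesz n}.
    by move=> y /flattenP[_ /mapP[z zL ->]] /mapP[a aA ->]; exact: c aA.
  rewrite /stepz; elim: (newz _) al => //= y s IHs al.
  rewrite /addz al ?mem_head //; apply: IHs => v vs; apply: al; by rewrite inE vs orbT.
have {}IH : (n < size (statesz n))%N by case: IH.
right; rewrite /stepz E size_cat; case: l E => [|a0 l] E; last by rewrite /=; lia.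
case: nc => z a zL aA; rewrite -[statesz n]cat0s -E; apply: h2.
by apply/flattenP; exists [seq c.2 | c <- arcs z]; [exact: map_f|exact: map_f aA].
Qed.

(** A place has no token or a token dated between 0 and [Hmax], hence the base [Hmax + 2]. *)
Lemma good_card (L : seq (timestamp W)) : uniq L -> (forall z, z \in L -> good z) ->
  (size L <= (Hmax + 2) ^ #|place W|)%N.
Proof.
move=> uL gL.
pose code z : {ffun place W -> option 'I_Hmax.+1} := [ffun p => omap (@inord Hmax) (z p)].
have inj : {in L &, injective code}.
  move=> z z' zL z'L /ffunP E; apply/ffunP => p; have := E p; rewrite !ffunE.
  have [_ [_ [_ _ _ /(_ p)]]] := gL z zL; have [_ [_ [_ _ _ /(_ p)]]] := gL z' z'L.
  case: (z p) => [a|]; case: (z' p) => [c|] //= hc ha [] /(congr1 val) /=.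
  by rewrite !inordK // => ->.
rewrite -(size_map code); have /card_uniqP <- : uniq (map code L) by rewrite map_inj_in_uniq.
apply: leq_trans (max_card _) _; rewrite card_ffun card_option card_ord.
by rewrite -addn2.
Qed.

Lemma statesz_closed n : ((Hmax + 2) ^ #|place W| <= n)%N -> closedz (statesz n).
Proof.
move=> le; have [//|lt] := statesz_closed_or n.
have [u g _] := statesz_inv n; have := good_card u g; lia.
Qed.

End Chain.

Section ArcProb.
Variables (K : realFieldType) (W : tpwn).
Implicit Types (x y z : timestamp W) (t u v w b : trans W) (p q : place W).

Lemma arcs_wf z : {in arcs z, forall a, fwf a.1}.
Proof.
move=> a; rewrite /arcs; case: (bestz z) => [b|]; last by rewrite inE => /eqP ->.
by move=> /mapP[u]; rewrite mem_enum => uC ->; exact: (qzP K uC).1.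
Qed.

Lemma arcs_gt0 z : {in arcs z, forall a, 0 < fval a.1 :> K}.
Proof.
move=> a; rewrite /arcs; case: (bestz z) => [b|]; last first.
  by rewrite inE => /eqP -> /=; rewrite /fval divr1.
move=> /mapP[u]; rewrite mem_enum => uC ->; rewrite (qzP K uC).2 /tprob ltr0q.
by rewrite divr_gt0 ?weight_gt0 // (weight_sum_gt0 uC).
Qed.

Lemma sum_arcs z b (f : timestamp W -> K) : bestz z = Some b ->
  \sum_(a <- arcs z) fval a.1 * f a.2 = \sum_(u in Cz z) tprob K (Cz z) u * f (nextz z u).
Proof.
move=> bE; rewrite /arcs bE big_map big_enum; apply: eq_bigr => u uC.
by rewrite (qzP K uC).2.
Qed.

Lemma bestz_in z b : bestz z = Some b -> b \in Cz z.
Proof.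
move=> bE; have [[]|[b']] := bestzP z; rewrite bE // => -[<-] [_ eb _].
by rewrite /Cz bE in_conflict eb dependent_refl //; exact: tpwn_workflow.
Qed.

Lemma arcs_sum z : \sum_(a <- arcs z) fval a.1 = 1 :> K.
Proof.
case bE: (bestz z) => [b|]; last by rewrite /arcs bE big_seq1 /fval divr1.
under eq_bigr => a _ do rewrite -[fval _]mulr1.
rewrite (sum_arcs (fun=> 1) bE); under eq_bigr => u _ do rewrite mulr1.
exact: tprob_sum (bestz_in bE).
Qed.

End ArcProb.

(** * Hitting probabilities and expected times of the chain *)

Section ChainValue.
Variables (R : realType) (W : tpwn).
Implicit Types (x y z : timestamp W) (t u v w b : trans W) (p q : place W).

Definition isfin z : bool := supp z == [set snk W]%SET.
Let h1 n z : R := hitv (@one_val R W) n z.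
Let h2 n z : R := hitv (@snk_time R W) n z.

Lemma bestz_fin z : isfin z -> bestz z = None.
Proof.
move=> /eqP fin; have [[-> //]|[b _ [_ eb _]]] := bestzP z.
by have := snk_dead b fin; rewrite eb.
Qed.

Lemma hitv_deadz (F : timestamp W -> R) z n : bestz z = None -> hitv F n.+2 z = 0.
Proof.
move=> bE; have [[_ [_ d]]|[b]] := bestzP z; last by rewrite bE.
by rewrite /= some_conflict_dead ?big_set0.
Qed.

Lemma h1_0 z : h1 0 z = (isfin z)%:R.
Proof. by rewrite /h1 /= /one_val -/(isfin z); case: (isfin z). Qed.

Lemma h2_0 z : h2 0 z = if isfin z then snk_time R z else 0.
Proof. by []. Qed.

Lemma h1_ge0 n z : 0 <= h1 n z.
Proof. by apply: hitv_ge0 => y; rewrite /one_val. Qed.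

Lemma h2_ge0 n z : 0 <= h2 n z.
Proof. by apply: hitv_ge0 => y; rewrite /snk_time ler0n. Qed.

Lemma h_fin n z : isfin z -> h1 n.+1 z = 0 /\ h2 n.+1 z = 0.
Proof. by move=> /bestz_fin bE; case: n => [//|n]; rewrite /h1 /h2 !hitv_deadz. Qed.

(** The elapsed time [kz z] is counted only on the runs that end at the given step, hence the factor
    [h1 n.+2 z]. *)
Lemma h_step n z : good z -> ~~ isfin z ->
  h1 n.+2 z = \sum_(a <- arcs z) fval a.1 * h1 n a.2 /\
  h2 n.+2 z = \sum_(a <- arcs z) fval a.1 * h2 n a.2 + (kz z)%:R * h1 n.+2 z.
Proof.
move=> [x [k [rx sk zE zH]]] nf; case bE: (bestz z) => [b|]; last first.
  rewrite /arcs bE !big_seq1 /h1 /h2 !hitv_deadz // mulr0 addr0 /fval divr1 !mul1r.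
  case: n => [|[|n]] //; last by rewrite !hitv_deadz.
  by rewrite -/(h1 0 z) -/(h2 0 z) h1_0 h2_0 (negPf nf).
have [sk' step] := good_step rx sk zE bE.
have CE : Cz z = conflict_set b (supp x) by rewrite /Cz bE zE supp_tshift.
have CC : Cz z \in conflict_sets (supp x).
  rewrite CE; apply/imsetP; exists b => //; rewrite inE.
  have [[]|[b']] := bestzP z; rewrite bE // => -[<-] [_ eb _].
  by move: eb; rewrite zE supp_tshift.
have nx u : u \in Cz z -> h1 n (upd x u) = h1 n (nextz z u) /\
    h2 n (upd x u) = h2 n (nextz z u) + (k + tstart z b)%:R * h1 n (upd x u).
  move=> uC; have [eu _ ->] := step u uC; exact: hitv_shift (start_ge_upd sk' eu).
have [z1 z2] := @hitv_shift R W k n.+2 x sk; rewrite -zE in z1 z2.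
rewrite -/(h1 n.+2 x) -/(h1 n.+2 z) -/(h2 n.+2 x) -/(h2 n.+2 z) in z1 z2.
have s1 : h1 n.+2 x = \sum_(u in Cz z) tprob R (Cz z) u * h1 n (upd x u) by exact: hitvSS.
have s2 : h2 n.+2 x = \sum_(u in Cz z) tprob R (Cz z) u * h2 n (upd x u) by exact: hitvSS.
rewrite !(sum_arcs (fun y => h1 n y) bE) !(sum_arcs (fun y => h2 n y) bE).
have e1 : h1 n.+2 z = \sum_(u in Cz z) tprob R (Cz z) u * h1 n (nextz z u).
  by rewrite -z1 s1; apply: eq_bigr => u uC; rewrite (nx u uC).1.
split=> //; have -> : h2 n.+2 z = h2 n.+2 x - k%:R * h1 n.+2 x by rewrite z2 addrK.
rewrite -z1 s2 (eq_bigr (fun u => tprob R (Cz z) u * h2 n (nextz z u) +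
   (k + tstart z b)%:R * (tprob R (Cz z) u * h1 n (upd x u)))) => [|u uC]; last first.
  by rewrite {1}(nx u uC).2 mulrDr mulrCA.
rewrite big_split /= -mulr_sumr -s1 /kz bE natrD; ring.
Qed.

(** The probability of reaching the final marking; [Tz] is the expected time restricted to the runs
    that reach it. *)
Definition Pz z : \bar R := (\sum_(0 <= n <oo) (h1 n z)%:E)%E.
Definition Tz z : \bar R := (\sum_(0 <= n <oo) (h2 n z)%:E)%E.

(** Two terms are split off because one firing takes two steps of the MDP. *)
Lemma nneseries_two (f : nat -> R) : (forall n, 0 <= f n) ->
  (\sum_(0 <= n <oo) (f n)%:E = (f 0%N)%:E + (f 1%N)%:E + \sum_(0 <= n <oo) (f n.+2)%:E)%E.
Proof.
move=> f0; have g0 n : (0 <= (f n)%:E)%E by rewrite lee_fin.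
rewrite (nneseries_split 0 2) // add0n -(nneseries_addn (f := fun n => (f n)%:E) 2) //.
rewrite big_nat_recr //= big_nat1; congr (_ + _)%E.
by apply: eq_eseriesr => n _; rewrite addn2.
Qed.

Lemma series_arcs (f : nat -> timestamp W -> R) z : (forall n y, 0 <= f n y) ->
  (\sum_(0 <= n <oo) (\sum_(a <- arcs z) fval a.1 * f n a.2)%:E =
   \sum_(a <- arcs z) (fval a.1)%:E * \sum_(0 <= n <oo) (f n a.2)%:E)%E.
Proof.
move=> f0; transitivity (\sum_(0 <= n <oo) \sum_(a <- arcs z) (fval a.1 * f n a.2)%:E)%E.
  by apply: eq_eseriesr => n _; rewrite sumEFin.
rewrite nneseries_sum; last by move=> *; rewrite lee_fin; apply: mulr_ge0; [exact: fval_ge0|exact: f0].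
apply: eq_bigr => a _; rewrite -nneseriesZl ?fval_ge0 // => n _.
by rewrite lee_fin; exact: f0.
Qed.

Lemma Pz_fin z : isfin z -> Pz z = 1%E.
Proof.
move=> fin; rewrite /Pz nneseries_two; last by move=> n; exact: h1_ge0.
rewrite h1_0 fin (h_fin 0 fin).1 eseries0 ?adde0 // => n _ _.
by rewrite (h_fin n.+1 fin).1.
Qed.

Lemma Tz_fin z : isfin z -> Tz z = (snk_time R z)%:E.
Proof.
move=> fin; rewrite /Tz nneseries_two; last by move=> n; exact: h2_ge0.
rewrite h2_0 fin (h_fin 0 fin).2 eseries0 ?adde0 // => n _ _.
by rewrite (h_fin n.+1 fin).2.
Qed.

Lemma Pz_step z : good z -> ~~ isfin z ->
  (Pz z = \sum_(a <- arcs z) (fval a.1)%:E * Pz a.2)%E.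
Proof.
move=> gz nf; rewrite /Pz nneseries_two; last by move=> n; exact: h1_ge0.
rewrite h1_0 (negPf nf) !add0e -series_arcs; last by move=> n y; exact: h1_ge0.
by apply: eq_eseriesr => n _; rewrite (h_step n gz nf).1.
Qed.

Lemma Tz_step z : good z -> ~~ isfin z ->
  (Tz z = \sum_(a <- arcs z) (fval a.1)%:E * Tz a.2 + (kz z)%:R%:E * Pz z)%E.
Proof.
move=> gz nf; have H2 n y := h2_ge0 n y; have H1 n y := h1_ge0 n y.
rewrite /Tz nneseries_two // h2_0 (negPf nf) !add0e -series_arcs //.
rewrite /Pz (nneseries_two (f := fun n => h1 n z)) // h1_0 (negPf nf) !add0e.
rewrite -nneseriesZl ?ler0n //; last by move=> n _; rewrite lee_fin.
rewrite -nneseriesD; first last.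
- by move=> n _ _; rewrite mule_ge0 // lee_fin ?ler0n.
- by move=> n _ _; rewrite lee_fin sumr_ge0 // => a _; rewrite mulr_ge0 ?fval_ge0.
by apply: eq_eseriesr => n _; rewrite (h_step n gz nf).2 EFinD EFinM.
Qed.

Let S1 n z : R := \sum_(i < n) h1 i z.
Let S2 n z : R := \sum_(i < n) h2 i z.

Lemma S1_step n z : good z -> ~~ isfin z -> S1 n.+2 z = \sum_(a <- arcs z) fval a.1 * S1 n a.2.
Proof.
move=> gz nf; rewrite /S1 2!big_ord_recl h1_0 (negPf nf) !add0r /=.
under eq_bigr => i _ do rewrite /bump /= !add1n (h_step i gz nf).1.
by rewrite exchange_big /=; apply: eq_bigr => a _; rewrite mulr_sumr.
Qed.

Lemma S2_step n z : good z -> ~~ isfin z ->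
  S2 n.+2 z = \sum_(a <- arcs z) fval a.1 * S2 n a.2 + (kz z)%:R * S1 n.+2 z.
Proof.
move=> gz nf; rewrite /S1 /S2 !(@big_ord_recl _ _ _ n.+1) !(@big_ord_recl _ _ _ n).
rewrite h1_0 h2_0 (negPf nf) !add0r /=.
under eq_bigr => i _ do rewrite /bump /= !add1n (h_step i gz nf).2.
rewrite big_split /= exchange_big /= -mulr_sumr; congr (_ + _).
by apply: eq_bigr => a _; rewrite mulr_sumr.
Qed.

Lemma S_fin n z : isfin z -> S1 n.+1 z = 1 /\ S2 n.+1 z = snk_time R z.
Proof.
move=> fin; rewrite /S1 /S2 !big_ord_recl h1_0 h2_0 fin !big1 ?addr0 //.
  by move=> i _; rewrite /= /bump /= add1n (h_fin i fin).2.
by move=> i _; rewrite /= /bump /= add1n (h_fin i fin).1.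
Qed.

Lemma S1_le1 n z : good z -> S1 n z <= 1.
Proof.
have [m] := ubnP n; elim: m n z => // m IH [|[|n]] z lt gz.
- by rewrite /S1 big_ord0.
- by rewrite /S1 big_ord1 h1_0; case: (isfin z).
have [fin|nf] := boolP (isfin z); first by rewrite (S_fin n.+1 fin).1.
rewrite S1_step // -(arcs_sum R z) big_seq [leRHS]big_seq; apply: ler_sum => a aA.
rewrite -[leRHS]mulr1 ler_wpM2l ?fval_ge0 // IH //; first by lia.
exact: good_arcs aA.
Qed.

Lemma series_le (f : nat -> R) (c : R) : (forall n, 0 <= f n) ->
  (forall n, \sum_(i < n) f i <= c) -> (\sum_(0 <= n <oo) (f n)%:E <= c%:E)%E.
Proof.
move=> f0 H; apply: lime_le.
  by apply: is_cvg_nneseries => n _ _; rewrite lee_fin.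
by apply: nearW => n; rewrite sumEFin lee_fin big_mkord.
Qed.

Lemma Pz_le1 z : good z -> (Pz z <= 1)%E.
Proof.
move=> gz; apply: series_le => n; [exact: h1_ge0|exact: S1_le1].
Qed.

Lemma Pz_ge0 z : (0 <= Pz z)%E.
Proof. by apply: nneseries_ge0 => n _ _; rewrite lee_fin h1_ge0. Qed.

Lemma Tz_ge0 z : (0 <= Tz z)%E.
Proof. by apply: nneseries_ge0 => n _ _; rewrite lee_fin h2_ge0. Qed.

(** The expected time lies below every nonnegative supersolution, because each partial sum of its
    series does. *)
Lemma Tz_le (V : timestamp W -> R) (L : seq (timestamp W)) :
  (forall z, z \in L -> good z) -> closedz L -> (forall z, z \in L -> 0 <= V z) ->
  (forall z, z \in L -> isfin z -> snk_time R z <= V z) ->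
  (forall z, z \in L -> ~~ isfin z -> \sum_(a <- arcs z) fval a.1 * V a.2 + (kz z)%:R <= V z) ->
  forall z, z \in L -> (Tz z <= (V z)%:E)%E.
Proof.
move=> gL cL V0 Vf Vn z zL; apply: series_le => n; first exact: h2_ge0.
have [m] := ubnP n; elim: m n z zL => // m IH [|[|n]] z zL lt.
- by rewrite big_ord0 V0.
- by rewrite big_ord1 h2_0; case: ifP => [/(Vf z zL)//|_]; exact: V0.
have [fin|nf] := boolP (isfin z); first by rewrite -/(S2 n.+2 z) (S_fin n.+1 fin).2 Vf.
apply: le_trans _ (Vn z zL nf); rewrite -/(S2 n.+2 z) (S2_step n (gL z zL) nf); apply: lerD.
  rewrite big_seq [leRHS]big_seq; apply: ler_sum => a aA.
  rewrite ler_wpM2l ?fval_ge0 // IH //; [exact: cL aA|lia].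
by rewrite -[leRHS]mulr1 ler_wpM2l ?ler0n // S1_le1 //; exact: gL.
Qed.

Lemma h1_gt0_step z n : good z -> ~~ isfin z -> 0 < h1 n.+2 z ->
  exists2 a, a \in arcs z & 0 < h1 n a.2.
Proof.
move=> gz nf; rewrite (h_step n gz nf).1 => H.
have [/hasP[a aA ha]|/hasPn nh] := boolP (has (fun a => 0 < h1 n a.2) (arcs z)); first by exists a.
move: H; rewrite big_seq big1 ?ltxx // => a aA.
by have := nh a aA; rewrite -leNgt => h; rewrite (@le_anti _ _ (h1 n a.2) 0) ?mulr0 // h h1_ge0.
Qed.

End ChainValue.

(** * The linear system of the chain *)

Section System.
Variable W : tpwn.
Implicit Types (x y z : timestamp W) (p q : place W).
Let ts := [seq raw_trans t | t <- enum (trans W)].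
Variable L : seq (timestamp W).
Hypotheses (uL : uniq L) (gL : forall z, z \in L -> good z) (cL : closedz L) (L0 : L != [::]).

Definition rowz z : seq nfrac :=
  rrow ts (bits_of [set snk W]%SET) [seq st_of y | y <- L] (st_of z).
Definition rowsz : seq (seq nfrac) := [seq rowz z | z <- L].
Definition arc_mass z y : nfrac := fsum [seq a.1 | a <- arcs z & a.2 == y].
(** The time still to be counted at a final state: the clock stands at the start of the last firing,
    not at its end. *)
Definition snkt z : nat := odflt 0%N (z (snk W)).

Lemma rowzE z : rowz z =
  if isfin z then [seq (0, 1)%N | y <- L] ++ [:: (1, 1)%N; (snkt z, 1)%N]
  else [seq arc_mass z y | y <- L] ++ [:: (0, 1)%N; (kz z, 1)%N].
Proof.
rewrite /rowz /rrow rfinalE -/(isfin z); case: (isfin z).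
  by rewrite -map_comp rstartE big_set1.
rewrite rsuccE -map_comp /=; congr (_ ++ _); apply: eq_map => y /=; congr fsum.
rewrite filter_map -map_comp; congr map; apply: eq_filter => a /=.
by rewrite (inj_eq (@st_of_inj W)).
Qed.

Lemma size_rowz z : size (rowz z) = (size L).+2.
Proof. by rewrite rowzE; case: ifP => _; rewrite size_cat size_map addn2. Qed.

Section Values.
Variable K : realFieldType.

Lemma rdot_cat A B (u v : seq K) : size A = size u -> rdot (A ++ B) (u ++ v) = rdot A u + rdot B v.
Proof. by elim: A u => [|a A IH] [|b u] //=; rewrite ?add0r // => -[/IH ->]; rewrite addrA. Qed.

Lemma rdot_map (T : Type) (f : T -> nfrac) (V : T -> K) (s : seq T) :
  rdot [seq f i | i <- s] [seq V i | i <- s] = \sum_(i <- s) fval (f i) * V i.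
Proof. by elim: s => [|i s IH] /=; rewrite ?big_nil // big_cons IH. Qed.

Lemma arc_massP z y : fwf (arc_mass z y) /\
  fval (arc_mass z y) = \sum_(a <- arcs z | a.2 == y) fval a.1 :> K.
Proof.
have w : all fwf [seq a.1 | a <- arcs z & a.2 == y].
  by apply/allP => _ /mapP[a + ->]; rewrite mem_filter => /andP[_ /(arcs_wf K)].
by have [-> ->] := fsumP K w; rewrite big_map big_filter.
Qed.

Lemma rowz_dot z (V : timestamp W -> K) a b : z \in L ->
  rdot (rowz z) ([seq V y | y <- L] ++ [:: a; b]) =
  if isfin z then a + (snkt z)%:R * b else \sum_(c <- arcs z) fval c.1 * V c.2 + (kz z)%:R * b.
Proof.
move=> zL; rewrite rowzE; case: ifP => _; rewrite rdot_cat ?size_map // rdot_map /=.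
  rewrite big1 ?add0r => [|y _]; last by rewrite /fval !mul0r.
  by rewrite /fval !divr1 mul1r addr0.
rewrite /fval !divr1 mul0r add0r addr0 -/(fval _); congr (_ + _).
under eq_bigr => y _ do rewrite -/(fval _) (arc_massP z y).2 mulr_suml.
under eq_bigr => y _ do rewrite big_mkcond /=.
rewrite exchange_big /= big_seq [RHS]big_seq; apply: eq_bigr => c cA.
rewrite -big_mkcond /= (eq_bigl (fun y => y == c.2)) => [|y]; last by rewrite eq_sym.
by rewrite -big_filter (filter_pred1_uniq uL (cL zL cA)) big_seq1.
Qed.

Lemma rowsz_stoch : @stoch K (size L).+2 rowsz.
Proof.
move=> _ /mapP[z zL ->].
have -> : rcons (nseq (size L).+2.-1 1) 0 = [seq 1 | y <- L] ++ [:: 1; 0] :> seq K.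
  by elim: (L) => //= y l <-.
rewrite rowz_dot //; case: ifP => _; rewrite mulr0 addr0 // -[RHS](arcs_sum K z).
by apply: eq_bigr => c _; rewrite mulr1.
Qed.

Lemma rowsz_solves (V : timestamp W -> K) a b :
  (forall z, z \in L -> V z = if isfin z then a + (snkt z)%:R * b
     else \sum_(c <- arcs z) fval c.1 * V c.2 + (kz z)%:R * b) ->
  solves rowsz ([seq V y | y <- L] ++ [:: a; b]).
Proof.
move=> H i; rewrite size_map => lt; have [z0 _] : exists z, z \in L.
  by exists (nth (tinit W) L i); exact: mem_nth.
rewrite nth_cat size_map lt (nth_map z0) // (nth_map z0) // rowz_dot ?mem_nth //.
by rewrite -H ?mem_nth.
Qed.

End Values.

Lemma rowsz_vrows : vrows (size L).+2 rowsz.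
Proof.
move=> _ /mapP[z zL ->]; split; first exact: size_rowz.
rewrite rowzE; case: ifP => _; rewrite all_cat /fwf /= ?coprime1n ?coprimen1 ?andbT.
  by apply/allP => _ /mapP[y _ ->].
by apply/allP => _ /mapP[y _ ->]; exact: (arc_massP rat z y).1.
Qed.

Lemma size_rowsz : size rowsz = size L.
Proof. exact: size_map. Qed.

Lemma rowsz_neq0 : rowsz != [::].
Proof. by move: L0; rewrite /rowsz; case: L. Qed.

End System.

(** * The result of the elimination is the expected time *)

Section Limit.
Variables (R : realType) (W : tpwn).
Implicit Types (x y z : timestamp W) (p : place W).
Local Notation Pz := (@Pz R W).
Local Notation Tz := (@Tz R W).

Lemma sum_arcs_fine (F : timestamp W -> \bar R) z :
  (forall a, a \in arcs z -> F a.2 \is a fin_num) ->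
  (\sum_(a <- arcs z) (fval a.1)%:E * F a.2)%E = (\sum_(a <- arcs z) fval a.1 * fine (F a.2))%:E.
Proof.
move=> fin; rewrite -sumEFin big_seq [RHS]big_seq; apply: eq_bigr => a aA.
by rewrite -[in LHS](fineK (fin a aA)).
Qed.

Lemma Pz_fin_num z : good z -> Pz z \is a fin_num.
Proof. by move=> gz; rewrite ge0_fin_numE ?Pz_ge0 // (le_lt_trans (Pz_le1 R gz)) ?ltry. Qed.

Lemma fine_Pz_step z : good z -> ~~ isfin z ->
  fine (Pz z) = \sum_(a <- arcs z) fval a.1 * fine (Pz a.2).
Proof.
move=> gz nf; rewrite Pz_step // sum_arcs_fine // => a aA; apply: Pz_fin_num.
exact: good_arcs aA.
Qed.

Section Finite.
Variable L : seq (timestamp W).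
Hypotheses (uL : uniq L) (gL : forall z, z \in L -> good z) (cL : closedz L) (L0 : L != [::]).

Lemma solves_rowsz (x : seq R) e z : size x = (size L).+2 -> drop (size L) x = e -> solves (rowsz L) x ->
  size e = 2 -> z \in L ->
  x`_(index z L) = if isfin z then e`_0 + (snkt z)%:R * e`_1
     else \sum_(c <- arcs z) fval c.1 * x`_(index c.2 L) + (kz z)%:R * e`_1.
Proof.
case: e => [|a [|b []]] // sx dx so _ zL.
have xE : x = [seq x`_(index y L) | y <- L] ++ [:: a; b].
  apply: (@eq_from_nth _ 0); first by rewrite size_cat size_map addn2.
  move=> i; rewrite sx => lt; rewrite nth_cat size_map; case: ltnP => le.
    by rewrite (nth_map z) // index_uniq.
  by rewrite -dx nth_drop subnKC.
have := so (index z L); rewrite /rowsz size_map index_mem => /(_ zL) ->.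
by rewrite (nth_map z) ?index_mem // nth_index // {1}xE rowz_dot.
Qed.

Variable q : nfrac.
Hypothesis sq : solve (rowsz L) = Some q.

Let sound : solved_by R (rowsz L) q.
Proof.
apply: (solve_sound (rowsz_neq0 L0) _ _ sq); rewrite size_rowsz; first exact: rowsz_vrows.
exact: rowsz_stoch.
Qed.

(** The hitting probabilities and the constant 1 both solve the system with stopping value 1 and
    reward coefficient 0, so uniqueness identifies them. *)
Lemma solved_Pz z : z \in L -> Pz z = 1%E.
Proof.
move=> zL; have [_ uq _ _] := sound; rewrite size_rowsz in uq.
pose V y := fine (Pz y).
have E : [seq V y | y <- L] ++ [:: 1; 0] = [seq 1 | y <- L] ++ [:: 1; 0].
  have sz (f : timestamp W -> R) : size ([seq f y | y <- L] ++ [:: 1; 0]) = (size L).+2.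
    by rewrite size_cat size_map addn2.
  have dr (f : timestamp W -> R) : drop (size L) ([seq f y | y <- L] ++ [:: 1; 0]) = [:: 1; 0].
    by rewrite drop_size_cat ?size_map.
  apply: uq; rewrite ?sz ?dr //; apply: rowsz_solves => // y yL; rewrite !mulr0 !addr0.
    by case: ifPn => fin; [rewrite /V Pz_fin|exact: fine_Pz_step (gL yL) fin].
  case: ifP => // _; rewrite -[LHS](arcs_sum R y); apply: eq_bigr => c _; by rewrite mulr1.
move: E => /eqP; rewrite eqseq_cat ?size_map // => /andP[/eqP/eq_in_map /(_ z zL) E _].
by rewrite -(fineK (Pz_fin_num (gL zL))); congr EFin.
Qed.

(** A nonnegative solution bounds the expected times through [Tz_le]. Being finite, they solve the
    system themselves, and the elimination returns their value at the last state. *)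
Lemma solved_Tz l z : L = rcons l z -> Tz z = (fval q)%:E.
Proof.
move=> LE; have [_ _ ex val] := sound; rewrite size_rowsz in ex val.
have [x [sx dx sox /allP x0]] := ex [:: 0; 1] erefl (ltac:(by rewrite /= lexx ler01)).
have xs y : y \in L -> _ := solves_rowsz sx dx sox erefl.
have fin y : y \in L -> Tz y \is a fin_num.
  move=> yL; rewrite ge0_fin_numE ?Tz_ge0 //; apply: le_lt_trans (ltry (x`_(index y L))).
  apply: (@Tz_le R W (fun y => x`_(index y L)) L gL cL _ _ _ y yL) => {yL}y yL.
  - by apply: x0; rewrite mem_nth // sx ltnS ltnW // ltnS ltnW // index_mem.
  - by move=> fy; rewrite xs // fy /= add0r mulr1.
  - by move=> /negPf nf; rewrite (xs y) // nf /= mulr1.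
pose V y := fine (Tz y).
have so : solves (rowsz L) ([seq V y | y <- L] ++ [:: 0; 1]).
  apply: rowsz_solves => // y yL; rewrite /V !mulr1 add0r; case: ifPn => fy; first by rewrite Tz_fin.
  rewrite (Tz_step R (gL yL) fy) solved_Pz // mule1 sum_arcs_fine => [|a aA].
    by rewrite -EFinD.
  by apply: fin; exact: cL aA.
have := val _ _ so _; rewrite size_cat size_map addn2 drop_size_cat ?size_map // => /(_ erefl erefl).
rewrite nth_cat size_map; have -> : ((size L).-1 < size L)%N by rewrite prednK // lt0n size_eq0.
rewrite (nth_map z); last by rewrite prednK // lt0n size_eq0.
have -> : nth z L (size L).-1 = z by rewrite LE size_rcons /= nth_rcons ltnn eqxx.
by move=> <-; rewrite fineK // fin // LE mem_rcons mem_head.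
Qed.

End Finite.

Let h1 n z : R := hitv (@one_val R W) n z.

Lemma pos_lbound (s : seq R) : (forall r, r \in s -> 0 < r) ->
  exists2 d, 0 < d < 1 & forall r, r \in s -> d <= r.
Proof.
elim: s => [|r s IH] H; first by exists (1 / 2) => //; lra.
have [r' r's|d /andP[d0 d1] D] := IH; first by apply: H; rewrite inE r's orbT.
exists (Num.min d r); first by rewrite lt_min d0 H ?mem_head //= gt_min d1.
by move=> r'; rewrite inE => /predU1P[->|/D h]; rewrite ge_min ?lexx ?orbT // h.
Qed.

(* If every state could reach the sink with positive probability, then
   [1 - d ^ n] with [n] the number of steps to the sink would be a strict
   supersolution of the system. *)
Lemma unsolved_dead L : uniq L -> (forall z, z \in L -> good z) -> closedz L -> L != [::] ->
  solve (rowsz L) = None -> exists2 z, z \in L & forall n, h1 n z = 0.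
Proof.
move=> uL gL cL L0 sN; apply: contrapT => nz.
have ex z : z \in L -> exists n, 0 < h1 n z.
  move=> zL; apply: contrapT => H; apply: nz; exists z => // n.
  have := @h1_ge0 R W n z; rewrite le_eqVlt => /predU1P[e|lt]; [exact: esym e|by case: H; exists n].
have [d d01 dP] : exists2 d : R, 0 < d < 1 &
    forall r, r \in flatten [seq [seq fval a.1 | a <- arcs z] | z <- L] -> d <= r.
  apply: pos_lbound => r /flattenP[_ /mapP[z _ ->]] /mapP[a aA ->].
  exact: arcs_gt0 aA.
have /andP[d0 d1] := d01.
pose dist z := if pselect (exists n, 0 < h1 n z) is left e then ex_minn e else 0%N.
have distP z : z \in L -> 0 < h1 (dist z) z /\ forall n, 0 < h1 n z -> (dist z <= n)%N.
  move=> /ex e; rewrite /dist; case: pselect => // e'; by case: ex_minnP.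
pose V z : R := 1 - d ^+ (dist z).+1.
have V0 z : 0 < V z by rewrite subr_gt0 exprn_ilt1 // ltW.
have := @solve_super R (rowsz L) ([seq V y | y <- L] ++ [:: 0; 0]) (rowsz_neq0 L0).
rewrite size_rowsz size_cat size_map addn2 sN => H; apply/idP: isT; apply: (H _ _ erefl) => {H}.
- exact: rowsz_vrows.
- exact: rowsz_stoch.
split.
  rewrite all_cat /= lexx !andbT; apply/allP => _ /mapP[y _ ->]; exact/ltW.
move=> i; rewrite size_rowsz => lt; have z0 := tinit W.
rewrite nth_cat size_map lt (nth_map z0) // (nth_map z0) //; move: (mem_nth z0 lt).
move: (nth z0 L i) => z zL {i lt}; split; first exact: V0.
rewrite rowz_dot //; case: ifPn => nf; rewrite !mulr0 addr0; first exact: V0.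
have [h hmin] := distP z zL; move: h hmin; case E : (dist z) => [|[|n]].
- by rewrite /h1 h1_0 (negPf nf) ltxx.
- by rewrite /h1 /= ltxx.
move=> h _; have [a aA ha] := h1_gt0_step (gL z zL) nf h.
have aL := cL z a zL aA.
have da : d <= fval a.1.
  by apply: dP; apply/flattenP; exists [seq fval a.1 | a <- arcs z]; exact: map_f.
have le : d ^+ n.+1 <= d ^+ (dist a.2).+1.
  by rewrite ler_wiXn2l ?ltW // ltnS (distP a.2 aL).2.
have eV : \sum_(c <- arcs z) fval c.1 * V c.2 =
    1 - \sum_(c <- arcs z) fval c.1 * d ^+ (dist c.2).+1.
  by rewrite -(arcs_sum R z) -sumrB; apply: eq_bigr => c _; rewrite mulrBr mulr1.
rewrite eV /V E ltrD2l ltrN2 (big_rem a) //=.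
apply: (@lt_le_trans _ _ (fval a.1 * d ^+ (dist a.2).+1)); last first.
  by rewrite lerDl sumr_ge0 // => c _; rewrite mulr_ge0 ?fval_ge0 // exprn_ge0 // ltW.
(* The arc costs one factor [d] but saves two steps of the MDP, which makes the inequality
   strict. *)
apply: (@lt_le_trans _ _ (d * d ^+ n.+1)); last first.
  by apply: ler_pM => //; [exact: ltW|exact/exprn_ge0/ltW].
by rewrite !exprS !ltr_pM2l ?exprn_gt0 // gtr_pMl ?exprn_gt0.
Qed.

(** States are found along arcs of positive probability, so a deficit in the hitting probability
    propagates back to the initial state. *)
Lemma Pz_back n z : z \in statesz W n -> (Pz z < 1)%E -> (Pz (tinit W) < 1)%E.
Proof.
elim: n z => [|n IH] z; first by rewrite inE => /eqP ->.
have [_ gL _] := statesz_inv W n.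
rewrite /statesz iterS -/(statesz W n).
have [_ _ _ h3] := foldl_addz (statesz W n) (newz (statesz W n)).
move=> /h3; rewrite mem_cat => /orP[|/flattenP[_ /mapP[y yL ->]] /mapP[a aA ->]]; first exact: IH.
move=> lt; apply: (IH y) => //.
have [fy|nf] := boolP (isfin y).
  by move: aA; rewrite /arcs bestz_fin // inE => /eqP E; rewrite E in lt.
have ga := good_arcs (gL y yL) aA.
rewrite -(fineK (Pz_fin_num (gL y yL))) lte_fin (fine_Pz_step (gL y yL) nf) -[ltRHS](arcs_sum R y).
rewrite (big_rem a) //= [ltRHS](big_rem a) //=; apply: ltr_leD.
  by rewrite gtr_pMr ?(arcs_gt0 R aA) // -lte_fin fineK ?Pz_fin_num.
rewrite big_seq [leRHS]big_seq; apply: ler_sum => c /mem_rem/(good_arcs (gL y yL)) gc.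
by rewrite ler_piMr ?fval_ge0 // -lee_fin (fineK (Pz_fin_num gc)) Pz_le1.
Qed.

Lemma is_ET_solve n : ((Hmax W + 2) ^ #|place W| <= n)%N ->
  is_ET W (ET_value R (omap (@fval rat) (solve (rowsz (statesz W n))))).
Proof.
move=> le S; have cL := statesz_closed le; have [uL gL [l E]] := statesz_inv W n.
have L0 : statesz W n != [::] by rewrite E -size_eq0 size_rcons.
rewrite sched_ET_series -/(Tz (tinit W)) /hit_prob -/(Pz (tinit W)).
case sq : (solve _) => [q|] /=.
  rewrite (solved_Tz uL gL cL L0 sq E) (solved_Pz uL gL cL L0 sq); last by rewrite E mem_rcons mem_head.
  by rewrite subee // mule0 adde0; congr EFin; rewrite /fval rmorphM fmorphV /= !rmorph_nat.
(* From [z] the final marking is never reached, so it is missed with positive probability from the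
   start and the term with +oo is infinite. *)
have [z zL z0] := unsolved_dead uL gL cL L0 sq.
have P0 : Pz z = 0%E by apply: eseries0 => m _ _; rewrite -/(h1 m z) z0.
have P1 : (Pz (tinit W) < 1)%E by apply: (Pz_back zL); rewrite P0.
have gi := good_init W.
rewrite gt0_mulye ?addey //; last by rewrite sube_gt0.
by rewrite gt_eqF // (lt_le_trans (ltNyr 0)) // Tz_ge0.
Qed.

End Limit.

(** * Complexity *)

Local Open Scope nat_scope.

(* The exponential cost is confined to the construction of [padding], whose
   length bounds the number of normalised timestamps: the rest of the program
   is polynomial in the padded input. *)
Definition bit_budget (r : raw) : seq bool :=
  true :: flatten [seq true :: nat_bits t.2.2 | t <- r.2].
Definition pad_exponent (r : raw) : seq bool := flatten [seq bit_budget r | _ <- r.1.1].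
Definition padding (r : raw) : seq bool :=
  foldl (fun p (_ : bool) => p ++ p) [:: true] (pad_exponent r).

Lemma FP_bit_budget : FP bit_budget.
Proof.
apply: FP_cons; first exact: FP_const.
apply: FP_flatten; apply: FP_map; last by fp.
by apply: FP_cons; [exact: FP_const|apply: FP_nat_bits; fp].
Qed.

Lemma FP_pad_exponent : FP pad_exponent.
Proof.
apply: FP_flatten; apply: FP_map; last by fp.
exact: FP_comp FP_bit_budget (FP_fst_ _ _).
Qed.

Lemma size_doubling (T : Type) (s : seq T) (b : bool) k :
  foldl (fun p _ => p ++ p) (nseq k b) s = nseq (k * 2 ^ size s) b.
Proof.
elim: s k => [|a s IH] k /=; first by rewrite muln1.
by rewrite -nseqD IH expnS mulnA muln2 addnn.
Qed.

Lemma sz_doubling (s : seq bool) :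
  sz (foldl (fun p (_ : bool) => p ++ p) [:: true] s) = 4 * 2 ^ size s + 1.
Proof.
rewrite -[[:: true]]/(nseq 1 true) size_doubling mul1n; elim: (2 ^ _) => // n IH.
by rewrite /= sz_cons IH /sz /=; lia.
Qed.

Section Padded.
Variable W : tpwn.

Lemma size_pad_exponent : size (pad_exponent (raw_of W)) = size (bit_budget (raw_of W)) * #|place W|.
Proof.
have -> : #|place W| = size (raw_of W).1.1 by rewrite size_map -cardE.
rewrite /pad_exponent; move: (bit_budget _) (raw_of W).1.1 => l s.
elim: s => [|b s IH] /=; first by rewrite muln0.
by rewrite size_cat IH mulnS.
Qed.

(** The leading element of the budget doubles the power of 2, which absorbs the [+ 2]. *)
Lemma Hmax_lt : Hmax W + 2 <= 2 ^ size (bit_budget (raw_of W)).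
Proof.
have gen (s : seq (trans W)) : \max_(t <- s) duration t <
    2 ^ size (flatten [seq true :: nat_bits (duration t) | t <- s]).
  elim: s => [|t s IH] /=; first by rewrite big_nil.
  rewrite big_cons size_cat expnS expnD; have := ltn_size_bits (duration t).
  by move: IH; set a := 2 ^ _; set b := 2 ^ _; rewrite gtn_max => h1 h2; apply/andP; split; nia.
have E : bit_budget (raw_of W) =
    true :: flatten [seq true :: nat_bits (duration t) | t <- enum (trans W)].
  by rewrite /bit_budget -map_comp.
have := gen (enum (trans W)); rewrite big_enum -/(Hmax W) E [size (_ :: _)]/= expnS.
by move: (Hmax W) (2 ^ _) => a b; lia.
Qed.

Lemma size_padding : size (padding (raw_of W)) =
  (2 ^ size (bit_budget (raw_of W))) ^ #|place W|.
Proof.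
by rewrite /padding -[[:: true]]/(nseq 1 true) size_doubling mul1n size_nseq size_pad_exponent expnM.
Qed.

Lemma padding_ge : (Hmax W + 2) ^ #|place W| <= size (padding (raw_of W)).
Proof.
rewrite size_padding leq_exp2r ?Hmax_lt // lt0n; apply/eqP => h.
by have := card0_eq h (src W).
Qed.

Lemma rrows_of pad : rrows (raw_of W) pad = rowsz (statesz W (size pad)).
Proof. by rewrite /rrows rstatesE -map_comp. Qed.

Lemma sz_st_of (z : timestamp W) k : (forall p, odflt 0 (z p) < 2 ^ k) ->
  sz (st_of z) <= 1 + #|place W| * (4 * k + 4).
Proof.
move=> H; have -> : #|place W| = size (st_of z) by rewrite size_map -cardE.
apply: leq_trans (sz_seq_le (B := 4 * k + 3) _) _; last by rewrite -addnS.
move=> i x0 lt; have p : place W by exact: src W.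
rewrite size_map in lt; rewrite (nth_map p) //; have := H (nth p (enum (place W)) i).
case: (z _) => [n|_]; last by rewrite /sz /=; lia.
by move=> /sz_nat_le h; rewrite sz_Some addn3; move: h; rewrite addn1.
Qed.

(** At every stage the length of the padding bounds the number of states, the number of places and
    the digits of each date. *)
Lemma sz_rstates i : let m := size (padding (raw_of W)) in
  sz (rstates (raw_of W).2 (rinit (raw_of W)) (take i (padding (raw_of W)))) <=
  1 + m * (1 + m * (4 * m + 4)).+1.
Proof.
lazy zeta; rewrite rstatesE; set m := size (padding _); set n := size (take _ _).
have [u g _] := statesz_inv W n.
have le := leq_trans (good_card u g) padding_ge; rewrite -/m in le.
have mE : m = 2 ^ (size (bit_budget (raw_of W)) * #|place W|) by rewrite expnM -size_padding.
have P0 : 0 < #|place W| by apply/card_gt0P; exists (src W).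
have l1 : size (bit_budget (raw_of W)) <= m.
  by rewrite mE; apply: leq_trans (ltnW (ltn_expl _ (isT : 1 < 2))); rewrite leq_pmulr.
have l2 : #|place W| <= m.
  by rewrite mE; apply: leq_trans (ltnW (ltn_expl _ (isT : 1 < 2))); rewrite leq_pmull.
apply: leq_trans (sz_seq_le (B := 1 + m * (4 * m + 4)) _) _ => [j x0|]; last first.
  by rewrite size_map leq_add2l leq_mul.
rewrite size_map => lt; rewrite (nth_map (tinit W)) //.
apply: leq_trans (sz_st_of (k := size (bit_budget (raw_of W))) _) _ => [p|].
  have [_ [_ [_ _ _ /(_ p) h]]] := g _ (mem_nth (tinit W) lt).
  by apply: leq_trans Hmax_lt; rewrite addn2 ltnS leqW.
by rewrite leq_add2l leq_mul //; lia.
Qed.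

End Padded.

(** This encoding is already exponential in the net, so polynomial time over it is single
    exponential time over the net. *)
Canonical padded_encType := EncType (fun W : tpwn => enc (raw_of W, padding (raw_of W))).

Lemma sz_padded (W : padded_encType) : sz W = (sz (raw_of W) + sz (padding (raw_of W))).+1.
Proof. by []. Qed.

Lemma FP_padded_raw : FP (fun W : padded_encType => raw_of W).
Proof.
apply: (FP_assign (e := Hd (Var 0))) => [s a /= -> //|a].
by have : sz (raw_of a) <= sz a; [rewrite sz_padded; lia|nia].
Qed.

Lemma FP_padding : FP (fun W : padded_encType => padding (raw_of W)).
Proof.
apply: (FP_assign (e := Tl (Var 0))) => [s a /= -> //|a].
by have : sz (padding (raw_of a)) <= sz a; [rewrite sz_padded; lia|nia].
Qed.

Lemma FP_rrows (X : encType) (r : X -> raw) (pad : X -> seq bool) :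
  FP r -> FP (fun a => rstates (r a).2 (rinit (r a)) (pad a)) -> FP (fun a => rrows (r a) (pad a)).
Proof.
move=> fr fs; have f1 := FP_comp fr (FP_fst_ X (seq_encType (option_encType nat_encType))).
have f2 := FP_comp fs (FP_fst_ X (seq_encType (option_encType nat_encType))).
apply: FP_map (fs); apply: FP_rrow f2 (FP_snd (FP_id _)); first exact: FP_snd f1.
exact: FP_snd (FP_fst f1).
Qed.

Definition output (o : option nfrac) : tree := if o is Some q then enc q else Leaf.

Lemma FP_output_time :
  FP (fun W : padded_encType => output (expected_time (raw_of W) (padding (raw_of W)))).
Proof.
have fr := FP_padded_raw; have fpad := FP_padding.
rewrite /output; apply: FP_match_option; [| |exact: FP_const]; last first.
  apply: (FP_assign (e := Tl (Var 0))) => [s a /= -> //|[W q]].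
  apply: (@leq_trans (sz (W, q))); last by move: (sz _) => n; nia.
  by rewrite sz_pair -[sz (enc _)]/(sz q) /= ltnW // ltnS leq_addl.
rewrite /expected_time; apply: FP_solve_rows => [W|W|W|].
- rewrite rrows_of; apply: rowsz_neq0.
  by have [_ _ [l ->]] := statesz_inv W (size (padding (raw_of W))); rewrite -size_eq0 size_rcons.
- by rewrite rrows_of size_rowsz; exact: rowsz_vrows.
- rewrite rrows_of size_rowsz; have [u _ _] := statesz_inv W (size (padding (raw_of W))).
  exact: rowsz_stoch u (statesz_closed (padding_ge W)) _.
apply: FP_rrows => //.
apply: (@FP_rstates _ (fun m => 1 + m * (1 + m * (4 * m + 4)).+1)) => //.
- by pbound.
- move=> W i; apply: leq_trans (sz_rstates W i) _.
  have h : size (padding (raw_of W)) <= sz W.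
    by apply: leq_trans (ltnW (size_le_sz _)) _; rewrite sz_padded ltnW // ltnS leq_addl.
  rewrite leq_add2l; apply: leq_mul => //; rewrite ltnS leq_add2l; apply: leq_mul => //; lia.
- by apply: FP_snd.
- by rewrite /rinit; apply: FP_map; fp.
Qed.

(** The 6 is the cost of the two assignments that join the programs, and [4 * 2 ^ N + 1] is the size
    of the padding. The three summands are at most 6, 1 and 1 times the same power of 2. *)
Lemma sum_exp_le s N e1 e2 :
  6 + (s + (4 * 2 ^ N + 1) + 2) ^ e1 + ((s + (4 * 2 ^ N + 1)).+1 + 2) ^ e2 <=
  8 * 2 ^ ((s + N + 4) * (e1 + e2)).
Proof.
have b k : k <= (s + (4 * 2 ^ N + 1)).+1 + 2 -> k <= 2 ^ (s + N + 4).
  move=> h; apply: leq_trans h _; rewrite !expnD; have := ltn_expl s (isT : 1 < 2).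
  by have : 0 < 2 ^ N by [rewrite expn_gt0]; move: (2 ^ s) (2 ^ N) => x y; nia.
have p e k : e <= e1 + e2 -> k <= 2 ^ (s + N + 4) -> k ^ e <= 2 ^ ((s + N + 4) * (e1 + e2)).
  move=> he hk; apply: leq_trans (_ : (2 ^ (s + N + 4)) ^ e <= _).
    by case: e {he} => // e; rewrite leq_exp2r.
  by rewrite -expnM leq_exp2l // leq_mul.
have h1 : (s + (4 * 2 ^ N + 1) + 2) ^ e1 <= _ := p _ _ (leq_addr _ _) (b _ _).
have {}h1 := h1 (leq_add (leqnSn _) (leqnn 2)).
have h2 := p e2 _ (leq_addl _ _) (b _ (leqnn _)).
have : 0 < 2 ^ ((s + N + 4) * (e1 + e2)) by rewrite expn_gt0.
move: h1 h2; move: (_ ^ e1) (_ ^ e2) (2 ^ ((s + N + 4) * _)) => x y z; lia.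
Qed.

Lemma expected_time_program : exists c (p : {poly nat}), forall W : tpwn,
  computes_within c (enc_tpwn W) (output (expected_time (raw_of W) (padding (raw_of W))))
    (8 * 2 ^ (p.[tree_size (enc_tpwn W)])%R).
Proof.
(* Building the padding is not polynomial in the raw net, so its loop is run with the explicit
   exponential bound instead of through [FP]. *)
have [c1 [m [e1 H1]]] := foldl_exec
  (X := prod_encType (prod_encType (seq_encType bool_encType) (seq_encType bool_encType)) _)
  (f := fun _ p (_ : bool) => p ++ p) (b := fun=> [:: true])
  (FP_cat (FP_fst (FP_snd (FP_id _))) (FP_fst (FP_snd (FP_id _)))) (FP_const _ _) FP_pad_exponent.
have [c2 [m2 [e2 [H2 _]]]] := FPE FP_output_time.
have [g [e0 He0] Sg] := sz_FP FP_pad_exponent.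
exists (Seq (Assign m.+1 (Var 0)) (Seq c1 (Seq (Assign 0 (Cons (Var m.+1) (Var 0))) c2))).
exists (('X + ('X + 2%N%:P) ^+ e0 + 4%N%:P) * (e1 + e2)%N%:P)%R => W.
set s := tree_size _; have sE : s = sz (raw_of W) by rewrite /s -enc_raw_of.
set N := size (pad_exponent (raw_of W)).
have NE : N <= (s + 2) ^ e0.
  by apply: leq_trans (He0 _); rewrite sE; apply: leq_trans (Sg _); exact: ltnW (size_le_sz _).
have [] := H1 (raw_of W) (4 * 2 ^ N + 1) _
  (set_var (set_var (fun=> Leaf) 0 (enc_tpwn W)) m.+1 (enc_tpwn W)).
- by move=> i; rewrite sz_doubling leq_add2r leq_mul // leq_exp2l // size_take; case: ifP => // /ltnW.
- by rewrite set_var_neq // set_var_eq enc_raw_of.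
move=> st1 [k1 [ex1 out1 keep1 cost1]].
have e1' : st1 m.+1 = enc_tpwn W by rewrite keep1 // set_var_eq.
have [st2 [k2 [ex2 out2 _ cost2]]] := H2 W
  (set_var st1 0 (Node (st1 m.+1) (st1 0))) (ltac:(by rewrite set_var_eq e1' out1 -enc_raw_of)).
have ex := exec_seq (exec_assign (set_var (fun=> Leaf) 0 (enc_tpwn W)) m.+1 (Var 0)) (exec_seq ex1
  (exec_seq (exec_assign st1 0 (Cons (Var m.+1) (Var 0))) ex2)).
exists st2; eexists; split; first exact: ex.
split; first exact: out2.
have -> : ((('X + ('X + 2%N%:P) ^+ e0 + 4%N%:P) * (e1 + e2)%N%:P) : {poly nat})%R.[s]%R =
    (s + (s + 2) ^ e0 + 4) * (e1 + e2).
  by rewrite hornerM !hornerD hornerX hornerC horner_exp hornerD hornerX !hornerC natrXE.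
apply: leq_trans (_ : 8 * 2 ^ ((s + N + 4) * (e1 + e2)) <= _); last first.
  by rewrite leq_mul // leq_exp2l // leq_mul // !leq_add2r leq_add2l.
apply: leq_trans (sum_exp_le _ _ _ _).
have szW : sz (W : padded_encType) = (s + (4 * 2 ^ N + 1)).+1.
  by rewrite sz_padded -sE /padding sz_doubling.
rewrite szW in cost2; rewrite -sE in cost1; move: cost1 cost2 => /=; lia.
Qed.

Lemma enc_rat_fval q : fwf q -> enc_rat (@fval rat q) = enc q.
Proof.
case: q => a b /andP[/= b0 co]; rewrite /enc_rat /fval /=.
have h := @coprimeq_num (Posz a) (Posz b) co; have h' := @coprimeq_den (Posz a) (Posz b) co.
rewrite -[(a%:R)%R]/((Posz a)%:~R)%R -[(b%:R)%R]/((Posz b)%:~R)%R h h' gtr0_sg // mul1r.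
by case: b b0 {co h h'}.
Qed.

Lemma ET_value_inj (R : realType) : injective (@ET_value R).
Proof. by move=> [p|] [q|] //= [] /(fmorph_inj (@ratr R)) ->. Qed.

Theorem theorem3 (R : realType) :
  (forall W : tpwn, exists v : option rat, is_ET W (ET_value R v)) /\
  (exists (c : cmd) (p : {poly nat}) (K : nat),
     forall (W : tpwn) (v : option rat), is_ET W (ET_value R v) ->
       computes_within c (enc_tpwn W) (enc_ET v)
         (K * 2 ^ (p.[tree_size (enc_tpwn W)])%R)).
Proof.
have val W := @is_ET_solve R W _ (padding_ge W).
split=> [W|]; first by eexists; exact: val.
have [c [p H]] := expected_time_program; exists c, p, 8 => W v /is_ET_unique/(_ (val W))/ET_value_inj ->.
have := H W; rewrite /expected_time rrows_of; case sq: (solve _) => [q|] //=.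
set n := size _ in sq; have [u gL [l E]] := statesz_inv W n.
have L0 : statesz W n != [::] by rewrite E -size_eq0 size_rcons.
have := @solve_sound R _ q (rowsz_neq0 L0); rewrite size_rowsz.
move=> /(_ (@rowsz_vrows W _) (rowsz_stoch u (statesz_closed (padding_ge W)) R) sq)[w _ _ _].
by rewrite enc_rat_fval.
Qed.
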